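(* For all integers $n \ge 0$, all boxes $A \subset \mathbb{R}^n$ and all numbers $\alpha,\beta_1,\dots,\beta_n \in (0,1]$ with $\alpha+\beta_1+\dots+\beta_n>n$, the function $$\int_A : \mathrm{H}^\alpha(A)\times \mathrm{H}^{\beta_1}(A)\times\dots\times \mathrm{H}^{\beta_n}(A)\to\mathbb{R},\qquad (f,g_1,\dots,g_n)\mapsto \int_A f\,dg := \lim_{k\to\infty} I_n(f,g,\mathcal P_k(A),\xi_k)$$ (defined recursively on $n$) is well defined and independent of the choice of the intermediate points $(\xi_k)_{k\in\mathbb N}$. It has the following properties. (1) $\int_A$ is $(n+1)$-linear. (2) In the case $\beta_1=\dots=\beta_n=1$, i.e. whenever $f\in \mathrm{H}^\alpha(A)$ and $g_1,\dots,g_n$ are Lipschitz, $$\int_A f\,dg=\int_A f\,\det Dg\,d\mathcal L^n$$ (for smooth $f$ and $g$ this agrees with $\int_A f\,dg_1\wedge\dots\wedge dg_n$). (3) $\int_A$ is continuous in the sense that $\int_A f_m\,dg_m\to\int_A f\,dg$ for $m\to\infty$ whenever $(f_m)_{m\in\mathbb N}$ and $(g_{m,i})_{m\in\mathbb N}$, $i=1,\dots,n$, are sequences converging uniformly on $A$ to $f$ and $g_i$ respectively, and $\mathrm{H}^\alpha(f_m)$ and $\mathrm{H}^{\beta_i}(g_{m,i})$ are bounded in $m$ for all $i=1,\dots,n$ (here $g_m=(g_{m,1},\dots,g_{m,n})$). Moreover, $\int_A$ is uniquely determined by (2) and (3).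
   Context: For a metric space $X$ and $\alpha\in(0,1]$, $\mathrm{H}^\alpha(X)$ is the set of functions $f:X\to\mathbb R$ for which there is $C\in[0,\infty)$ with $|f(x)-f(x')|\le C\,d(x,x')^\alpha$ for all $x,x'$; the smallest such $C$ is denoted $\mathrm{H}^\alpha(f)$. For $\alpha=1$ these are the Lipschitz functions. $\mathcal L^n$ is Lebesgue measure, and $Dg$ is the (almost everywhere defined) derivative of $g=(g_1,\dots,g_n)$. A box is a set $A=[u_1,v_1]\times\dots\times[u_n,v_n]\subset\mathbb R^n$ (with $u_i<v_i$). $\mathcal P_0(A)=\{A\}$, and $\mathcal P_{k+1}(A)$ is obtained from $\mathcal P_k(A)$ by dividing each box into $2^n$ similar boxes of half the size. $\xi_k=\{\xi_B\}_{B\in\mathcal P_k(A)}$ is any collection of points with $\xi_B\in B$. Recursive construction: in dimension $0$ the integral is evaluation of the function $f$ at the point. For $n\ge1$, assume the integral is constructed in dimensions $0,\dots,n-1$. For a box $B=[s_1,t_1]\times\dots\times[s_n,t_n]\subset A$ put $$B_{(i,j)}=[s_1,t_1]\times\dots\times[s_{i-1},t_{i-1}]\times\{s_i+j(t_i-s_i)\}\times[s_{i+1},t_{i+1}]\times\dots\times[s_n,t_n],\quad j\in\{0,1\},$$ identified with a box in $\mathbb R^{n-1}$ by omitting the $i$-th coordinate, and $$\int_{\partial B}g_1\,d(g_2,\dots,g_n):=\sum_{i=1}^n\sum_{j=0}^1(-1)^{i+j}\int_{B_{(i,j)}}g_1\,d(g_2,\dots,g_n),$$ with the functions restricted to $B_{(i,j)}$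 (for $n=1$: $\int_{\partial[s,t]}g=g(t)-g(s)$). Then for a partition $\mathcal P$ of $A$ into finitely many boxes with disjoint interiors and points $\xi_B\in B$, $$I_n(f,g,\mathcal P,\xi):=\sum_{B\in\mathcal P}f(\xi_B)\int_{\partial B}g_1\,d(g_2,\dots,g_n).$$ $\int_A f\,dg$ is also written $\int_A f\,d(g_1,\dots,g_n)$. *)

(* Defs.v *)
From HB Require Import structures.
From mathcomp Require Import all_boot all_order all_algebra.
From mathcomp Require Import perm.
From mathcomp Require Import all_classical all_reals all_analysis.

Set Implicit Arguments.
Unset Strict Implicit.
Unset Printing Implicit Defensive.

Import Order.TTheory GRing.Theory Num.Theory.
Import numFieldNormedType.Exports.

Local Open Scope classical_set_scope.
Local Open Scope ring_scope.

(* MathComp-Analysis has no measurable structure on ['rV[R]_n]; [L^n] is built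
   on [n.-tuple R] (with its product sigma-algebra) as the image of
   [L^1 \x L^(n-1)] under [(x, t) |-> x :: t]; [L^0] is the Dirac mass at the
   unique point. *)
Section lebesgue_measure_n.
Context {R : realType}.
Notation RT := (measurableTypeR R).

Definition tcons n (p : RT * n.-tuple RT) : n.+1.-tuple RT :=
  [the n.+1.-tuple RT of p.1 :: p.2].

Lemma measurable_tcons n : measurable_fun setT (@tcons n).
Proof. exact: (measurable_cons measurable_fst measurable_snd). Qed.

Section step.
Variables (n : nat) (mu : {sigma_finite_measure set (n.-tuple RT) -> \bar R}).

Definition lebesgue_step : set (n.+1.-tuple RT) -> \bar R :=
  pushforward ((@lebesgue_measure R) \x mu)%E (@tcons n).

Let step0 : lebesgue_step set0 = 0%E.
Proof. by rewrite /lebesgue_step /pushforward preimage_set0 measure0. Qed.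

Let step_ge0 X : (0 <= lebesgue_step X)%E.
Proof. by rewrite /lebesgue_step /pushforward; exact: measure_ge0. Qed.

Let step_sigma_additive : semi_sigma_additive lebesgue_step.
Proof.
move=> F mF tF mUF; rewrite /lebesgue_step /pushforward preimage_bigcup.
have mpre X : measurable X -> measurable (@tcons n @^-1` X).
  by move=> mX; rewrite -[X in measurable X]setTI; exact: measurable_tcons.
apply: measure_semi_sigma_additive.
- by move=> k; exact: mpre.
- apply/trivIsetP => /= i j _ _ ij; rewrite -preimage_setI.
  by move/trivIsetP : tF => /(_ _ _ _ _ ij) ->//; rewrite preimage_set0.
- by rewrite -preimage_bigcup; exact: mpre.
Qed.

HB.instance Definition _ := isMeasure.Build _ _ _ lebesgue_step
  step0 step_ge0 step_sigma_additive.

Lemma lebesgue_step_sigma_finite : sigma_finite setT lebesgue_step.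
Proof.
have /sigma_finiteP[F [FT ndF mF]] := sigma_finiteT (@lebesgue_measure R).
have /sigma_finiteP[G [GT ndG mG]] := sigma_finiteT mu.
exists (fun k => [set t | F k (thead t) /\ G k [tuple of behead t]]).
  apply/esym; rewrite -subTset => t _ /=.
  have : (\bigcup_k F k) (thead t) by rewrite -FT.
  have : (\bigcup_k G k) [tuple of behead t] by rewrite -GT.
  move=> [j _ Gj] [i _ Fi]; exists (maxn i j) => //; split.
    by move: Fi; apply/subsetPset/ndF; rewrite leq_maxl.
  by move: Gj; apply/subsetPset/ndG; rewrite leq_maxr.
move=> k; have [[mFk Fk] [mGk Gk]] := (mF k, mG k); split.
  rewrite (_ : [set _ | _] =
    ((fun t : n.+1.-tuple RT => tnth t ord0) @^-1` F k) `&`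
    ((fun t : n.+1.-tuple RT => [tuple of behead t]) @^-1` G k))//.
  apply: measurableI; rewrite -[X in measurable X]setTI.
    exact: measurable_tnth.
  exact: measurable_behead.
rewrite /lebesgue_step /pushforward.
rewrite [X in (_ \x _)%E X](_ : _ = F k `*` G k).
  by rewrite product_measure1E// lte_mul_pinfty// ge0_fin_numE.
have behead_cons (x : RT) (t : n.-tuple RT) :
    [tuple of behead (tcons (x, t))] = t by exact/val_inj.
by apply/seteqP; split=> -[x t] /=; rewrite behead_cons.
Qed.

HB.instance Definition _ := Measure_isSigmaFinite.Build _ _ _ lebesgue_step
  lebesgue_step_sigma_finite.

End step.

Fixpoint lebesgue_measure_n n :
    {sigma_finite_measure set (n.-tuple RT) -> \bar R} :=
  match n with
  | 0 => [the {sigma_finite_measure set (0.-tuple RT) -> \bar R}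
            of dirac [tuple]]
  | m.+1 => [the {sigma_finite_measure set (m.+1.-tuple RT) -> \bar R}
            of lebesgue_step (lebesgue_measure_n m)]
  end.

End lebesgue_measure_n.

Section definitions.
Context {R : realType}.

(* [A.1] and [A.2] are the corners [(u_i)_i] and [(v_i)_i] of
   [u_1, v_1] x ... x [u_n, v_n]. *)
Definition box n : Type := ('rV[R]_n * 'rV[R]_n)%type.

Definition proper_box n (A : box n) := forall i, A.1 0 i < A.2 0 i.

Definition box_set n (A : box n) : set 'rV[R]_n :=
  [set x | forall i, A.1 0 i <= x 0 i <= A.2 0 i].

Definition midpoint n (A : box n) : 'rV[R]_n := 2^-1 *: (A.1 + A.2).

Definition half_box n (A : box n) (s : {ffun 'I_n -> bool}) : box n :=
  (\row_i (if s i then midpoint A 0 i else A.1 0 i),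
   \row_i (if s i then A.2 0 i else midpoint A 0 i)).

Definition subdivide n (A : box n) : seq (box n) :=
  [seq half_box A s | s <- enum {ffun 'I_n -> bool}].

Definition dyadic n (k : nat) (A : box n) : seq (box n) :=
  iter k (fun P => flatten [seq subdivide B | B <- P]) [:: A].

Definition tagging n (A : box n) (xi : nat -> box n -> 'rV[R]_n) :=
  forall k B, B \in dyadic k A -> box_set B (xi k B).

(* Inclusion of the hyperplane [x_i = c]. *)
Definition insert_coord n (i : 'I_n.+1) (c : R) (x : 'rV[R]_n) : 'rV[R]_n.+1 :=
  \row_k (if unlift i k is Some l then x 0 l else c).

Definition omit_coord n (i : 'I_n.+1) (B : box n.+1) : box n :=
  (col' i B.1, col' i B.2).

Definition functional n :=
  box n -> ('rV[R]_n -> R) -> ('I_n -> 'rV[R]_n -> R) -> R.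

(* Indices start at 0 here, whence the exponent [i.+1 + j]. *)
Definition boundary_integral n (I : functional n) (B : box n.+1)
    (g : 'I_n.+1 -> 'rV[R]_n.+1 -> R) : R :=
  \sum_(i < n.+1) \sum_(j < 2)
    let c := B.1 0 i + j%:R * (B.2 0 i - B.1 0 i) in
    (-1) ^+ (i.+1 + j) *
    I (omit_coord i B) (g ord0 \o insert_coord i c)
      (fun k => g (lift ord0 k) \o insert_coord i c).

Definition riemann_sum n (I : functional n) (f : 'rV[R]_n.+1 -> R)
    (g : 'I_n.+1 -> 'rV[R]_n.+1 -> R) (P : seq (box n.+1))
    (xi : box n.+1 -> 'rV[R]_n.+1) : R :=
  \sum_(B <- P) f (xi B) * boundary_integral I B g.

(* [is_integral A f g v] : in dimension [>= 1], the Riemann sums converge to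
   [v] for every choice of the intermediate points.  The integral is the [v]
   with this property (and [0] if there is none). *)
Fixpoint is_integral n :
    box n -> ('rV[R]_n -> R) -> ('I_n -> 'rV[R]_n -> R) -> set R :=
  match n with
  | 0 => fun A f _ => [set f A.1]
  | m.+1 => fun A f g => [set v | forall xi, tagging A xi ->
      riemann_sum (fun B f' g' => xget 0 (@is_integral m B f' g')) f g
        (dyadic k A) (xi k) @[k --> \oo] --> v]
  end.

Definition integral_fdg n : functional n :=
  fun A f g => xget 0 (is_integral A f g).

Definition euclidean_dist n (x y : 'rV[R]_n) : R :=
  Num.sqrt (\sum_i (x 0 i - y 0 i) ^+ 2).

Definition holder_bounds n (X : set 'rV[R]_n) (a : R) (f : 'rV[R]_n -> R) :
    set R :=
  [set C | 0 <= C /\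
    forall x y, X x -> X y -> `|f x - f y| <= C * euclidean_dist x y `^ a].

(* Functions on [X] are represented by functions on the whole space, whose
   values outside [X] are irrelevant. *)
Definition holder n (X : set 'rV[R]_n) (a : R) (f : 'rV[R]_n -> R) : Prop :=
  holder_bounds X a f !=set0.

Definition holder_const n (X : set 'rV[R]_n) (a : R) (f : 'rV[R]_n -> R) : R :=
  inf (holder_bounds X a f).

(* [Dg] as a function on [X] : row [i] is the derivative of [g i].  ['J] is
   the total derivative of the library, in the row vector convention (hence
   the transpose).  The value [0] on the boundary makes [Dg] depend on
   [g] restricted to [X] only. *)
Definition deriv_on n (X : set 'rV[R]_n) (g : 'I_n -> 'rV[R]_n -> R)
    (x : 'rV[R]_n) : 'M[R]_n :=
  if x \in (X° : set _) then ('J (fun y : 'rV[R]_n => \row_i g i y) x)^T else 0.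

Definition lebesgue_integral_on n (X : set 'rV[R]_n) (F : 'rV[R]_n -> R) :
    \bar R :=
  (let pt (t : n.-tuple (measurableTypeR R)) : 'rV[R]_n := \row_i tnth t i in
   \int[lebesgue_measure_n n]_(t in pt @^-1` X) (F (pt t))%:E)%E.

Fixpoint ndifferentiable n (k : nat) (f : 'rV[R]_n -> R) : Prop :=
  match k with
  | 0 => True
  | l.+1 => (forall x, differentiable f x) /\
            (forall v, ndifferentiable l (fun x => 'D_v f x))
  end.

Definition smooth_fun n (f : 'rV[R]_n -> R) : Prop :=
  forall k, ndifferentiable k f.

(* Exterior product of the linear forms [w i], evaluated at the standard
   basis. *)
Definition wedge_std n (w : 'I_n -> 'rV[R]_n -> R) : R :=
  \sum_(s : 'S_n) (-1) ^+ s * \prod_i w i (delta_mx 0 (s i)).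

Section properties.
Variables (n : nat) (A : box n) (a : R) (b : 'I_n -> R).

Definition admissible (f : 'rV[R]_n -> R) (g : 'I_n -> 'rV[R]_n -> R) : Prop :=
  holder (box_set A) a f /\ forall i, holder (box_set A) (b i) (g i).

Definition update_at (g : 'I_n -> 'rV[R]_n -> R) (i : 'I_n) (h : 'rV[R]_n -> R) :=
  fun j => if j == i then h else g j.

Variable J : ('rV[R]_n -> R) -> ('I_n -> 'rV[R]_n -> R) -> R.

Definition multilinear : Prop :=
  (forall c f f' g, admissible f g -> admissible f' g ->
     J (fun x => c * f x + f' x) g = c * J f g + J f' g) /\
  (forall i c h h' f g, admissible f (update_at g i h) ->
     admissible f (update_at g i h') ->
     J f (update_at g i (fun x => c * h x + h' x)) =
     c * J f (update_at g i h) + J f (update_at g i h')).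

Definition lipschitz_formula : Prop :=
  forall f g, holder (box_set A) a f ->
    (forall i, holder (box_set A) 1 (g i)) ->
    (J f g)%:E = lebesgue_integral_on (box_set A)
                   (fun x => f x * \det (deriv_on (box_set A) g x)).

(* [\int_A f dg_1 /\ ... /\ dg_n], the integral of an [n]-form being that of
   its coefficient. *)
Definition smooth_formula : Prop :=
  forall f g, smooth_fun f -> (forall i, smooth_fun (g i)) ->
    (J f g)%:E = lebesgue_integral_on (box_set A)
                   (fun x => f x * wedge_std (fun i => 'd (g i) x)).

Definition holder_continuous : Prop :=
  forall (f_ : nat -> 'rV[R]_n -> R) (g_ : nat -> 'I_n -> 'rV[R]_n -> R) f g,
    (forall m, admissible (f_ m) (g_ m)) -> admissible f g ->
    {uniform box_set A, f_ @ \oo --> f} ->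
    (forall i, {uniform box_set A, (fun m => g_ m i) @ \oo --> g i}) ->
    (exists M, forall m, holder_const (box_set A) a (f_ m) <= M) ->
    (forall i, exists M, forall m,
       holder_const (box_set A) (b i) (g_ m i) <= M) ->
    J (f_ m) (g_ m) @[m --> \oo] --> J f g.

End properties.

End definitions.

(* Main.v *)
(* Measuring Hoelder constants in the supremum norm, an induction on [n] shows
   that on a box [B] of side at most [r],
     |int_B f dg| <= K (|f x| + H(f) r^a) prod_i H(g_i) r^(b_i)   (x in B).
   In the inductive step, int_{dB} g_1 d(g_2, ..., g_n) is additive under
   subdivision of [B] and unchanged by constants added to [g_1], hence is bounded
   by a multiple of prod_i r^(b_i); so successive Riemann sums differ by at most
   2^(nk) 2^(-k(a + sum b)), a geometric series.  As its ratio depends on the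
   exponents only, the convergence of the Riemann sums is uniform over bounded
   sets of Hoelder functions, which yields continuity under pointwise convergence.

   For Lipschitz [g], the quotient of int_B dg by the volume of [B] tends to
   det Dg(x) when the dyadic boxes [B] shrink to a point [x] of differentiability:
   [g] is close to its affine approximation uniformly at scale r, hence, by
   interpolation, in Hoelder norms with exponents slightly below 1, while the
   affine case is the Laplace expansion of the determinant.  The formula follows
   by Rademacher's theorem and dominated convergence.  Smooth functions are
   Lipschitz on the box.

   Uniqueness: the inf-convolutions x |-> inf_y (g_i(y) + k |x - y|) are Lipschitz,
   converge uniformly to [g_i], and have the same Hoelder constants as [g_i]. *)

From HB Require Import structures.
Require Import Defs.
From mathcomp Require Import all_boot all_order all_algebra.
From mathcomp Require Import ring lra zify.
From mathcomp Require Import all_classical all_reals all_analysis measurable_realfun.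

Import Order.TTheory GRing.Theory Num.Theory.
Import numFieldNormedType.Exports.

Set Implicit Arguments.
Unset Strict Implicit.
Unset Printing Implicit Defensive.

Local Open Scope classical_set_scope.
Local Open Scope ring_scope.

(** * Boxes and Hoelder functions *)

Section boxes.
Context {R : realType}.

(** Invariance under constants added to g_1 expresses that the boundary of a boundary vanishes: with
    g_1 constant, a boundary integral becomes an alternating sum over faces of codimension two,
    which cancel in pairs. It brings the factor r^(b_1) into the bound, since the bound one
    dimension lower contains the value |g_1(x)| and not only an oscillation. Interpolation is forced
    by what differentiability provides: g minus its affine approximation is small, relative to r, in
    the supremum norm, while the Lipschitz constant of the difference need not be small. The strict
    inequality 1 + n > n leaves room to lower the exponents of g slightly, and there the difference
    is small. Rademacher's theorem rests on the one-variable theorem along coordinate lines. To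
    combine partial slopes into a differential, nearby points are reached through points of a closed
    set K on which the slopes are controlled. The distance to K is itself Lipschitz, so the
    one-variable theorem applied to it supplies such points at almost every point of K. *)

Definition small_box n (r : R) (A : box n) :=
  forall i, A.1 0 i < A.2 0 i <= A.1 0 i + r.

Lemma small_box_proper n r (A : @box R n) : small_box r A -> proper_box A.
Proof. by move=> sA i; case/andP: (sA i). Qed.

Lemma proper_small_box n (A : @box R n) :
  proper_box A -> exists2 r, 0 < r & small_box r A.
Proof.
move=> pA; exists (1 + \sum_i `|A.2 0 i - A.1 0 i|).
  by rewrite ltr_wpDr// sumr_ge0.
move=> i; rewrite pA/= (bigD1 i)//=.
have : 0 <= \sum_(i0 < n | i0 != i) `|A.2 0 i0 - A.1 0 i0| by rewrite sumr_ge0.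
have := ler_norm (A.2 0 i - A.1 0 i); lra.
Qed.

Lemma midpointE n (A : @box R n) i : midpoint A 0 i = (A.1 0 i + A.2 0 i) / 2.
Proof. by rewrite !mxE mulrC. Qed.

Lemma half_box1 n (A : @box R n) s i :
  (half_box A s).1 0 i = if s i then midpoint A 0 i else A.1 0 i.
Proof. by rewrite mxE. Qed.

Lemma half_box2 n (A : @box R n) s i :
  (half_box A s).2 0 i = if s i then A.2 0 i else midpoint A 0 i.
Proof. by rewrite mxE. Qed.

Lemma half_box_small n r (A : @box R n) s :
  small_box r A -> small_box (r / 2) (half_box A s).
Proof.
move=> sA i; have := sA i; rewrite half_box1 half_box2 midpointE.
by case: (s i) => /andP[? ?]; apply/andP; split; lra.
Qed.

Lemma half_box_proper n (A : @box R n) s :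
  proper_box A -> proper_box (half_box A s).
Proof.
move=> /proper_small_box[r _ /(half_box_small s)]; exact: small_box_proper.
Qed.

Lemma half_box_sub n (A : @box R n) s :
  proper_box A -> box_set (half_box A s) `<=` box_set A.
Proof.
move=> pA x + i => /(_ i); have := pA i; rewrite half_box1 half_box2 midpointE.
by case: (s i) => ? /andP[? ?]; apply/andP; split; lra.
Qed.

Lemma corner_in n (A : @box R n) : proper_box A -> box_set A A.1.
Proof. by move=> pA i; rewrite lexx ltW. Qed.

Lemma big_subdivide (V : nmodType) n (A : @box R n) (F : box n -> V) :
  \sum_(B <- subdivide A) F B = \sum_s F (half_box A s).
Proof. by rewrite big_map big_enum. Qed.

Lemma big_dyadicS (V : nmodType) n k (A : @box R n) (F : box n -> V) :
  \sum_(B <- dyadic k.+1 A) F B =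
  \sum_(B <- dyadic k A) \sum_s F (half_box B s).
Proof.
rewrite /dyadic iterS big_flatten big_map.
by apply: eq_bigr => B _; rewrite big_subdivide.
Qed.

(** Peels off the first subdivision instead of the last: a Riemann sum of level [k.+1] on [A] is
    then the sum of those of level [k] on its halves, which makes the limit additive. *)
Lemma big_dyadicSr (V : nmodType) n k (A : @box R n) (F : box n -> V) :
  \sum_(B <- dyadic k.+1 A) F B =
  \sum_s \sum_(B <- dyadic k (half_box A s)) F B.
Proof.
elim: k F => [|k IH] F.
  rewrite big_dyadicS /dyadic/= big_seq1.
  by apply: eq_bigr => s _; rewrite big_seq1.
rewrite big_dyadicS IH; apply: eq_bigr => s _.
by rewrite big_dyadicS.
Qed.

Lemma dyadicSP n k (A B : @box R n) : B \in dyadic k.+1 A ->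
  exists2 B', B' \in dyadic k A & exists s, B = half_box B' s.
Proof.
rewrite /dyadic iterS => /flatten_mapP[B' B'A /mapP[s _ ->]].
by exists B' => //; exists s.
Qed.

Lemma dyadic_small n k r (A B : @box R n) :
  small_box r A -> B \in dyadic k A -> small_box (r / 2 ^+ k) B.
Proof.
move=> sA; elim: k B => [|k IH] B.
  by rewrite inE => /eqP ->; rewrite expr0 divr1.
move=> /dyadicSP[B' /IH sB' [s ->]].
by rewrite exprSr invfM mulrA; exact: half_box_small.
Qed.

Lemma dyadic_proper n k (A B : @box R n) :
  proper_box A -> B \in dyadic k A -> proper_box B.
Proof.
move=> /proper_small_box[r _ sA] /(dyadic_small sA); exact: small_box_proper.
Qed.

Lemma dyadic_sub n k (A B : @box R n) :
  proper_box A -> B \in dyadic k A -> box_set B `<=` box_set A.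
Proof.
move=> pA; elim: k B => [|k IH] B; first by rewrite inE => /eqP ->.
move=> /dyadicSP[B' B'A [s ->]]; apply: subset_trans (IH _ B'A).
exact/half_box_sub/(dyadic_proper pA B'A).
Qed.

Lemma sum_dyadic_cst n k (A : @box R n) (c : R) :
  \sum_(B <- dyadic k A) c = (2 ^+ n) ^+ k * c.
Proof.
elim: k => [|k IH]; first by rewrite /dyadic/= big_seq1 mul1r.
rewrite big_dyadicS; under eq_bigr do rewrite sumr_const.
rewrite card_ffun card_bool card_ord.
have -> : \sum_(B <- dyadic k A) c *+ 2 ^ n = (\sum_(B <- dyadic k A) c) *+ 2 ^ n.
  by rewrite sumrMnl.
by rewrite IH -[LHS]mulr_natl natrX exprS mulrA.
Qed.

Lemma dyadic_size n k (A B : @box R n) i : B \in dyadic k A ->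
  B.2 0 i - B.1 0 i = (A.2 0 i - A.1 0 i) / 2 ^+ k.
Proof.
elim: k B => [|k IH] B; first by rewrite inE => /eqP ->; rewrite expr0 divr1.
move=> /dyadicSP[B' /IH sB' [s ->]].
rewrite half_box1 half_box2 midpointE exprSr invfM mulrA -sB'.
by case: (s i); field.
Qed.

(** [is_integral] quantifies over all taggings, so uniqueness of the limit requires that one
    exists. *)
Definition corner_tag n (k : nat) (B : @box R n) := B.1.

Lemma corner_tagging n (A : @box R n) : proper_box A -> tagging A (@corner_tag n).
Proof. by move=> pA k B /(dyadic_proper pA); exact: corner_in. Qed.

(** Separates the choice of half in direction [i] from the others. Two halves that differ in
    direction [i] only share a middle face, while the remaining choices subdivide the faces
    orthogonal to [i]. *)
Definition ffun_insert n (i : 'I_n.+1) (p : bool * {ffun 'I_n -> bool}) :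
    {ffun 'I_n.+1 -> bool} :=
  [ffun k => if unlift i k is Some l then p.2 l else p.1].

Lemma sum_ffun_insert (V : nmodType) n (i : 'I_n.+1)
    (F : {ffun 'I_n.+1 -> bool} -> V) :
  \sum_s F s = \sum_(s : {ffun 'I_n -> bool}) \sum_(e : bool) F (ffun_insert i (e, s)).
Proof.
rewrite exchange_big pair_bigA/=.
rewrite (reindex (ffun_insert i))/=; first by apply: eq_bigr => -[].
exists (fun s : {ffun 'I_n.+1 -> bool} => (s i, [ffun l => s (lift i l)])).
  move=> [e s] _; congr pair; first by rewrite ffunE unlift_none.
  by apply/ffunP => l; rewrite !ffunE liftK.
move=> s _; apply/ffunP => k; rewrite ffunE.
by case: unliftP => [l ->|->]//=; rewrite ffunE.
Qed.

Lemma omit_half n (A : @box R n.+1) i e s :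
  omit_coord i (half_box A (ffun_insert i (e, s))) = half_box (omit_coord i A) s.
Proof.
by congr pair; apply/rowP => l; rewrite !mxE ffunE liftK.
Qed.

Lemma omit_small n r (A : @box R n.+1) i : small_box r A -> small_box r (omit_coord i A).
Proof. by move=> sA l; rewrite !mxE. Qed.

Lemma omit_proper n (A : @box R n.+1) i : proper_box A -> proper_box (omit_coord i A).
Proof. by move=> sA l; rewrite !mxE. Qed.

Lemma insert_coord_in n (A : @box R n.+1) i c x : A.1 0 i <= c <= A.2 0 i ->
  box_set (omit_coord i A) x -> box_set A (insert_coord i c x).
Proof.
move=> cA xA k; rewrite mxE; case: unliftP => [l ->|->]//.
by have := xA l; rewrite !mxE.
Qed.

Lemma insert_coord0 n (i : 'I_n.+1) (c : R) (x : 'rV[R]_n) :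
  insert_coord i c x 0 i = c.
Proof. by rewrite mxE unlift_none. Qed.

Lemma insert_coord_lift n (i : 'I_n.+1) (c : R) (x : 'rV[R]_n) l :
  insert_coord i c x 0 (lift i l) = x 0 l.
Proof. by rewrite mxE liftK. Qed.

Lemma face_coord n (A : @box R n) i (j : 'I_2) : proper_box A ->
  A.1 0 i <= A.1 0 i + j%:R * (A.2 0 i - A.1 0 i) <= A.2 0 i.
Proof.
move=> /(_ i); case: j => -[|[|//]] /= _ ?; rewrite ?mul0r ?mul1r; apply/andP; split; lra.
Qed.

End boxes.

Section holder_functions.
Context {R : realType}.

(* Hoelder continuity for the supremum norm, on the whole space: with this
   form restrictions to faces inherit the constant, and no membership
   conditions are needed. *)
Definition sup_holder n (a C : R) (f : 'rV[R]_n -> R) :=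
  forall (x y : 'rV[R]_n) (r : R), 0 <= r -> (forall i, `|x 0 i - y 0 i| <= r) ->
    `|f x - f y| <= C * r `^ a.

Lemma sup_holder_cst n a c : sup_holder a 0 (fun _ : 'rV[R]_n => c).
Proof. by move=> x y r _ _; rewrite subrr normr0 mul0r. Qed.

Lemma sup_holder_lin n a c C C' (f f' : 'rV[R]_n -> R) :
  sup_holder a C f -> sup_holder a C' f' ->
  sup_holder a (`|c| * C + C') (fun x => c * f x + f' x).
Proof.
move=> hf hf' x y r r0 xyr.
rewrite [X in `|X|](_ : _ = c * (f x - f y) + (f' x - f' y)); last by ring.
rewrite (le_trans (ler_normD _ _))// mulrDl lerD//; last exact: hf'.
by rewrite normrM -mulrA ler_wpM2l//; exact: hf.
Qed.

Lemma sup_holder_insert n a C (f : 'rV[R]_n.+1 -> R) i c :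
  sup_holder a C f -> sup_holder a C (f \o insert_coord i c).
Proof.
move=> hf x y r r0 xyr; apply: hf => // k; rewrite !mxE.
by case: (unlift i k) => [l|]//; rewrite subrr normr0.
Qed.

Lemma sup_holderW n a C C' (f : 'rV[R]_n -> R) :
  C <= C' -> sup_holder a C f -> sup_holder a C' f.
Proof.
move=> CC' hf x y r r0 xyr; apply: le_trans (hf _ _ _ r0 xyr) _.
by rewrite ler_wpM2r// powR_ge0.
Qed.

Lemma sup_holder_box n a C r (f : 'rV[R]_n -> R) (A : box n) x y :
  sup_holder a C f -> 0 <= r -> small_box r A -> box_set A x -> box_set A y ->
  `|f x - f y| <= C * r `^ a.
Proof.
move=> hf r0 sA xA yA; apply: hf => // i.
move: (sA i) (xA i) (yA i) => /andP[? ?] /andP[? ?] /andP[? ?].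
by rewrite ler_norml; apply/andP; split; lra.
Qed.

End holder_functions.

(** * Existence of the integral *)

Section sequences.
Context {R : realType}.

Lemma cvg_bigsum (T : eqType) (r : seq T) (F : nat -> T -> R) (l : T -> R) :
  (forall x, x \in r -> F k x @[k --> \oo] --> l x) ->
  \sum_(x <- r) F k x @[k --> \oo] --> \sum_(x <- r) l x.
Proof.
elim: r => [|x r IH] Fl.
  rewrite big_nil; under eq_fun do rewrite big_nil; exact: cvg_cst.
rewrite big_cons; under eq_fun do rewrite big_cons.
apply: cvgD; first by apply: Fl; rewrite mem_head.
by apply: IH => y yr; apply: Fl; rewrite inE yr orbT.
Qed.

Lemma cvg_bigsum_fin (T : finType) (F : nat -> T -> R) (l : T -> R) :
  (forall x, F k x @[k --> \oo] --> l x) ->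
  \sum_x F k x @[k --> \oo] --> \sum_x l x.
Proof. by move=> Fl; apply: cvg_bigsum. Qed.

Lemma cvg_geometric_increments (u : nat -> R) (D rho : R) :
  0 <= D -> 0 <= rho < 1 -> (forall k, `|u k.+1 - u k| <= D * rho ^+ k) ->
  exists2 l, u k @[k --> \oo] --> l &
    forall k, `|l - u k| <= D / (1 - rho) * rho ^+ k.
Proof.
move=> D0 /andP[rho0 rho1] uD.
set E := D / (1 - rho).
have r1 : 0 < 1 - rho by rewrite subr_gt0.
have E0 : 0 <= E by rewrite divr_ge0// ltW.
have ED : D = E - E * rho by rewrite -[X in X - _]mulr1 -mulrBr /E mulfVK// gt_eqF.
(* [E * rho ^+ k] is the sum of all increments from [k] on. Adding it makes [u] decreasing,
   subtracting it makes [u] increasing, and the limit is enclosed between the two. *)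
pose v k := u k + E * rho ^+ k; pose w k := u k - E * rho ^+ k.
have p0 k : 0 <= E * rho ^+ k by rewrite mulr_ge0// exprn_ge0.
have vS k : v k.+1 <= v k.
  rewrite /v exprS; have := uD k; rewrite ED ler_norml => /andP[_].
  rewrite mulrBl -mulrA; lra.
have wS k : w k <= w k.+1.
  rewrite /w exprS; have := uD k; rewrite ED ler_norml => /andP[+ _].
  rewrite mulrBl -mulrA; lra.
have vni : {homo v : n m / (n <= m)%N >-> m <= n}.
  exact: (@homo_leq _ _ (fun x y => y <= x) (fun=> lexx _) (fun _ _ _ h1 h2 => le_trans h2 h1)).
have wnd : {homo w : n m / (n <= m)%N >-> n <= m}.
  exact: (@homo_leq _ _ (fun x y => x <= y) (fun=> lexx _) (fun _ _ _ h1 h2 => le_trans h1 h2)).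
have wv k m : w k <= v m.
  apply: (le_trans (wnd _ _ (leq_maxl k m))); apply: le_trans _ (vni _ _ (leq_maxr k m)).
  by rewrite /w /v; have := p0 (maxn k m); lra.
have vlb : has_lbound (range v) by exists (w 0%N) => _ [k _ <-]; exact: wv.
exists (inf (range v)).
  rewrite [X in X k @[k --> _]](_ : u = fun k => v k - E * rho ^+ k); last first.
    by apply/funext => k; rewrite /v addrK.
  rewrite -[X in _ --> X]subr0; apply: cvgB; first exact: nonincreasing_cvgn.
  rewrite -[X in _ --> X](mulr0 E); apply: cvgMr.
  by apply: cvg_expr; rewrite ger0_norm.
move=> k; rewrite ler_norml; apply/andP; split.
  have : w k <= inf (range v).
    by apply: lb_le_inf; [exists (v 0%N), 0%N|move=> _ [m _ <-]; exact: wv].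
  rewrite /w; lra.
have : inf (range v) <= v k by apply: ge_inf => //; exists k.
rewrite /v; lra.
Qed.

End sequences.

Section integral_basics.
Context {R : realType}.

Lemma is_integralS n (A : @box R n.+1) f g v :
  is_integral A f g v = forall xi, tagging A xi ->
    riemann_sum (@integral_fdg R n) f g (dyadic k A) (xi k) @[k --> \oo] --> v.
Proof. by []. Qed.

Lemma rowR0_eq (x y : 'rV[R]_0) : x = y.
Proof. by apply/rowP => -[]. Qed.

Lemma is_integral_uniq n (A : @box R n) f g v w : proper_box A ->
  is_integral A f g v -> is_integral A f g w -> v = w.
Proof.
case: n A f g => [|n] A f g pA; first by move=> -> ->.
rewrite !is_integralS => /(_ _ (corner_tagging pA)) hv /(_ _ (corner_tagging pA)) hw.
exact: (cvg_unique _ hv hw).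
Qed.

Lemma integral_fdg_eq n (A : @box R n) f g v : proper_box A ->
  is_integral A f g v -> integral_fdg A f g = v.
Proof.
by move=> pA vP; apply: xget_unique => // w /is_integral_uniq; apply.
Qed.

Lemma integral_fdg0 (A : @box R 0) f g : integral_fdg A f g = f A.1.
Proof. by apply: integral_fdg_eq => // -[]. Qed.

Lemma eq_boundary_integral n (I : functional n) (A : box n.+1)
    (g g' : 'I_n.+1 -> 'rV[R]_n.+1 -> R) :
  (forall (B : box n) f f' h h', proper_box B -> {in box_set B, f =1 f'} ->
    (forall i, {in box_set B, h i =1 h' i}) -> I B f h = I B f' h') ->
  proper_box A -> (forall i, {in box_set A, g i =1 g' i}) ->
  boundary_integral I A g = boundary_integral I A g'.
Proof.
move=> HI pA gg'; apply: eq_bigr => i _; apply: eq_bigr => j _ /=; congr (_ * _).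
have inA x : box_set (omit_coord i A) x ->
    box_set A (insert_coord i (A.1 0 i + j%:R * (A.2 0 i - A.1 0 i)) x).
  by apply: insert_coord_in; exact: face_coord.
by apply: HI; [exact: omit_proper| |] => [x|k x] /set_mem/inA/mem_set; exact: gg'.
Qed.

(** Only values on the box enter, at every level of the recursion. Hence functions given on [A] can
    be replaced by globally Hoelder extensions. *)
Lemma eq_is_integral n (A : @box R n) f f' g g' : proper_box A ->
  {in box_set A, f =1 f'} -> (forall i, {in box_set A, g i =1 g' i}) ->
  is_integral A f g = is_integral A f' g'.
Proof.
elim: n A f f' g g' => [|n IH] A f f' g g' pA ff' gg'.
  by rewrite /= ff'//; apply/mem_set => -[].
have H xi k : tagging A xi ->
    riemann_sum (@integral_fdg R n) f g (dyadic k A) (xi k) =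
    riemann_sum (@integral_fdg R n) f' g' (dyadic k A) (xi k).
  move=> xiA; apply: eq_big_seq => B BA; congr (_ * _).
    by apply: ff'; apply/mem_set/(dyadic_sub pA BA)/xiA.
  apply: eq_boundary_integral; [|exact: (dyadic_proper pA BA)|].
    by move=> F h h' k1 k2 pF hh' kk; rewrite /integral_fdg (IH F h h' k1 k2).
  by move=> i x /set_mem/(dyadic_sub pA BA)/mem_set; exact: gg'.
apply/seteqP; split=> v; rewrite !is_integralS => vP xi xiA.
  by under eq_fun do rewrite -H//; exact: vP.
by under eq_fun do rewrite H//; exact: vP.
Qed.

Lemma eq_integral_fdg n (A : @box R n) f f' g g' : proper_box A ->
  {in box_set A, f =1 f'} -> (forall i, {in box_set A, g i =1 g' i}) ->
  integral_fdg A f g = integral_fdg A f' g'.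
Proof. by move=> pA ff' gg'; rewrite /integral_fdg (eq_is_integral pA ff' gg'). Qed.

Definition face_integral n (I : functional n) (g : 'I_n.+1 -> 'rV[R]_n.+1 -> R)
    (i : 'I_n.+1) (c : R) (F : box n) : R :=
  I F (g ord0 \o insert_coord i c) (fun k => g (lift ord0 k) \o insert_coord i c).

Lemma boundary_integralE n (I : functional n) A (g : 'I_n.+1 -> 'rV[R]_n.+1 -> R) :
  boundary_integral I A g = \sum_(i < n.+1) (-1) ^+ i *
    (face_integral I g i (A.2 0 i) (omit_coord i A) -
     face_integral I g i (A.1 0 i) (omit_coord i A)).
Proof.
apply: eq_bigr => i _; rewrite big_ord_recl big_ord1/= mul0r addr0 mul1r.
rewrite (addrC (A.1 0 i)) subrK -/(face_integral I g i _ _).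
rewrite -/(face_integral I g i (A.2 0 i) _) addn0 addn1 !exprS; ring.
Qed.

Lemma eq_integral_fdg_total n (A : @box R n) f f' g g' :
  f =1 f' -> (forall i, g i =1 g' i) -> integral_fdg A f g = integral_fdg A f' g'.
Proof.
move=> /funext -> gg'; congr integral_fdg.
by apply/funext => i; apply/funext.
Qed.

End integral_basics.

Section existence.
Context {R : realType}.

Definition admissible_exponents n (a : R) (b : 'I_n -> R) :=
  [/\ 0 < a <= 1, forall i, 0 < b i <= 1 & n%:R < a + \sum_i b i].

Definition face_exponents n (b : 'I_n.+1 -> R) :=
  @admissible_exponents n (b ord0) (fun k => b (lift ord0 k)).

(** The recursion closes because [a <= 1]: dropping [a] costs at most one, as much as the dimension
    drops, and [b ord0] takes over the role of [a] on the faces. *)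
Lemma admissible_face_exponents n a (b : 'I_n.+1 -> R) :
  admissible_exponents a b -> face_exponents b.
Proof.
move=> [/andP[a0 a1] b01 nab]; split => //.
by move: nab; rewrite big_ord_recl -natr1; lra.
Qed.

(* The bound is stated with an arbitrary point [x] of the box: in the next
   dimension it is applied to [f - f x]. *)
Definition integral_bound n (a : R) (b : 'I_n -> R) (K : R) :=
  forall A r (f : 'rV[R]_n -> R) g Cf (Cg : 'I_n -> R), 0 <= r -> small_box r A ->
  sup_holder a Cf f -> (forall i, sup_holder (b i) (Cg i) (g i)) ->
  is_integral A f g (integral_fdg A f g) /\
  forall x, box_set A x -> `|integral_fdg A f g| <=
    K * (`|f x| + Cf * r `^ a) * \prod_i (Cg i * r `^ b i).

Definition integral_exists n := forall a (b : 'I_n -> R),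
  admissible_exponents a b -> exists2 K, 0 <= K & integral_bound a b K.

Lemma sup_holder_ge0 n a C (f : 'rV[R]_n -> R) : sup_holder a C f -> 0 <= C.
Proof.
move=> /(_ 0 0 1 ler01); rewrite subrr normr0 powR1 mulr1; apply.
by move=> i; rewrite subrr normr0.
Qed.

Section step.
Variable n : nat.
Hypothesis IHn : integral_exists n.

Lemma exists_is_integral a (b : 'I_n -> R) A f g Cf Cg :
  admissible_exponents a b -> proper_box A ->
  sup_holder a Cf f -> (forall i, sup_holder (b i) (Cg i) (g i)) ->
  is_integral A f g (integral_fdg A f g).
Proof.
move=> /IHn[K K0 bK] /proper_small_box[r r0 sA] hf hg.
by have [] := bK _ _ _ _ _ _ (ltW r0) sA hf hg.
Qed.

End step.

Lemma riemann_sum_cvg n a (b : 'I_n.+1 -> R) (A : box n.+1) f g Cf Cg xi :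
  integral_exists n.+1 -> admissible_exponents a b -> proper_box A ->
  sup_holder a Cf f -> (forall i, sup_holder (b i) (Cg i) (g i)) ->
  tagging A xi ->
  riemann_sum (@integral_fdg R n) f g (dyadic k A) (xi k) @[k --> \oo] -->
    integral_fdg A f g.
Proof.
move=> IH ab pA hf hg xiA.
by have := exists_is_integral IH ab pA hf hg; rewrite is_integralS; apply.
Qed.

Lemma integral_additive n a (b : 'I_n -> R) A f g Cf Cg :
  integral_exists n -> admissible_exponents a b -> proper_box A ->
  sup_holder a Cf f -> (forall i, sup_holder (b i) (Cg i) (g i)) ->
  integral_fdg A f g = \sum_s integral_fdg (half_box A s) f g.
Proof.
case: n b A f g Cg => [|n] b A f g Cg IH ab pA hf hg.
  rewrite integral_fdg0; under eq_bigr do rewrite integral_fdg0.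
  rewrite (eq_bigr (fun=> f A.1)); last by move=> s _; congr f; exact: rowR0_eq.
  by rewrite sumr_const card_ffun card_bool card_ord expn0 mulr1n.
have h1 := riemann_sum_cvg IH ab pA hf hg (corner_tagging pA).
have h2 s := riemann_sum_cvg IH ab (half_box_proper s pA) hf hg
  (corner_tagging (half_box_proper s pA)).
have h3 := cvg_bigsum_fin h2.
move: h1; rewrite -cvg_shiftS; under eq_fun do rewrite /riemann_sum big_dyadicSr.
move=> h1; exact: (cvg_unique _ h1 h3).
Qed.

Lemma integral_linear_integrand n a (b : 'I_n -> R) A c f f' g Cf Cf' Cg :
  integral_exists n -> admissible_exponents a b -> proper_box A ->
  sup_holder a Cf f -> sup_holder a Cf' f' ->
  (forall i, sup_holder (b i) (Cg i) (g i)) ->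
  integral_fdg A (fun x => c * f x + f' x) g =
  c * integral_fdg A f g + integral_fdg A f' g.
Proof.
case: n b A f f' g Cg => [|n] b A f f' g Cg IH ab pA hf hf' hg.
  by rewrite !integral_fdg0.
have h1 := riemann_sum_cvg IH ab pA (sup_holder_lin c hf hf') hg (corner_tagging pA).
have h2 := riemann_sum_cvg IH ab pA hf hg (corner_tagging pA).
have h3 := riemann_sum_cvg IH ab pA hf' hg (corner_tagging pA).
have h4 : c * riemann_sum (@integral_fdg R n) f g (dyadic k A) (@corner_tag R _ k) +
    riemann_sum (@integral_fdg R n) f' g (dyadic k A) (@corner_tag R _ k)
    @[k --> \oo] --> c * integral_fdg A f g + integral_fdg A f' g.
  by apply: cvgD h3; apply: cvgM h2; exact: cvg_cst.
move: h1; under eq_fun => k.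
  rewrite (_ : riemann_sum _ _ _ _ _ = c * riemann_sum (@integral_fdg R n) f g
    (dyadic k A) (@corner_tag R _ k) + riemann_sum (@integral_fdg R n) f' g
    (dyadic k A) (@corner_tag R _ k)); first over.
  rewrite /riemann_sum mulr_sumr -big_split/=.
  by apply: eq_bigr => B _; ring.
by move=> h1; exact: (cvg_unique _ h1 h4).
Qed.

End existence.

(** * Boundary integrals: additivity, and the boundary of a boundary *)

Section boundary.
Context {R : realType}.

Lemma face_additive n (b : 'I_n.+1 -> R) (F : box n) g Cg i c :
  @integral_exists R n -> face_exponents b -> proper_box F ->
  (forall i, sup_holder (b i) (Cg i) (g i)) ->
  face_integral (@integral_fdg R n) g i c F =
  \sum_s face_integral (@integral_fdg R n) g i c (half_box F s).
Proof.
move=> IH fb pF hg; apply: (integral_additive IH fb pF (Cf := Cg ord0)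
  (Cg := fun k => Cg (lift ord0 k))) => [|k]; exact: sup_holder_insert.
Qed.

(** In each direction the middle face belongs to two halves with opposite signs and cancels; the
    outer faces of [A] are the sums of the outer faces of the halves, as the integral one dimension
    lower is additive. *)
Lemma boundary_additive n (b : 'I_n.+1 -> R) (A : box n.+1) g Cg :
  @integral_exists R n -> face_exponents b -> proper_box A ->
  (forall i, sup_holder (b i) (Cg i) (g i)) ->
  boundary_integral (@integral_fdg R n) A g =
  \sum_s boundary_integral (@integral_fdg R n) (half_box A s) g.
Proof.
move=> IH fb pA hg; rewrite boundary_integralE.
under [in RHS]eq_bigr do rewrite boundary_integralE.
rewrite exchange_big; apply: eq_bigr => i _ /=.
rewrite -mulr_sumr; congr (_ * _).
rewrite (sum_ffun_insert i)/=.
have pF := omit_proper i pA.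
rewrite !(face_additive i _ IH fb pF hg) -sumrB; apply: eq_bigr => s _.
rewrite big_bool/= !half_box1 !half_box2 !omit_half !ffunE !unlift_none/=.
by ring.
Qed.

Lemma sum_boundary_dyadic n (b : 'I_n.+1 -> R) (A : box n.+1) g Cg k :
  @integral_exists R n -> face_exponents b -> proper_box A ->
  (forall i, sup_holder (b i) (Cg i) (g i)) ->
  \sum_(B <- dyadic k A) boundary_integral (@integral_fdg R n) B g =
  boundary_integral (@integral_fdg R n) A g.
Proof.
move=> IH fb pA hg; elim: k => [|k IHk]; first by rewrite /dyadic/= big_seq1.
rewrite big_dyadicS -IHk; apply: eq_big_seq => B BA.
exact/esym/(boundary_additive IH fb (dyadic_proper pA BA) hg).
Qed.

(** By additivity the Riemann sums of a constant are the same at all levels and for all taggings.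
    This is the case of Stokes' formula used throughout. *)
Lemma integral_fdg_cst n (b : 'I_n.+1 -> R) (A : box n.+1) c g Cg :
  @integral_exists R n -> face_exponents b -> proper_box A ->
  (forall i, sup_holder (b i) (Cg i) (g i)) ->
  integral_fdg A (fun=> c) g = c * boundary_integral (@integral_fdg R n) A g.
Proof.
move=> IH fb pA hg; apply: integral_fdg_eq => //; rewrite is_integralS => xi xiA.
rewrite /riemann_sum; under eq_fun do
  rewrite -mulr_sumr (sum_boundary_dyadic _ IH fb pA hg).
exact: cvg_cst.
Qed.

(** The sign rule behind a vanishing double boundary: the larger of two removed indices moves down
    by one when the smaller is removed before it, so exchanging the order of removal flips the
    sign. *)
Lemma alternating_pairs_eq0 n (W : 'I_n.+2 -> 'I_n.+2 -> R) :
  (forall i m, i != m -> W i m = W m i) ->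
  \sum_(i < n.+2) \sum_(k < n.+1) (-1) ^+ (i + k) * W i (lift i k) = 0.
Proof.
move=> Wsym.
have sgnE (p q : nat) : p != q ->
    (-1) ^+ (q + unbump q p) = - (-1) ^+ (p + unbump p q) :> R.
  wlog pq : p q / (p < q)%N => [hw|_].
    move=> pq; have := pq; rewrite neq_ltn => /orP[] ?; first exact: hw.
    by rewrite [in RHS]hw ?opprK// eq_sym.
  rewrite /unbump pq ltnNge (ltnW pq)/= subn0 subn1.
  by rewrite (_ : q + p = (p + q.-1).+1)%N ?exprS ?mulN1r//; lia.
pose H (i m : 'I_n.+2) : R :=
  if i != m then (-1) ^+ (i + unbump i m) * W i m else 0.
rewrite (eq_bigr (fun i => \sum_m H i m)); last first.
  move=> i _; rewrite (bigD1_ord i)//= {1}/H eqxx add0r.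
  by apply: eq_bigr => k _; rewrite /H neq_lift/= bumpK.
have : \sum_i \sum_m H i m = - \sum_i \sum_m H i m.
  rewrite {1}exchange_big -sumrN; apply: eq_bigr => i _.
  rewrite -sumrN; apply: eq_bigr => m _; rewrite /H eq_sym.
  case: ifPn => [im|]; last by rewrite oppr0.
  rewrite Wsym; last by rewrite eq_sym.
  by rewrite -mulNr sgnE.
lra.
Qed.

(** A face of codimension two fixes the coordinates [i] and [m]. It is reached by removing [i]
    first, after which [m] has index [k], or [m] first, after which [i] has index [k']. *)
Lemma lift_lift_swap n (i m : 'I_n.+2) (k k' : 'I_n.+1) (l : 'I_n) :
  lift i k = m -> lift m k' = i -> lift i (lift k l) = lift m (lift k' l).
Proof.
move=> /(congr1 val)/= e1 /(congr1 val)/= e2; apply/val_inj => /=.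
move: e1 e2; rewrite /bump; case: i k k' m l => [i ?] [k ?] [k' ?] [m ?] [l ?] /=.
lia.
Qed.

Lemma insert_insert_swap n (i m : 'I_n.+2) (k k' : 'I_n.+1) (c d : R)
    (x : 'rV[R]_n) :
  lift i k = m -> lift m k' = i ->
  insert_coord i c (insert_coord k d x) = insert_coord m d (insert_coord k' c x).
Proof.
move=> ikm mki; apply/rowP => t.
case: (unliftP i t) => [u ->|->].
  rewrite insert_coord_lift; case: (unliftP k u) => [l ->|->].
    by rewrite insert_coord_lift (lift_lift_swap _ ikm mki) !insert_coord_lift.
  by rewrite ikm !insert_coord0.
by rewrite insert_coord0 -[in RHS]mki insert_coord_lift insert_coord0.
Qed.

Lemma omit_omit_swap n (A : @box R n.+2) (i m : 'I_n.+2) (k k' : 'I_n.+1) :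
  lift i k = m -> lift m k' = i ->
  omit_coord k (omit_coord i A) = omit_coord k' (omit_coord m A).
Proof.
by move=> ikm mki; congr pair; apply/rowP => l; rewrite !mxE
  (lift_lift_swap _ ikm mki).
Qed.

Definition side n (A : @box R n) (p : bool) : 'rV[R]_n := if p then A.2 else A.1.

Lemma boundary_integral_side n (I : functional n) A (g : 'I_n.+1 -> 'rV[R]_n.+1 -> R) :
  boundary_integral I A g = \sum_(i < n.+1) \sum_(p : bool) (-1) ^+ (i + ~~ p) *
    face_integral I g i (side A p 0 i) (omit_coord i A).
Proof.
rewrite boundary_integralE; apply: eq_bigr => i _; rewrite big_bool/=.
by rewrite addn0 addn1 exprS; ring.
Qed.

(** With [g ord0] constant, each face integral is [c] times a boundary integral by
    [integral_fdg_cst], so the total runs over faces of codimension two and cancels. Two dimensions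
    are descended, whence the hypothesis for [n.-1]. *)
Lemma boundary_integral_cst n (b : 'I_n.+1 -> R) (A : box n.+1) c g Cg :
  (forall m, m = n.-1 -> @integral_exists R m) ->
  face_exponents b -> b ord0 <= 1 -> proper_box A ->
  (forall i, sup_holder (b i) (Cg i) (g i)) -> g ord0 = (fun=> c) ->
  boundary_integral (@integral_fdg R n) A g = 0.
Proof.
move=> IH fb b01 pA hg g0.
case: n b A g Cg IH fb b01 pA hg g0 => [|n] b A g Cg IH fb b01 pA hg g0.
  by rewrite boundary_integralE big_ord1 /face_integral !integral_fdg0 g0/= subrr mulr0.
have {}IH := IH n erefl.
pose G l := g (lift ord0 l).
have fb' := admissible_face_exponents fb.
have hG i c' : forall l, sup_holder (b (lift ord0 l)) (Cg (lift ord0 l))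
   (G l \o insert_coord i c').
  by move=> l; exact: sup_holder_insert.
rewrite boundary_integral_side.
(* The contribution of the face where coordinates [i] and [m] are fixed on the sides [p] and [q];
   [k] is the index of [m] once [i] is removed. *)
pose V (i m : 'I_n.+2) (k : 'I_n.+1) (p q : bool) :=
  integral_fdg (omit_coord k (omit_coord i A))
    (G ord0 \o insert_coord i (side A p 0 i) \o insert_coord k (side A q 0 m))
    (fun l => G (lift ord0 l) \o insert_coord i (side A p 0 i) \o
              insert_coord k (side A q 0 m)).
pose W i m := if unlift i m is Some k then
  \sum_p \sum_q (-1) ^+ (~~ p + ~~ q) * V i m k p q else 0.
have Wsym i m : i != m -> W i m = W m i.
  move=> im; rewrite /W.
  case: (unliftP i m) => [k mE|mE]; last by rewrite mE eqxx in im.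
  case: (unliftP m i) => [k' iE|iE]; last by rewrite iE eqxx in im.
  rewrite exchange_big; apply: eq_bigr => p _; apply: eq_bigr => q _.
  rewrite addnC; congr (_ * _).
  rewrite /V (omit_omit_swap _ (esym mE) (esym iE)).
  apply: eq_integral_fdg_total => [x|l x] /=;
    by rewrite (insert_insert_swap _ _ _ (esym mE) (esym iE)).
transitivity (c * \sum_(i < n.+2) \sum_(k < n.+1) (-1) ^+ (i + k) * W i (lift i k));
  last by rewrite alternating_pairs_eq0// mulr0.
rewrite [RHS]mulr_sumr; apply: eq_bigr => i _.
transitivity (\sum_p (-1) ^+ (i + ~~ p) * (c * \sum_(k < n.+1) \sum_q
   (-1) ^+ (k + ~~ q) * V i (lift i k) k p q)).
  apply: eq_bigr => p _; congr (_ * _).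
  rewrite /face_integral g0 (integral_fdg_cst c IH fb' (omit_proper i pA) (hG i _)).
  congr (_ * _); rewrite boundary_integral_side; apply: eq_bigr => k _.
  apply: eq_bigr => q _; congr (_ * _).
  rewrite /face_integral /V; congr (integral_fdg _ (_ \o insert_coord _ _) _).
    by rewrite /side; case: q; rewrite mxE.
  apply/funext => l; congr (_ \o insert_coord _ _).
  by rewrite /side; case: q; rewrite mxE.
rewrite mulr_sumr.
under eq_bigr do rewrite mulrCA mulr_sumr mulr_sumr.
rewrite exchange_big; apply: eq_bigr => k _ /=.
rewrite /W liftK -mulr_sumr; congr (_ * _).
rewrite mulr_sumr; apply: eq_bigr => p _.
rewrite mulr_sumr mulr_sumr; apply: eq_bigr => q _.
by rewrite !mulrA; congr (_ * _); rewrite -!exprD; congr (_ ^+ _); lia.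
Qed.

Lemma boundary_linear n (A : box n.+1) c (g g' g'' : 'I_n.+1 -> 'rV[R]_n.+1 -> R) :
  (forall F c0 j, proper_box F -> face_integral (@integral_fdg R n) g j c0 F =
     c * face_integral (@integral_fdg R n) g' j c0 F +
     face_integral (@integral_fdg R n) g'' j c0 F) ->
  proper_box A ->
  boundary_integral (@integral_fdg R n) A g =
  c * boundary_integral (@integral_fdg R n) A g' +
  boundary_integral (@integral_fdg R n) A g''.
Proof.
move=> gE pA; rewrite !boundary_integralE mulr_sumr -big_split/=.
by apply: eq_bigr => j _; rewrite !gE//; [ring|exact: omit_proper..].
Qed.

End boundary.

(** * Estimate of boundary integrals and convergence of the Riemann sums *)

Section sewing.
Context {R : realType}.

Lemma face_linear_integrand n (b : 'I_n.+1 -> R) c (g g' g'' : 'I_n.+1 -> 'rV[R]_n.+1 -> R)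
    Cg' Cg'' i c0 (F : box n) :
  @integral_exists R n -> face_exponents b -> proper_box F ->
  (forall i, sup_holder (b i) (Cg' i) (g' i)) ->
  (forall i, sup_holder (b i) (Cg'' i) (g'' i)) ->
  (forall x, g ord0 x = c * g' ord0 x + g'' ord0 x) ->
  (forall k x, g (lift ord0 k) x = g' (lift ord0 k) x) ->
  (forall k x, g'' (lift ord0 k) x = g' (lift ord0 k) x) ->
  face_integral (@integral_fdg R n) g i c0 F =
  c * face_integral (@integral_fdg R n) g' i c0 F +
  face_integral (@integral_fdg R n) g'' i c0 F.
Proof.
move=> IH fb pF hg' hg'' g0 gk gk''; rewrite /face_integral.
rewrite [X in _ = _ + X](eq_integral_fdg_total F (f' := g'' ord0 \o insert_coord i c0)
  (g' := fun k => g' (lift ord0 k) \o insert_coord i c0))//; last first.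
  by move=> k x /=; rewrite gk''.
rewrite -(integral_linear_integrand c IH fb pF (Cf := Cg' ord0) (Cf' := Cg'' ord0)
   (Cg := fun k => Cg' (lift ord0 k))); first last.
- by move=> k; exact: sup_holder_insert.
- exact: sup_holder_insert.
- exact: sup_holder_insert.
by apply: eq_integral_fdg_total => [x|k x] /=; rewrite ?g0 ?gk.
Qed.

(* Constants added to [g ord0] do not change the boundary integral, so only the
   oscillation of [g ord0] on the box enters the bound. *)
Lemma boundary_integral_bound n (b : 'I_n.+1 -> R) :
  (forall m, (m <= n)%N -> @integral_exists R m) -> face_exponents b ->
  exists2 K, 0 <= K & forall A r g Cg, 0 <= r -> small_box r A ->
    (forall i, sup_holder (b i) (Cg i) (g i)) ->
    `|boundary_integral (@integral_fdg R n) A g| <= K * \prod_i (Cg i * r `^ b i).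
Proof.
move=> IH fb; have [K K0 bK] := IH n (leqnn n) _ _ fb.
(* Each direction has two faces; on each of them the value and the oscillation of the normalised
   [g ord0] contribute one Hoelder bound apiece. *)
exists (\sum_(i < n.+1) (K * 4)); first by rewrite sumr_ge0// => i _; rewrite mulr_ge0.
move=> A r g Cg r0 sA hg; have pA := small_box_proper sA.
have [/andP[b0 b1] _ _] := fb.
pose upd (h : 'rV[R]_n.+1 -> R) (k : 'I_n.+1) := if k == ord0 then h else g k.
have updS h k x : upd h (lift ord0 k) x = g (lift ord0 k) x.
  by rewrite /upd eq_sym (negbTE (neq_lift _ _)).
have upd0 h x : upd h ord0 x = h x by rewrite /upd eqxx.
pose c := g ord0 A.1.
pose g1 := upd (fun x => 1 * g ord0 x + - c).
pose C2 k := if k == ord0 then 0 else Cg k.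
have hg2 k : sup_holder (b k) (C2 k) (upd (fun=> - c) k).
  by rewrite /upd /C2; case: eqP => // _; exact: sup_holder_cst.
have hg1 k : sup_holder (b k) (Cg k) (g1 k).
  rewrite /g1 /upd; case: eqP => [->|//] x y s s0 xy.
  rewrite [X in `|X|](_ : _ = g ord0 x - g ord0 y); last by ring.
  exact: hg.
have Q0 : boundary_integral (@integral_fdg R n) A (upd (fun=> - c)) = 0.
  apply: (boundary_integral_cst _ fb b1 pA hg2 (c := - c)).
    by move=> m ->; apply: IH; case: (n) => //= ?.
  by apply/funext => x; rewrite upd0.
have -> : boundary_integral (@integral_fdg R n) A g =
    boundary_integral (@integral_fdg R n) A g1.
  rewrite (@boundary_linear _ _ A 1 g1 g (upd (fun=> - c)))// ?Q0 ?mul1r ?addr0//.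
  move=> F c0 j pF.
  apply: (face_linear_integrand _ _ (IH n (leqnn n)) fb pF hg hg2) => [x|k x|k x].
  - by rewrite /g1 !upd0.
  - by rewrite /g1 updS.
  - by rewrite updS.
set P := \prod_i _.
have face_le i c0 : A.1 0 i <= c0 <= A.2 0 i ->
    `|face_integral (@integral_fdg R n) g1 i c0 (omit_coord i A)| <= K * 2 * P.
  move=> c0A; have [_] := bK _ _ _ _ _ _ r0 (omit_small i sA)
    (sup_holder_insert i c0 (hg1 ord0))
    (fun k => sup_holder_insert i c0 (hg1 (lift ord0 k))).
  move=> /(_ _ (corner_in (omit_proper i pA)))/le_trans; apply.
  rewrite /P big_ord_recl [leRHS]mulrA ler_wpM2r//.
    by apply: prodr_ge0 => k _; rewrite mulr_ge0 ?powR_ge0//; exact: sup_holder_ge0 (hg _).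
  rewrite -mulrA ler_wpM2l// mulr_natl mulr2n lerD2r /= /g1 upd0 mul1r.
  apply: sup_holder_box (hg ord0) r0 sA _ (corner_in pA).
  exact: insert_coord_in (corner_in (omit_proper i pA)).
rewrite boundary_integralE mulr_suml.
apply: le_trans (ler_norm_sum _ _ _) _; apply: ler_sum => i _.
rewrite normrM normrX normrN1 expr1n mul1r.
apply: le_trans (ler_normB _ _) _.
have Ai : A.1 0 i <= A.2 0 i by rewrite ltW.
have := face_le i (A.2 0 i); have := face_le i (A.1 0 i).
rewrite !lexx Ai => /(_ isT) h1 /(_ isT) h2.
by apply: le_trans (lerD h2 h1) _; rewrite le_eqVlt; apply/orP; left; apply/eqP; ring.
Qed.

Lemma powR_dyadic (a r : R) k : 0 <= r -> (r / 2 ^+ k) `^ a = r `^ a * (2^-1 `^ a) ^+ k.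
Proof.
move=> r0; elim: k => [|k IH]; first by rewrite expr0 divr1 mulr1.
rewrite exprSr invfM mulrA powRM ?invr_ge0// ?IH ?exprSr ?mulrA//.
by rewrite mulr_ge0// invr_ge0 exprn_ge0.
Qed.

Definition holder_product n (a : R) (b : 'I_n -> R) Cf (Cg : 'I_n -> R) r :=
  Cf * r `^ a * \prod_i (Cg i * r `^ b i).

(** The change of the total error under one subdivision: [2 ^+ n] times as many boxes, with halved
    side in every Hoelder factor. *)
Definition sewing_ratio n (a : R) (b : 'I_n -> R) :=
  2 ^+ n * (2^-1 `^ a * \prod_i (2^-1 `^ b i)) : R.

Lemma holder_product_dyadic n a (b : 'I_n -> R) Cf Cg r k : 0 <= r ->
  (2 ^+ n) ^+ k * holder_product a b Cf Cg (r / 2 ^+ k) =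
  holder_product a b Cf Cg r * sewing_ratio a b ^+ k.
Proof.
move=> r0; rewrite /holder_product /sewing_ratio powR_dyadic//.
under eq_bigr do rewrite powR_dyadic// mulrA.
by rewrite big_split/= prodrXl !exprMn; ring.
Qed.

Lemma sewing_ratio_lt1 n a (b : 'I_n -> R) : n%:R < a + \sum_i b i ->
  0 <= sewing_ratio a b < 1.
Proof.
move=> nab; apply/andP; split.
  by rewrite mulr_ge0 ?exprn_ge0// mulr_ge0 ?powR_ge0// prodr_ge0// => i _; exact: powR_ge0.
have e : 2^-1 `^ a * \prod_i (2^-1 `^ b i) = 2^-1 `^ (a + \sum_i b i) :> R.
  have n0 : (2^-1 : R) != 0 by rewrite invr_eq0.
  rewrite powRD ?n0 ?implybT//; congr (_ * _); apply/esym.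
  by apply: (big_morph (fun x => 2^-1 `^ x)) => [x y|]; rewrite ?powRr0// powRD// n0 implybT.
rewrite /sewing_ratio e.
have -> : 2 ^+ n = (2^-1 `^ n%:R)^-1 :> R by rewrite powR_mulrn// exprVn invrK.
rewrite mulrC ltr_pdivrMr ?powR_gt0// mul1r.
rewrite /powR invr_eq0 pnatr_eq0/= ltr_expR ltr_nM2r//.
by rewrite lnV ?posrE// oppr_lt0 ln_gt0// ltr1n.
Qed.

Lemma holder_product_ge0 n a (b : 'I_n -> R) Cf Cg r (f : 'rV[R]_n -> R)
    (g : 'I_n -> 'rV[R]_n -> R) :
  sup_holder a Cf f -> (forall i, sup_holder (b i) (Cg i) (g i)) ->
  0 <= holder_product a b Cf Cg r.
Proof.
move=> /sup_holder_ge0 f0 hg; rewrite mulr_ge0 ?mulr_ge0 ?powR_ge0//.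
by apply: prodr_ge0 => i _; rewrite mulr_ge0 ?powR_ge0//; exact: sup_holder_ge0 (hg _).
Qed.

Lemma norm_sum_dyadic_le n k (A : @box R n) (F : box n -> R) c :
  (forall B, B \in dyadic k A -> `|F B| <= c) ->
  `|\sum_(B <- dyadic k A) F B| <= (2 ^+ n) ^+ k * c.
Proof.
move=> Fc; apply: le_trans (ler_norm_sum _ _ _) _; rewrite -(sum_dyadic_cst k A).
by rewrite big_seq [leRHS]big_seq; apply: ler_sum.
Qed.

Lemma sewing n a (b : 'I_n.+1 -> R) :
  (forall m, (m <= n)%N -> @integral_exists R m) -> admissible_exponents a b ->
  exists2 K, 0 <= K &
  forall A r (f : 'rV[R]_n.+1 -> R) g Cf Cg, 0 <= r -> small_box r A ->
    sup_holder a Cf f -> (forall i, sup_holder (b i) (Cg i) (g i)) ->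
    is_integral A f g (integral_fdg A f g) /\
    forall k, `|integral_fdg A f g -
        riemann_sum (@integral_fdg R n) f g (dyadic k A) (@corner_tag R _ k)| <=
      K * holder_product a b Cf Cg r * sewing_ratio a b ^+ k.
Proof.
move=> IH ab; have fb := admissible_face_exponents ab.
have [K K0 bK] := boundary_integral_bound IH fb.
have [_ _ nab] := ab; have /andP[rho0 rho1] := sewing_ratio_lt1 nab.
set rho := sewing_ratio a b in rho0 rho1 *.
exists (2 ^+ n.+1 * K / (1 - rho)).
  by rewrite divr_ge0 ?subr_ge0 ?(ltW rho1)// mulr_ge0// exprn_ge0.
move=> A r f g Cf Cg r0 sA hf hg; have pA := small_box_proper sA.
set H := holder_product a b Cf Cg r.
have H0 : 0 <= H := holder_product_ge0 r hf hg.
pose Q B := boundary_integral (@integral_fdg R n) B g.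
have rk0 k : 0 <= r / 2 ^+ k by rewrite divr_ge0// exprn_ge0.
(* Used twice: with [B'] a half of [B] to compare successive levels, and with [B'] equal to [B] to
   compare two taggings. *)
have term k B B' x y : B \in dyadic k A -> small_box (r / 2 ^+ k) B' ->
    box_set B x -> box_set B y ->
    `|(f x - f y) * Q B'| <= K * holder_product a b Cf Cg (r / 2 ^+ k).
  move=> BA sB' xB yB; rewrite normrM /holder_product mulrCA ler_pM//.
    exact: sup_holder_box hf (rk0 k) (dyadic_small sA BA) xB yB.
  exact: bK (rk0 k) sB' hg.
pose u k := riemann_sum (@integral_fdg R n) f g (dyadic k A) (@corner_tag R _ k).
have uS k : `|u k.+1 - u k| <= 2 ^+ n.+1 * K * H * rho ^+ k.
  rewrite /u /riemann_sum big_dyadicS.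
  rewrite [X in `|X|](_ : _ = \sum_(B <- dyadic k A) \sum_s
      (f (half_box B s).1 - f B.1) * Q (half_box B s)); last first.
    rewrite -sumrB; apply: eq_big_seq => B BA.
    rewrite [X in _ - _ * X](boundary_additive (IH n (leqnn n)) fb (dyadic_proper pA BA) hg).
    rewrite mulr_sumr -sumrB; apply: eq_bigr => s _; rewrite /Q /corner_tag; ring.
  apply: le_trans (norm_sum_dyadic_le (c := 2 ^+ n.+1 *
    (K * holder_product a b Cf Cg (r / 2 ^+ k))) _) _.
    move=> B BA; apply: le_trans (ler_norm_sum _ _ _) _.
    apply: le_trans (ler_sum (G := fun=> K * holder_product a b Cf Cg (r / 2 ^+ k)) _ _) _.
      move=> s _; apply: (term k B) => //.
      - have := half_box_small s (dyadic_small sA BA).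
        move=> sB i; have /andP[-> /le_trans]/= := sB i; apply.
        by rewrite lerD2l ler_pdivrMr// ler_peMr// ler1n.
      - exact/half_box_sub/corner_in/half_box_proper/(dyadic_proper pA BA)/(dyadic_proper pA BA).
      - exact/corner_in/(dyadic_proper pA BA).
    by rewrite sumr_const card_ffun card_bool card_ord -[leLHS]mulr_natl natrX.
  rewrite le_eqVlt; apply/orP; left; apply/eqP.
  rewrite -[RHS]mulrA -(holder_product_dyadic a b Cf Cg k r0); ring.
have [|||l ul lu] := @cvg_geometric_increments _ u (2 ^+ n.+1 * K * H) rho => //.
- by rewrite mulr_ge0// mulr_ge0// exprn_ge0.
- by rewrite rho0.
have lI : is_integral A f g l.
  rewrite is_integralS => xi xiA.
  (* Moving the points inside their boxes changes the sum of level [k] by at most a multiple of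
     [rho ^+ k], so the limit found for the corners serves all taggings. *)
  suff h : riemann_sum (@integral_fdg R n) f g (dyadic k A) (xi k) - u k @[k --> \oo] --> (0 : R).
    rewrite -[l]add0r.
    under eq_fun => k do rewrite -[riemann_sum _ _ _ _ _](subrK (u k)).
    exact: cvgD h ul.
  apply: (@squeeze_cvgr _ _ _ _ (fun k => - (K * H * rho ^+ k)) (fun k => K * H * rho ^+ k)).
  - apply: nearW => k; rewrite -ler_norml /u /riemann_sum -sumrB.
    under eq_bigr do rewrite -mulrBl.
    rewrite -mulrA -(holder_product_dyadic a b Cf Cg k r0) mulrCA.
    apply: norm_sum_dyadic_le => B BA; apply: (term k B) => //.
    + exact: dyadic_small sA BA.
    + exact: xiA.
    + exact: corner_tagging.
  - rewrite -[X in _ --> X]oppr0; apply: cvgN; rewrite -[X in _ --> X](mulr0 (K * H)).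
    by apply: cvgM; [exact: cvg_cst|apply: cvg_expr; rewrite ger0_norm].
  - rewrite -[X in _ --> X](mulr0 (K * H)).
    by apply: cvgM; [exact: cvg_cst|apply: cvg_expr; rewrite ger0_norm].
rewrite (integral_fdg_eq pA lI); split => // k.
by rewrite [X in _ <= X * _]mulrAC; exact: lu.
Qed.

Theorem integral_existsP n : @integral_exists R n.
Proof.
elim/ltn_ind: n => -[_|n IH] a b ab.
  exists 1 => // A r f g Cf Cg r0 sA hf hg; rewrite integral_fdg0; split => // x _.
  rewrite big_ord0 mulr1 mul1r (rowR0_eq x A.1) lerDl mulr_ge0 ?powR_ge0//.
  exact: sup_holder_ge0 hf.
have IH' m : (m <= n)%N -> @integral_exists R m by move=> mn; exact: IH.
have [K K0 sK] := sewing IH' ab.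
have [K' K'0 bK'] := boundary_integral_bound IH' (admissible_face_exponents ab).
exists (K + K'); first exact: addr_ge0.
move=> A r f g Cf Cg r0 sA hf hg; have [AI rate] := sK _ _ _ _ _ _ r0 sA hf hg.
split => // x xA; have pA := small_box_proper sA.
set P := \prod_i _.
have P0 : 0 <= P.
  by apply: prodr_ge0 => i _; rewrite mulr_ge0 ?powR_ge0//; exact: sup_holder_ge0 (hg _).
have C0 : 0 <= Cf * r `^ a by rewrite mulr_ge0 ?powR_ge0//; exact: sup_holder_ge0 hf.
(* At level zero the rate compares the integral with the single term [f A.1] times the boundary
   integral over [A], which is bounded separately. *)
have := rate 0%N; rewrite expr0 mulr1 /riemann_sum /dyadic/= big_seq1.
rewrite /holder_product -/P /corner_tag => h.
have hQ := bK' _ _ _ _ r0 sA hg; rewrite -/P in hQ.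
have hfx := sup_holder_box hf r0 sA (corner_in pA) xA.
have hfA : `|f A.1| <= `|f x| + Cf * r `^ a.
  by rewrite -[f A.1](subrK (f x)) addrC; apply: le_trans (ler_normD _ _) _; rewrite lerD2l.
rewrite -[integral_fdg A f g](subrK (f A.1 * boundary_integral (@integral_fdg R n) A g)).
apply: le_trans (ler_normD _ _) _.
rewrite mulrDl mulrDl lerD//.
  apply: le_trans h _; rewrite mulrA ler_wpM2r// ler_wpM2l// lerDr; exact: normr_ge0.
by rewrite normrM mulrAC [leRHS]mulrC ler_pM.
Qed.

End sewing.

(** * Continuity and linearity in the differentials *)

Section consequences.
Context {R : realType}.
Implicit Types n : nat.

Lemma sup_holder_lim n a C (f_ : nat -> 'rV[R]_n -> R) f :
  (forall m, sup_holder a C (f_ m)) -> (forall x, f_ m x @[m --> \oo] --> f x) ->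
  sup_holder a C f.
Proof.
move=> hf ff x y r r0 xy.
apply: (@ler_cvg_to _ \oo _ _ (fun m => `|f_ m x - f_ m y|) (fun=> C * r `^ a)).
- by apply: cvg_norm; apply: cvgB; exact: ff.
- exact: cvg_cst.
- by apply: nearW => m; exact: hf.
Qed.

(** Riemann sums of a fixed level converge by the induction hypothesis on the faces; the rate of
    [sewing] is common to all [m], so the two limits can be exchanged. *)
Lemma integral_continuous n a (b : 'I_n -> R) A f_ g_ f g Cf Cg :
  admissible_exponents a b -> proper_box A ->
  (forall m, sup_holder a Cf (f_ m)) ->
  (forall m i, sup_holder (b i) (Cg i) (g_ m i)) ->
  (forall x, f_ m x @[m --> \oo] --> f x) ->
  (forall i x, g_ m i x @[m --> \oo] --> g i x) ->
  integral_fdg A (f_ m) (g_ m) @[m --> \oo] --> integral_fdg A f g.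
Proof.
elim: n a b A f_ g_ f g Cf Cg => [|n IH] a b A f_ g_ f g Cf Cg ab pA hf_ hg_ ff gg.
  by rewrite integral_fdg0; under eq_fun do rewrite integral_fdg0; exact: ff.
have hf := sup_holder_lim hf_ ff.
have hg i := sup_holder_lim (fun m => hg_ m i) (gg i).
have fb := admissible_face_exponents ab.
have Qcvg B : proper_box B ->
    boundary_integral (@integral_fdg R n) B (g_ m) @[m --> \oo] -->
    boundary_integral (@integral_fdg R n) B g.
  move=> pB; rewrite boundary_integralE.
  under eq_fun do rewrite boundary_integralE.
  apply: cvg_bigsum_fin => i; apply: cvgM; first exact: cvg_cst.
  have face c : face_integral (@integral_fdg R n) (g_ m) i c (omit_coord i B)
      @[m --> \oo] --> face_integral (@integral_fdg R n) g i c (omit_coord i B).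
    apply: IH fb (omit_proper i pB) _ _ _ _ => [m|m k|x|k x].
    - exact: sup_holder_insert (hg_ m ord0).
    - exact: sup_holder_insert (hg_ m (lift ord0 k)).
    - exact: gg.
    - exact: gg.
  by apply: cvgB.
pose S k f g := riemann_sum (@integral_fdg R n) f g (dyadic k A) (@corner_tag R _ k).
have Scvg k : S k (f_ m) (g_ m) @[m --> \oo] --> S k f g.
  apply: cvg_bigsum => B BA; apply: cvgM; first exact: ff.
  exact/Qcvg/(dyadic_proper pA BA).
have [K K0 sK] := sewing (fun m _ => @integral_existsP R m) ab.
have [r r0 sA] := proper_small_box pA.
have [_ _ /sewing_ratio_lt1/andP[rho0 rho1]] := ab.
set H := K * holder_product a b Cf Cg r.
have rate k f' g' : sup_holder a Cf f' -> (forall i, sup_holder (b i) (Cg i) (g' i)) ->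
    `|integral_fdg A f' g' - S k f' g'| <= H * sewing_ratio a b ^+ k.
  by move=> hf' hg'; have [_] := sK _ _ _ _ _ _ (ltW r0) sA hf' hg'; exact.
apply/cvgrPdist_le => e e0; have e30 : 0 < e / 3 by rewrite divr_gt0.
have Hcvg : H * sewing_ratio a b ^+ k @[k --> \oo] --> (0 : R).
  rewrite -[X in _ --> X](mulr0 H); apply: cvgM; first exact: cvg_cst.
  by apply: cvg_expr; rewrite ger0_norm.
have [k _ /(_ k (leqnn k))] : \forall k \near \oo, `|0 - H * sewing_ratio a b ^+ k| <= e / 3.
  by move/cvgrPdist_le : Hcvg; exact.
rewrite sub0r normrN => /(le_trans (ler_norm _)) Hk.
have /cvgrPdist_le/(_ _ e30) := Scvg k; apply: filterS => m Sm.
have h1 := le_trans (rate k _ _ hf hg) Hk.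
have h2 := le_trans (rate k _ _ (hf_ m) (hg_ m)) Hk.
rewrite [X in `|X|](_ : _ = (integral_fdg A f g - S k f g) +
  (S k f g - S k (f_ m) (g_ m)) - (integral_fdg A (f_ m) (g_ m) - S k (f_ m) (g_ m))); last by ring.
apply: le_trans (ler_normB _ _) _.
apply: le_trans (lerD (ler_normD _ _) (lexx _)) _; lra.
Qed.

(** On a face, [g ord0] is the integrand and the other components are differentials. Thus the case
    [i = ord0] is linearity in the integrand and the others follow by induction. Three separate
    families, rather than updates of one, restrict to faces without reindexing. *)
Lemma integral_linear_differential n a (b : 'I_n -> R) A c i f g g' g'' Cf Cg' Cg'' :
  admissible_exponents a b -> proper_box A -> sup_holder a Cf f ->
  (forall j, sup_holder (b j) (Cg' j) (g' j)) ->
  (forall j, sup_holder (b j) (Cg'' j) (g'' j)) ->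
  (forall x, g i x = c * g' i x + g'' i x) ->
  (forall j x, j != i -> g j x = g' j x /\ g'' j x = g' j x) ->
  integral_fdg A f g = c * integral_fdg A f g' + integral_fdg A f g''.
Proof.
elim: n a b A i f g g' g'' Cf Cg' Cg'' => [_ _ _ []//|n IH].
move=> a b A i f g g' g'' Cf Cg' Cg'' ab pA hf hg' hg'' gi gj.
have fb := admissible_face_exponents ab.
pose Cg j := (`|c| * Cg' j + Cg'' j) + Cg' j.
have hg j : sup_holder (b j) (Cg j) (g j).
  have C'0 := sup_holder_ge0 (hg' j); have C''0 := sup_holder_ge0 (hg'' j).
  have [->|ji] := eqVneq j i.
    apply: (@sup_holderW _ _ _ (`|c| * Cg' i + Cg'' i)).
      by rewrite lerDl (sup_holder_ge0 (hg' i)).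
    have -> : g i = fun x => c * g' i x + g'' i x by apply/funext.
    exact: sup_holder_lin.
  apply: (@sup_holderW _ _ _ (Cg' j)).
    by rewrite /Cg lerDr addr_ge0// mulr_ge0.
  have -> // : g j = g' j by apply/funext => x; have [] := gj j x ji.
have Qlin B : proper_box B -> boundary_integral (@integral_fdg R n) B g =
   c * boundary_integral (@integral_fdg R n) B g' + boundary_integral (@integral_fdg R n) B g''.
  apply: boundary_linear => F c0 j pF.
  case: (unliftP ord0 i) => [k ik|i0].
    have h0 : g ord0 =1 g' ord0 /\ g'' ord0 =1 g' ord0.
      by split=> x; have [] := gj ord0 x; rewrite // ik neq_lift.
    rewrite /face_integral.
    rewrite (eq_integral_fdg_total _ (f := g ord0 \o insert_coord j c0)
      (f' := g' ord0 \o insert_coord j c0)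
      (g' := fun k => g (lift ord0 k) \o insert_coord j c0))//;
      last by move=> x /=; rewrite h0.1.
    rewrite (eq_integral_fdg_total _ (f := g'' ord0 \o insert_coord j c0)
      (f' := g' ord0 \o insert_coord j c0)
      (g' := fun k => g'' (lift ord0 k) \o insert_coord j c0))//;
      last by move=> x /=; rewrite h0.2.
    apply: (IH _ _ _ k _ _ _ _ _ _ _ fb pF).
    - exact: sup_holder_insert (hg' ord0).
    - by move=> l; exact: sup_holder_insert (hg' (lift ord0 l)).
    - by move=> l; exact: sup_holder_insert (hg'' (lift ord0 l)).
    - by move=> x /=; rewrite -ik gi.
    - by move=> l x lk /=; apply: gj; rewrite ik (inj_eq lift_inj).
  apply: (face_linear_integrand _ _ (@integral_existsP R n) fb pF hg' hg'').
  - by move=> x; rewrite -i0 gi.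
  - by move=> k x; have [] := gj (lift ord0 k) x; rewrite // i0 eq_sym neq_lift.
  - by move=> k x; have [] := gj (lift ord0 k) x; rewrite // i0 eq_sym neq_lift.
have IE := @integral_existsP R n.+1.
have h1 := riemann_sum_cvg IE ab pA hf hg (corner_tagging pA).
have h2 := riemann_sum_cvg IE ab pA hf hg' (corner_tagging pA).
have h3 := riemann_sum_cvg IE ab pA hf hg'' (corner_tagging pA).
have h4 : c * riemann_sum (@integral_fdg R n) f g' (dyadic k A) (@corner_tag R _ k) +
    riemann_sum (@integral_fdg R n) f g'' (dyadic k A) (@corner_tag R _ k)
    @[k --> \oo] --> c * integral_fdg A f g' + integral_fdg A f g''.
  by apply: cvgD h3; apply: cvgM h2; exact: cvg_cst.
move: h1; under eq_fun => k.
  rewrite (_ : riemann_sum _ _ _ _ _ = c * riemann_sum (@integral_fdg R n) f g'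
    (dyadic k A) (@corner_tag R _ k) + riemann_sum (@integral_fdg R n) f g''
    (dyadic k A) (@corner_tag R _ k)); first over.
  rewrite /riemann_sum mulr_sumr -big_split/=.
  by apply: eq_big_seq => B BA; rewrite (Qlin _ (dyadic_proper pA BA)); ring.
by move=> h1; exact: (cvg_unique _ h1 h4).
Qed.

(** Exchanging the components of [g] for those of [h] one at a time, linearity turns each step into
    an integral whose [i]-th differential is the difference [g i - h i]. *)
Lemma integral_telescope n a (b : 'I_n -> R) : admissible_exponents a b ->
  exists2 K, 0 <= K & forall A r f g h Cf C D, 0 <= r -> small_box r A ->
    sup_holder a Cf f -> (forall i, sup_holder (b i) (C i) (g i)) ->
    (forall i, sup_holder (b i) (C i) (h i)) ->
    (forall i, sup_holder (b i) (D i) (fun x => g i x - h i x)) ->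
    forall x, box_set A x -> `|integral_fdg A f g - integral_fdg A f h| <=
      K * (`|f x| + Cf * r `^ a) *
      \sum_i \prod_j ((if j == i then D j else C j) * r `^ b j).
Proof.
move=> ab; have [K K0 bK] := @integral_existsP R n _ _ ab.
exists K => // A r f g h Cf C D r0 sA hf hg hh hd x xA.
have pA := small_box_proper sA.
pose u k := integral_fdg A f (fun i : 'I_n => if (i < k)%N then h i else g i).
have u0 : u 0%N = integral_fdg A f g by apply: eq_integral_fdg_total.
have un : u n = integral_fdg A f h.
  by apply: eq_integral_fdg_total => // i; rewrite ltn_ord.
rewrite distrC -u0 -un -(telescope_sumr u (leq0n n)) big_mkord.
apply: le_trans (ler_norm_sum _ _ _) _; rewrite mulr_sumr; apply: ler_sum => i _.
pose mid j := if j == i then (fun x => g j x - h j x) else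
  if (j < i)%N then h j else g j.
have hmid j : sup_holder (b j) (if j == i then D j else C j) (mid j).
  by rewrite /mid; case: eqP => // _; case: ifP.
have hu1 j : sup_holder (b j) (C j) (if (j < i.+1)%N then h j else g j) by case: ifP.
have -> : u i.+1 - u i = - integral_fdg A f mid.
  rewrite [u i](@integral_linear_differential _ a b A 1 i f _
    (fun j : 'I_n => if (j < i.+1)%N then h j else g j) mid Cf C
    (fun j => if j == i then D j else C j))//.
  - by rewrite mul1r opprD addrA subrr sub0r.
  - by move=> y; rewrite ltnn ltnS leqnn /mid eqxx; ring.
  - move=> j y ji; rewrite /mid (negbTE ji) ltnS [(j <= i)%N]leq_eqVlt.
    by have /negbTE -> : (j : nat) != i.
rewrite normrN.
have [_] := bK _ _ _ _ _ _ r0 sA hf hmid.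
by apply.
Qed.

End consequences.

(** * Blow-up at points of differentiability *)

Section clamping.
Context {R : realType}.

(** The coordinatewise nearest-point retraction onto the box. It increases no coordinate distance,
    so composing with it extends a Hoelder function on [A] to the whole space. *)
Definition clamp n (A : @box R n) (x : 'rV[R]_n) : 'rV[R]_n :=
  \row_i Num.max (A.1 0 i) (Num.min (A.2 0 i) (x 0 i)).

Lemma clamp_in n (A : @box R n) x : proper_box A -> box_set A (clamp A x).
Proof.
move=> pA i; rewrite mxE le_max lexx/= ge_max ge_min lexx/= andbT.
exact/ltW/pA.
Qed.

Lemma clamp_id n (A : @box R n) x : box_set A x -> clamp A x = x.
Proof.
move=> xA; apply/rowP => i; rewrite mxE; have /andP[ux xv] := xA i.
by rewrite min_r// max_r.
Qed.

Lemma clamp_dist n (A : @box R n) x y i :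
  `|clamp A x 0 i - clamp A y 0 i| <= `|x 0 i - y 0 i|.
Proof.
rewrite !mxE; set u := A.1 0 i; set v := A.2 0 i.
move: (x 0 i) (y 0 i) => s t.
wlog st : s t / s <= t => [hw|].
  by have [/hw//|/ltW/hw] := leP s t; rewrite distrC [in leRHS]distrC.
rewrite distrC [leRHS]distrC [leRHS]ger0_norm ?subr_ge0// ler_norml.
rewrite /Num.max /Num.min.
case: (ltP v s) => ?; case: (ltP v t) => ?; case: ltP => ?; case: ltP => ?;
 apply/andP; split; lra.
Qed.

Lemma powR_split (s theta : R) : 0 <= s -> s = s `^ (1 - theta) * s `^ theta.
Proof. by move=> s0; rewrite -powRD subrK ?oner_eq0// powRr1. Qed.

(** Clamped points are within [r] of each other as well as within [s]; the part [1 - theta] of the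
    exponent is spent on [r] and the part [theta] on [s]. *)
Lemma lipschitz_clamp_holder n M theta r (f : 'rV[R]_n -> R) (A : box n) :
  0 < theta <= 1 -> 0 <= r -> small_box r A -> sup_holder 1 M f ->
  sup_holder theta (M * r `^ (1 - theta)) (f \o clamp A).
Proof.
move=> /andP[t0 t1] r0 sA hf x y s s0 xy.
have pA := small_box_proper sA; have M0 := sup_holder_ge0 hf.
have m0 : 0 <= Num.min s r by rewrite le_min s0.
have := hf (clamp A x) (clamp A y) (Num.min s r) m0.
rewrite powRr1// => /(_ _)/le_trans; apply => [i|].
  rewrite le_min (le_trans (clamp_dist _ _ _ _))//=.
  have := clamp_in x pA i; have := clamp_in y pA i; have := sA i.
  move=> /andP[? ?] /andP[? ?] /andP[? ?].
  by rewrite ler_norml; apply/andP; split; lra.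
rewrite -mulrA ler_wpM2l// (powR_split theta m0) ler_pM ?powR_ge0//;
  by apply: ge0_ler_powR; rewrite ?nnegrE ?subr_ge0 ?(ltW t0)// ge_min lexx ?orbT.
Qed.

(* Interpolation between the bound [e] on [g - h] and its Lipschitz bound. *)
Lemma diff_clamp_holder n M theta e (g h : 'rV[R]_n -> R) (A : box n) :
  0 < theta <= 1 -> 0 <= e -> proper_box A -> sup_holder 1 M g -> sup_holder 1 M h ->
  (forall x, box_set A x -> `|g x - h x| <= e) ->
  sup_holder theta (2 * (1 + M) * e `^ (1 - theta))
    (fun x => g (clamp A x) - h (clamp A x)).
Proof.
move=> /andP[t0 t1] e0 pA hg hh ghe x y s s0 xy; have M0 := sup_holder_ge0 hg.
have h1 := ghe _ (clamp_in x pA); have h2 := ghe _ (clamp_in y pA).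
have cxy i : `|clamp A x 0 i - clamp A y 0 i| <= s.
  by apply: le_trans (clamp_dist _ _ _ _) _.
have := hg _ _ _ s0 cxy; have := hh _ _ _ s0 cxy; rewrite !powRr1//.
move: h1 h2; set gx := g _; set hx := h _; set gy := g _; set hy := h _ => h1 h2 h3 h4.
have m0 : 0 <= Num.min s e by rewrite le_min s0.
(* The difference is at most [2 * e] and at most [2 * M * s]; the constant covers both cases of the
   minimum. *)
apply: (@le_trans _ _ (2 * (1 + M) * Num.min s e)); last first.
  rewrite -[leRHS]mulrA ler_wpM2l ?mulr_ge0 ?addr_ge0//.
  rewrite (powR_split theta m0) ler_pM ?powR_ge0//;
  by apply: ge0_ler_powR; rewrite ?nnegrE ?subr_ge0 ?(ltW t0)// ge_min lexx ?orbT.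
have Ms : 0 <= M * s by rewrite mulr_ge0.
have Me : 0 <= M * e by rewrite mulr_ge0.
move: h1 h2 h3 h4; rewrite !ler_norml => /andP[? ?] /andP[? ?] /andP[? ?] /andP[? ?].
by rewrite /Num.min; case: ltP => ?; apply/andP; split; nra.
Qed.

End clamping.

Section blow_up.
Context {R : realType}.
Implicit Types n : nat.

Lemma integral_shift n a (b : 'I_n -> R) A f g h (d : 'I_n -> R) Cf Cg :
  admissible_exponents a b -> proper_box A -> sup_holder a Cf f ->
  (forall i, sup_holder (b i) (Cg i) (g i)) -> (forall i x, h i x = g i x + d i) ->
  integral_fdg A f h = integral_fdg A f g.
Proof.
move=> ab pA hf hg hE; have [K K0 tK] := integral_telescope ab.
have [r r0 sA] := proper_small_box pA.
have hh i : sup_holder (b i) (Cg i) (h i).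
  by move=> x y s s0 xy; rewrite !hE opprD addrACA subrr addr0; exact: hg.
have hd i : sup_holder (b i) 0 (fun x => h i x - g i x).
  move=> x y s s0 xy; rewrite [X in `|X|](_ : _ = 0) ?normr0 ?mul0r//.
  by rewrite !hE; ring.
have := tK _ _ _ _ _ _ _ (fun=> 0) (ltW r0) sA hf hh hg hd _ (corner_in pA).
rewrite [X in _ * X](_ : _ = 0) ?mulr0 ?normr_le0 ?subr_eq0; first by move/eqP.
by rewrite big1// => i _; rewrite (bigD1 i)//= eqxx !mul0r.
Qed.

Definition volume n (A : @box R n) := \prod_i (A.2 0 i - A.1 0 i).

Lemma volume_gt0 n (A : @box R n) : proper_box A -> 0 < volume A.
Proof. by move=> pA; apply: prodr_gt0 => i _; rewrite subr_gt0. Qed.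

Lemma dyadic_volume n k (A B : @box R n) : B \in dyadic k A ->
  volume B = volume A / (2 ^+ n) ^+ k.
Proof.
move=> BA; rewrite /volume.
rewrite (eq_bigr (fun i => (A.2 0 i - A.1 0 i) * (2 ^+ k)^-1)); last first.
  by move=> i _; exact: dyadic_size BA.
by rewrite big_split/= prodr_const card_ord exprVn -!exprM mulnC.
Qed.

Definition affine n m (M : 'M[R]_(m, n)) (d : 'I_m -> R) (i : 'I_m) (x : 'rV[R]_n) : R :=
  \sum_k M i k * x 0 k + d i.

Lemma affine_holder n m (M : 'M[R]_(m, n)) d i :
  sup_holder 1 (\sum_k `|M i k|) (affine M d i).
Proof.
move=> x y r r0 xy; rewrite powRr1// /affine opprD addrACA subrr addr0 -sumrB.
apply: le_trans (ler_norm_sum _ _ _) _; rewrite mulr_suml; apply: ler_sum => k _.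
by rewrite -mulrBr normrM ler_wpM2l.
Qed.

Lemma lipschitz_exponents n : admissible_exponents 1 (fun _ : 'I_n => 1 : R).
Proof.
split=> [|_|]; rewrite ?ltr01 ?lexx// sumr_const card_ord.
by rewrite ltrDr ltr01.
Qed.

(** Between opposite faces in direction [i] the affine [g ord0] changes by the constant [M ord0 i]
    times the side length, while the other components restrict to affine maps with the minor as
    matrix. *)
Lemma integral_affine n (M : 'M[R]_n) (d : 'I_n -> R) A : proper_box A ->
  integral_fdg A (fun=> 1) (affine M d) = \det M * volume A.
Proof.
elim: n M d A => [|n IH] M d A pA.
  by rewrite integral_fdg0 det_mx00 /volume big_ord0 mulr1.
have ab := lipschitz_exponents n.+1; have fb := admissible_face_exponents ab.
have IE := @integral_existsP R n.
rewrite (integral_fdg_cst 1 IE fb pA (fun i => affine_holder M d i)) mul1r.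
rewrite boundary_integralE (expand_det_row M ord0) mulr_suml.
apply: eq_bigr => i _; rewrite /cofactor add0n.
set M' := row' ord0 (col' i M); set F := omit_coord i A.
have pF : proper_box F := omit_proper i pA.
have insE m c x : affine M d m (insert_coord i c x) =
    \sum_l M m (lift i l) * x 0 l + (M m i * c + d m).
  rewrite /affine (bigD1_ord i)//= insert_coord0.
  rewrite (eq_bigr (fun l => M m (lift i l) * x 0 l)); first by ring.
  by move=> l _; rewrite insert_coord_lift.
(* The position [c] enters the other components through additive constants only; removing them
   leaves opposite faces with the same differentials. *)
have faceE c : face_integral (@integral_fdg R n) (affine M d) i c F =
    integral_fdg F (affine M d ord0 \o insert_coord i c) (affine M' (fun=> 0)).
  apply: (integral_shift (d := fun k => M (lift ord0 k) i * c + d (lift ord0 k)) fb pF).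
  - exact/sup_holder_insert/affine_holder.
  - exact: affine_holder.
  - move=> k x /=; rewrite insE /affine addr0; congr (_ + _).
    by apply: eq_bigr => l _; rewrite !mxE.
set u := A.1 0 i; set v := A.2 0 i.
have e x : (affine M d ord0 \o insert_coord i v) x =
    M ord0 i * (v - u) * 1 + (affine M d ord0 \o insert_coord i u) x.
  by rewrite /= !insE; ring.
rewrite !faceE (eq_integral_fdg_total _ e (fun _ _ => erefl)).
rewrite (integral_linear_integrand _ IE fb pF (sup_holder_cst 1 1)
  (sup_holder_insert i u (affine_holder M d ord0)) (fun k => affine_holder M' _ k)).
rewrite addrK IH// /volume [in RHS](bigD1_ord i)//= -/u -/v.
rewrite (eq_bigr (fun l => A.2 0 (lift i l) - A.1 0 (lift i l))); last first.
  by move=> l _; rewrite !mxE.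
ring.
Qed.

(** The error has the order of the volume although only uniform closeness is assumed: with exponents
    below one the difference has a small Hoelder constant, and all powers of [r] add up to [n]. *)
Lemma integral_close n (M e : R) : 0 < e -> exists2 eta, 0 < eta &
  forall (B : box n) r g h, 0 < r -> small_box r B ->
    (forall i, sup_holder 1 M (g i)) -> (forall i, sup_holder 1 M (h i)) ->
    (forall i x, box_set B x -> `|g i x - h i x| <= eta * r) ->
    `|integral_fdg B (fun=> 1) g - integral_fdg B (fun=> 1) h| <= e * r ^+ n.
Proof.
(* With [theta = 1 - m^-1], admissibility amounts to [n < m]; [2 <= m] keeps [theta] positive also
   for [n = 0]. *)
move=> e0; pose m := (2 * n.+1)%N.
pose theta : R := 1 - m%:R^-1.
have m2 : 2 <= (m%:R : R) by rewrite ler_nat /m; lia.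
have m0 : 0 < (m%:R : R) by rewrite (lt_le_trans _ m2).
have mi : 0 < (m%:R : R)^-1 <= 2^-1.
  by rewrite invr_gt0 m0/= lef_pV2 ?posrE.
have t01 : 0 < theta <= 1 by rewrite /theta; apply/andP; split; lra.
have ab : admissible_exponents 1 (fun _ : 'I_n => theta).
  split=> //; first by rewrite ltr01 lexx.
  rewrite sumr_const card_ord /theta mulrnBl -[(_^-1 *+ n)]mulr_natr -[1 *+ n]/(n%:R : R).
  suff : m%:R^-1 * n%:R < 1 :> R by lra.
  by rewrite mulrC ltr_pdivrMr// mul1r ltr_nat /m; lia.
have [K K0 tK] := integral_telescope ab.
(* There are [n] telescoping terms, each with [n] factors whose constants are at most twice
   [1 + |M|], apart from the small power of [eta]. *)
pose c := K * n%:R * (2 * (1 + `|M|)) ^+ n.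
have c0 : 0 <= c by rewrite mulr_ge0 ?mulr_ge0// exprn_ge0// mulr_ge0// addr_ge0.
have q0 : 0 < e / (c + 1) by rewrite divr_gt0// ltr_wpDl.
(* The power [m] undoes the exponent [1 - theta], which is [m^-1]. *)
pose eta := Num.min 1 ((e / (c + 1)) ^+ m).
have eta0 : 0 < eta by rewrite lt_min ltr01 exprn_gt0.
have etaE : c * eta `^ (1 - theta) <= e.
  apply: (@le_trans _ _ (c * (e / (c + 1)))).
    rewrite ler_wpM2l// /theta opprB addrCA subrr addr0.
    have -> : e / (c + 1) = ((e / (c + 1)) ^+ m) `^ m%:R^-1.
      by rewrite -powR_mulrn ?ltW// -powRrM mulfV ?gt_eqF// powRr1 ?ltW.
    apply: ge0_ler_powR; rewrite ?nnegrE.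
    - by rewrite invr_ge0.
    - exact: ltW.
    - by rewrite exprn_ge0// ltW.
    - by rewrite ge_min lexx orbT.
  by rewrite mulrCA ger_pMr// ler_pdivrMr ?ltr_wpDl// mul1r lerDl.
exists eta => // B r g h r0 sB hg hh gh.
have pB := small_box_proper sB.
have er0 : 0 <= eta * r by rewrite mulr_ge0 ?ltW.
have M2 : 0 <= M -> M <= 2 * (1 + M) by lra.
have M0 i : 0 <= M := sup_holder_ge0 (hg i).
have loc (k : 'I_n -> 'rV[R]_n -> R) : integral_fdg B (fun=> 1) k =
    integral_fdg B (fun=> 1) (fun i => k i \o clamp B).
  by apply: eq_integral_fdg => // i x /set_mem xB /=; rewrite clamp_id.
rewrite (loc g) (loc h).
have := tK B r (fun=> 1) _ _ 0 _ (fun=> 2 * (1 + M) * (eta * r) `^ (1 - theta))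
  (ltW r0) sB (sup_holder_cst 1 1)
  (fun i => lipschitz_clamp_holder t01 (ltW r0) sB (hg i))
  (fun i => lipschitz_clamp_holder t01 (ltW r0) sB (hh i))
  (fun i => diff_clamp_holder t01 er0 pB (hg i) (hh i) (gh i)) _ (corner_in pB).
move/le_trans; apply; rewrite normr1 mul0r addr0 mulr1.
apply: (@le_trans _ _ (K * \sum_(i < n) ((2 * (1 + `|M|)) ^+ n * eta `^ (1 - theta) * r ^+ n))).
  rewrite ler_wpM2l//; apply: ler_sum => i _.
  have Mn : `|M| = M by rewrite ger0_norm// (M0 i).
  have rE : r = r `^ (1 - theta) * r `^ theta := powR_split theta (ltW r0).
  rewrite [leRHS](_ : _ = \prod_(j < n) ((2 * (1 + M) *
    (if j == i then eta `^ (1 - theta) else 1)) * r)); last first.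
    rewrite big_split big_split/= !prodr_const card_ord Mn; congr (_ * _ * _).
    by rewrite (bigD1 i)//= eqxx big1 ?mulr1// => j /negbTE ->.
  apply: ler_prod => j _; apply/andP; split.
    case: ifP => _; rewrite mulr_ge0 ?powR_ge0// mulr_ge0 ?powR_ge0 ?(M0 i)//.
    by rewrite mulr_ge0// addr_ge0// (M0 i).
  have [_|_] := ifP.
    rewrite powRM ?(ltW eta0) ?(ltW r0)// mulrA -[X in X <= _]mulrA -rE.
    exact: lexx.
  rewrite mulr1 -mulrA -rE ler_wpM2r ?(ltW r0)//.
  exact/M2/(M0 i).
rewrite sumr_const card_ord -[X in K * X]mulr_natl.
rewrite [leLHS](_ : _ = c * eta `^ (1 - theta) * r ^+ n); last by rewrite /c; ring.
by rewrite ler_wpM2r// exprn_ge0// ltW.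
Qed.

(** The error is measured by any radius [s] of a cube containing [y], so that one scale serves all
    points of a small box at once. *)
Definition differential_at n m (g : 'I_m -> 'rV[R]_n -> R) (G : 'M[R]_(m, n))
    (x : 'rV[R]_n) :=
  forall e : R, 0 < e -> exists2 dl, 0 < dl & forall (y : 'rV[R]_n) s, 0 <= s <= dl ->
    (forall i, `|y 0 i - x 0 i| <= s) ->
    forall i, `|g i y - g i x - \sum_k G i k * (y 0 k - x 0 k)| <= e * s.

Lemma integral_density n M g (G : 'M[R]_n) x A e : proper_box A ->
  (forall i, sup_holder 1 M (g i)) -> differential_at g G x -> 0 < e ->
  \forall k \near \oo, forall B, B \in dyadic k A -> box_set B x ->
    `|integral_fdg B (fun=> 1) g - \det G * volume B| <= e * volume B.
Proof.
move=> pA hg dg e0; have [r r0 sA] := proper_small_box pA.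
have v0 := volume_gt0 pA.
pose M' := `|M| + \sum_i \sum_k `|G i k|.
(* Dyadic subdivision preserves the ratio of the volume to the [n]-th power of the scale, so this
   tolerance becomes [e * volume B] on every dyadic box. *)
have [eta eta0 close] := @integral_close n M' (e * volume A / r ^+ n)
  (divr_gt0 (mulr_gt0 e0 v0) (exprn_gt0 n r0)).
have [dl dl0 dgx] := dg _ eta0.
have cvg0 : r * 2^-1 ^+ k @[k --> \oo] --> (0 : R).
  rewrite -[X in _ --> X](mulr0 r); apply: cvgM; first exact: cvg_cst.
  by apply: cvg_expr; rewrite ger0_norm ?invr_ge0// invf_lt1// ltr1n.
move/cvgrPdist_le : cvg0 => /(_ _ dl0); apply: filterS => k.
rewrite sub0r normrN => /(le_trans (ler_norm _)); rewrite exprVn => rk B BA xB.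
have sB := dyadic_small sA BA; have pB := dyadic_proper pA BA.
pose d i := g i x - \sum_k G i k * x 0 k.
rewrite -(integral_affine G d pB).
have rk0 : 0 < r / 2 ^+ k by rewrite divr_gt0// exprn_gt0.
rewrite [leRHS](_ : _ = e * volume A / r ^+ n * (r / 2 ^+ k) ^+ n); last first.
  rewrite (dyadic_volume BA) expr_div_n -!exprM mulnC.
  by field; rewrite !expf_neq0// gt_eqF.
apply: close => // [i|i|i y yB].
- apply: sup_holderW (hg i); rewrite /M'; apply: le_trans (ler_norm _) _.
  by rewrite lerDl sumr_ge0// => j _; rewrite sumr_ge0.
- apply: sup_holderW (affine_holder _ _ _).
  rewrite /M' -[leLHS]add0r lerD// [leRHS](bigD1 i)//= lerDl.
  by rewrite sumr_ge0// => j _; rewrite sumr_ge0.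
- rewrite /affine /d.
  rewrite [X in `|X|](_ : _ = g i y - g i x - \sum_k G i k * (y 0 k - x 0 k)).
    apply: dgx; first by rewrite (ltW rk0).
    move=> l; have := sB l; have := xB l; have := yB l.
    move=> /andP[? ?] /andP[? ?] /andP[? ?].
    by rewrite ler_norml; apply/andP; split; lra.
  under [in RHS]eq_bigr do rewrite mulrBr; rewrite sumrB; ring.
Qed.

End blow_up.

(** * Rademacher's theorem *)

Section lipschitz_real_functions.
Context {R : realType}.
Notation leb := (@lebesgue_measure R).

Lemma lebesgue_stieltjes_ocitv (H : cumulative R R) (a b : R) : a <= b ->
  lebesgue_stieltjes_measure H `]a, b]%classic = (H b - H a)%:E.
Proof.
move=> ab; rewrite /lebesgue_stieltjes_measure /measure_extension/=.
by rewrite measurable_mu_extE/= ?wlength_itv_bnd//; exact: is_ocitv.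
Qed.

Lemma lebesgue_stieltjes_le (H G : cumulative R R) : (forall x, H x + G x = x) ->
  forall A, measurable A -> (lebesgue_stieltjes_measure H A <= leb A)%E.
Proof.
move=> HG A mA.
have addE := measure_addE (lebesgue_stieltjes_measure H) (lebesgue_stieltjes_measure G).
rewrite (@lebesgue_measure_unique _ (measure_add (lebesgue_stieltjes_measure H)
  (lebesgue_stieltjes_measure G)))//; last first.
  move=> X /ocitvP[->|[[a b]/= ab ->]]; first by rewrite !measure0.
  apply: etrans (esym (addE _)).
  rewrite [LHS](lebesgue_stieltjes_ocitv idfun (ltW ab)).
  rewrite [X in (X + _)%E](lebesgue_stieltjes_ocitv H (ltW ab)).
  rewrite [X in (_ + X)%E](lebesgue_stieltjes_ocitv G (ltW ab)).
  by rewrite -EFinD; congr EFin => /=; rewrite -{1}(HG a) -{1}(HG b); ring.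
by rewrite [leRHS](addE A) leeDl.
Qed.

(* The Stieltjes measures of [H] and [G] add up to the Lebesgue measure, so that
   of [H] has a density, which is the derivative of [H] almost everywhere. *)
Lemma complementary_cumulative_ae_derivable (H G : cumulative R R) :
  (forall x, H x + G x = x) -> {ae leb, forall x, derivable H x 1}.
Proof.
move=> HG.
(* Localisation makes the Stieltjes measure finite and its density integrable on the line. *)
suff HN (N : nat) : {ae leb, forall x, - N%:R < x < N%:R -> derivable H x 1}.
  move/ae_foralln : HN; apply: filterS => x Hx.
  apply: (Hx (Num.bound `|x|)); rewrite -ltr_norml.
  by rewrite (le_lt_trans _ (archi_boundP _)).
have NN : - N%:R <= N%:R :> R by rewrite (@le_trans _ _ 0)// oppr_le0.
pose D := `](- N%:R : R), N%:R]%classic.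
have mD : measurable (D : set (measurableTypeR R)) by exact: measurable_itv.
have Doo : (lebesgue_stieltjes_measure H D < +oo)%E.
  by rewrite lebesgue_stieltjes_ocitv// ltry.
pose nu := charge_of_finite_measure (mfrestr mD Doo).
have numu : nu `<< leb.
  apply/null_content_dominatesP => A mA A0; apply/eqP; rewrite -measure_le0.
  rewrite -A0; apply: (@le_trans _ _ (lebesgue_stieltjes_measure H A)).
    exact: measureIl.
  exact: lebesgue_stieltjes_le HG _ mA.
pose f x := fine (Radon_Nikodym nu leb x).
have fE x : (f x)%:E = Radon_Nikodym nu leb x.
  by rewrite /f fineK// Radon_Nikodym_fin_num.
have intf : leb.-integrable setT (EFin \o f).
  apply: eq_integrable (Radon_Nikodym_integrable numu) => // x _ /=.
  by rewrite fE.
have := @FTC1Ny _ f _ _.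
move=> /(_ _ (open_integrable_locally openT intf)).
have intfS y : leb.-integrable `]-oo, y] (EFin \o f).
  exact: integrableS intf.
move=> /(_ intfS); apply: (@filterS _ _ (ae_filter_ringOfSetsType leb)) => x [+ _] /andP[Nx xN].
move=> dF; have : derivable
   (fun y : R => \int[leb]_(t in `]-oo, y]) f t + H (- N%:R)) x 1.
  by apply: derivableD => //; exact: derivable_cst.
apply: near_eq_derivable; near=> y.
have Ny : - N%:R < y by near: y; exact: lt_nbhsr.
have yN : y < N%:R by near: y; exact: lt_nbhsl.
rewrite /Rintegral; under eq_integral do rewrite fE.
rewrite -Radon_Nikodym_integral//.
rewrite /nu /charge_of_finite_measure /mfrestr /mrestr.
rewrite [X in fine X](_ : _ =
  lebesgue_stieltjes_measure H `](- N%:R), y]%classic); last first.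
  congr (lebesgue_stieltjes_measure H _).
  apply/seteqP; split=> z /=; rewrite /D/= !in_itv/=.
    by move=> [? /andP[? ?]]; apply/andP.
  by move=> /andP[? zy]; split => //; apply/andP; split=> //; rewrite (le_trans zy)// ltW.
by rewrite lebesgue_stieltjes_ocitv ?(ltW Ny)//= subrK.
Unshelve. all: by end_near. Qed.

Lemma derivable_affine_combination (f : R -> R) (c d x : R) :
  derivable f x 1 -> derivable (fun y => c * f y - d * y) x 1.
Proof.
move=> df.
have dc : derivable (cst c * f) x 1 by exact: derivableM (derivable_cst c x 1) df.
have dd : derivable (cst d * (@id R)) x 1.
  by apply: derivableM; [exact: derivable_cst|exact: derivable_id].
exact: derivableB dc dd.
Qed.

(** After division by [L], both [x + h x / L] and [x - h x / L] are nondecreasing. Their halves are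
    complementary cumulative functions, and [h] is a combination of the first one and the
    identity. *)
Lemma lipschitz_ae_derivable (h : R -> R) (L : R) :
  (forall x y, `|h x - h y| <= L * `|x - y|) -> {ae leb, forall x, derivable h x 1}.
Proof.
move=> hL; wlog L0 : L hL / 0 < L.
  apply; last exact: (ltr_pwDl ltr01 (normr_ge0 L)).
  move=> x y; apply: le_trans (hL x y) _; rewrite ler_wpM2r//.
  by have := ler_norm L; lra.
have hc : continuous h.
  move=> x; apply/cvgrPdist_le => e e0; near=> y.
  apply: le_trans (hL _ _) _; rewrite mulrC -ler_pdivlMr//.
  near: y; apply: cvgr_dist_le; [exact: cvg_id|exact: divr_gt0].
pose H s x := (x + s * (h x / L)) / 2.
have Hnd s : `|s| = 1 -> {homo H s : x y / x <= y}.
  move=> s1 x y xy; rewrite /H ler_pM2r// -subr_ge0.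
  rewrite [X in 0 <= X](_ : _ = (y - x) - s * ((h x - h y) / L)); last by ring.
  rewrite subr_ge0 (le_trans (ler_norm _))// normrM s1 mul1r normrM normfV.
  rewrite (gtr0_norm L0) ler_pdivrMr// mulrC (le_trans (hL _ _))//.
  by rewrite distrC ger0_norm// subr_ge0.
have Hrc s : right_continuous (H s).
  apply/right_continuousW => x; apply: cvgM; last exact: cvg_cst.
  apply: cvgD; first exact: cvg_id.
  apply: cvgM; first exact: cvg_cst.
  by apply: cvgM; [exact: hc|exact: cvg_cst].
have s1 : `|1 : R| = 1 by rewrite normr1.
have s2 : `|-1 : R| = 1 by rewrite normrN1.
pose M1 := isCumulative.Build R _ R (H 1) (Hnd _ s1) (Hrc 1).
pose C1 : cumulative R R := HB.pack (H 1) M1.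
pose M2 := isCumulative.Build R _ R (H (-1)) (Hnd _ s2) (Hrc (-1)).
pose C2 : cumulative R R := HB.pack (H (-1)) M2.
have C12 x : C1 x + C2 x = x by rewrite /= /H; field; rewrite gt_eqF.
have := complementary_cumulative_ae_derivable C12.
apply: (@filterS _ _ (ae_filter_ringOfSetsType leb)) => x /= dH.
have -> : h = fun y => 2 * L * H 1 y - L * y.
  by apply/funext => y; rewrite /H; field; rewrite gt_eqF.
exact: derivable_affine_combination.
Unshelve. all: by end_near. Qed.

End lipschitz_real_functions.

(** * Measurable and negligible sets of row vectors *)

Section lebesgue_measure_rows.
Context {R : realType}.
Notation RT := (measurableTypeR R).
Notation leb := (@lebesgue_measure R).
Notation lebn := (@lebesgue_measure_n R).

(** Topology and derivatives live on rows, the measure on tuples; sets of rows are measured through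
    their preimages. *)
Definition row_of_tuple n (t : n.-tuple RT) : 'rV[R]_n := \row_i tnth t i.

Definition row_measurable n (X : set 'rV[R]_n) :=
  measurable (@row_of_tuple n @^-1` X).

Definition row_negligible n (X : set 'rV[R]_n) :=
  (lebn n).-negligible (@row_of_tuple n @^-1` X).

Lemma row_negligibleS n (X Y : set 'rV[R]_n) :
  X `<=` Y -> row_negligible Y -> row_negligible X.
Proof. by move=> XY; apply: negligibleS => t; exact: XY. Qed.

Lemma row_negligible_bigcup (T : countType) n (F : T -> set 'rV[R]_n) :
  (forall k, row_negligible (F k)) -> row_negligible (\bigcup_k F k).
Proof.
move=> nF; pose G m := if unpickle m is Some k then F k else set0.
apply: (@row_negligibleS _ _ (\bigcup_m G m)).
  by move=> x [k _ Fkx]; exists (pickle k) => //; rewrite /G pickleK.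
rewrite /row_negligible preimage_bigcup; apply: negligible_bigcup => m.
by rewrite /G; case: unpickle => [k|]; [exact: nF|rewrite preimage_set0; exact: negligible_set0].
Qed.

Lemma row_negligibleU n (X Y : set 'rV[R]_n) :
  row_negligible X -> row_negligible Y -> row_negligible (X `|` Y).
Proof. by move=> nX nY; rewrite /row_negligible preimage_setU; exact: negligibleU. Qed.

Lemma row_measurable_bigcup (T : countType) n (F : T -> set 'rV[R]_n) :
  (forall k, row_measurable (F k)) -> row_measurable (\bigcup_k F k).
Proof.
move=> mF; rewrite /row_measurable preimage_bigcup.
by apply: countable_bigcupT_measurable => //; exact: countableP.
Qed.

Lemma row_measurableC n (X : set 'rV[R]_n) : row_measurable X -> row_measurable (~` X).
Proof. by move=> mX; rewrite /row_measurable preimage_setC; exact: measurableC. Qed.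

Lemma row_measurable_coord n (I : 'I_n -> set R) :
  (forall i, measurable (I i : set RT)) ->
  row_measurable [set x : 'rV[R]_n | forall i, I i (x 0 i)].
Proof.
move=> mI; rewrite /row_measurable.
rewrite [X in measurable X](_ : _ = \bigcap_i ((fun t : n.-tuple RT => tnth t i) @^-1` I i)).
  apply: fin_bigcap_measurable; first exact: finite_finset.
  by move=> i _; rewrite -[X in measurable X]setTI; exact: measurable_tnth.
by apply/seteqP; split=> t /= h i; have := h i; rewrite mxE//; apply.
Qed.

Lemma row_nbhsP n (x : 'rV[R]_n) (P : set 'rV[R]_n) : nbhs x P <->
  exists2 e : R, 0 < e & forall y : 'rV[R]_n, (forall i, `|x 0 i - y 0 i| < e) -> P y.
Proof.
rewrite -filter_from_ballE; split=> -[e /= e0 eP]; exists e => //.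
  by move=> y xy; apply: eP; split=> // i j; rewrite (ord1 i); exact: xy.
by move=> y [_ xy]; apply: eP => i; exact: xy.
Qed.

(** An open set is the countable union of the cubes with rational centre and radius [1/(m+1)] that
    it contains. *)
Lemma open_row_measurable n (U : set 'rV[R]_n) : open U -> row_measurable U.
Proof.
move=> oU.
pose cube (c : {ffun 'I_n -> rat} * nat) : set 'rV[R]_n :=
  [set x : 'rV[R]_n | forall i,
    `](ratr (c.1 i) - c.2.+1%:R^-1), (ratr (c.1 i) + c.2.+1%:R^-1)[%classic (x 0 i)].
pose F c := if `[< cube c `<=` U >] then cube c else set0.
have -> : U = \bigcup_c F c.
  apply/seteqP; split=> [x Ux|x [c _]]; last by rewrite /F; case: asboolP => // + cx; apply.
  have /row_nbhsP[e e0 eU] : nbhs x U by exact: open_nbhs_nbhs.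
  have e20 : 0 < e / 2 by rewrite divr_gt0.
  pose m := Num.bound (e / 2)^-1.
  have m0 : 0 < (m.+1%:R : R)^-1 by rewrite invr_gt0.
  have me : (m.+1%:R : R)^-1 < e / 2.
    rewrite -[ltRHS]invrK ltf_pV2 ?posrE// ?invr_gt0//.
    by rewrite (lt_le_trans (archi_boundP _))// ?invr_ge0 ?(ltW e20)// ler_nat.
  have q i : exists q : rat, ratr q \in `](x 0 i - m.+1%:R^-1), (x 0 i + m.+1%:R^-1)[.
    by apply: rat_in_itvoo; rewrite ltrD2l gt0_cp.
  have [c cP] := choice q.
  have aux (p q' d : R) : q' - d < p -> p < q' + d -> p - d < q' < p + d.
    by move=> *; apply/andP; split; lra.
  have aux2 (p d y z : R) : d < e / 2 -> p - d < y -> y < p + d -> p - d < z ->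
      z < p + d -> `|z - y| < e.
    by move=> *; rewrite ltr_norml; apply/andP; split; lra.
  have xc : cube ([ffun i => c i], m) x.
    move=> i /=; rewrite ffunE; have := cP i; rewrite !in_itv/= => /andP[? ?].
    exact: aux.
  exists ([ffun i => c i], m) => //; rewrite /F asboolT// => y yc; apply: eU => i.
  have := xc i; have := yc i; rewrite /= !in_itv/= => /andP[y1 y2] /andP[z1 z2].
  exact: (aux2 _ _ _ _ me y1 y2 z1 z2).
apply: row_measurable_bigcup => c; rewrite /F; case: asboolP => _.
  apply: (row_measurable_coord (I := fun i =>
    `](ratr (c.1 i) - c.2.+1%:R^-1), (ratr (c.1 i) + c.2.+1%:R^-1)[%classic)) => i.
  exact: measurable_itv.
by rewrite /row_measurable preimage_set0.
Qed.

Lemma closed_row_measurable n (K : set 'rV[R]_n) : closed K -> row_measurable K.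
Proof.
by rewrite -openC => /open_row_measurable/row_measurableC; rewrite setCK.
Qed.

Definition set_coord n (x : 'rV[R]_n) (i : 'I_n) (s : R) : 'rV[R]_n :=
  \row_k (if k == i then s else x 0 k).

Definition tset n (t : n.-tuple RT) (i : 'I_n) (s : RT) : n.-tuple RT :=
  [tuple if k == i then s else tnth t k | k < n].

Lemma tset_cons0 n (x s : RT) (t : n.-tuple RT) :
  tset (tcons (x, t)) ord0 s = tcons (s, t).
Proof.
apply: eq_from_tnth => k; rewrite tnth_mktuple.
case: (unliftP ord0 k) => [l ->|->]; last by rewrite eqxx.
by rewrite eq_sym (negbTE (neq_lift _ _)) !tnthS.
Qed.

Lemma tset_consS n (x s : RT) (t : n.-tuple RT) k :
  tset (tcons (x, t)) (lift ord0 k) s = tcons (x, tset t k s).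
Proof.
apply: eq_from_tnth => l; rewrite tnth_mktuple.
case: (unliftP ord0 l) => [m ->|->]; last by rewrite (negbTE (neq_lift _ _)).
by rewrite (inj_eq lift_inj) !tnthS tnth_mktuple.
Qed.

Lemma measurable_tcons_preimage n (M : set (n.+1.-tuple RT)) :
  measurable M -> measurable (@tcons R n @^-1` M).
Proof. by move=> mM; rewrite -[X in measurable X]setTI; exact: measurable_tcons. Qed.

(** Fubini along one coordinate direction. If [i] is not the first coordinate, the slices with fixed
    first coordinate are null by induction. *)
Lemma tuple_null_lines n (i : 'I_n) (M : set (n.-tuple RT)) : measurable M ->
  (forall t, leb.-negligible [set s | M (tset t i s)]) -> lebn n M = 0%E.
Proof.
elim: n i M => [[]//|n IH] i M mM Mi.
rewrite /= /lebesgue_step /pushforward.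
have mM' := measurable_tcons_preimage mM; set M' := _ @^-1` M in mM' *.
case: (unliftP ord0 i) => [k ik|i0].
  rewrite /product_measure1 integral0_eq// => x _ /=.
  apply: (IH k); first exact: measurable_xsection.
  move=> t; apply: negligibleS (Mi (tcons (x, t))) => s /=.
  by rewrite ik tset_consS /xsection/= inE.
(* For the first coordinate the lines must be the inner integral, so the product measure is
   evaluated in the other order. *)
transitivity ((leb \x^ lebn n)%E M').
  apply: product_measure_unique => // A B mA mB; exact: product_measure2E.
rewrite /product_measure2 integral0_eq// => t _ /=.
apply/negligibleP; first exact: measurable_ysection.
apply: negligibleS (Mi (tcons (0, t))) => s /=.
by rewrite i0 tset_cons0 /ysection/= inE.
Qed.

Lemma row_negligible_lines n (i : 'I_n) (X : set 'rV[R]_n) : row_measurable X ->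
  (forall x, leb.-negligible [set s | X (set_coord x i s)]) -> row_negligible X.
Proof.
move=> mX Xi; apply/negligibleP => //; apply: (tuple_null_lines (i := i)) => // t.
apply: negligibleS (Xi (row_of_tuple t)) => s /=.
rewrite (_ : row_of_tuple _ = set_coord (row_of_tuple t) i s)//.
by apply/rowP => k; rewrite !mxE tnth_mktuple.
Qed.

Lemma hyperplane_negligible n (i : 'I_n) (c : R) :
  row_negligible [set x : 'rV[R]_n | x 0 i = c].
Proof.
apply: (row_negligible_lines (i := i)).
  rewrite [X in row_measurable X](_ : _ =
    [set x : 'rV[R]_n | forall k, (if k == i then [set c] else setT) (x 0 k)]).
    apply: (row_measurable_coord (I := fun k => if k == i then [set c] else setT)) => k.
    by case: ifP => _; [exact: measurable_set1|exact: measurableT].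
  apply/seteqP; split=> x /=; first by move=> xi k; case: ifP => // /eqP ->.
  by move=> /(_ i); rewrite eqxx.
have nc : leb.-negligible ([set c] : set RT).
  by apply/negligibleP; [exact: measurable_set1|exact: lebesgue_measure_set1].
by move=> x; apply: negligibleS nc => s /=; rewrite mxE eqxx.
Qed.

Lemma box_row_measurable n (A : @box R n) : row_measurable (box_set A).
Proof.
rewrite (_ : box_set A = [set x : 'rV[R]_n | forall i, `[A.1 0 i, A.2 0 i]%classic (x 0 i)]).
  apply: (row_measurable_coord (I := fun i => `[A.1 0 i, A.2 0 i]%classic)) => i.
  exact: measurable_itv.
by apply/seteqP; split=> x /= xA i; have := xA i; rewrite /= in_itv.
Qed.

Lemma lebesgue_measure_box n (A : @box R n) : proper_box A ->
  lebn n (@row_of_tuple n @^-1` box_set A) = (volume A)%:E.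
Proof.
elim: n A => [|n IH] A pA.
  rewrite /= /volume big_ord0 diracE mem_set//; by case.
rewrite /= /lebesgue_step /pushforward.
have -> : @tcons R n @^-1` (@row_of_tuple n.+1 @^-1` box_set A) =
    `[A.1 0 ord0, A.2 0 ord0]%classic `*`
    (@row_of_tuple n @^-1` box_set (omit_coord ord0 A)).
  apply/seteqP; split=> -[x t] /=.
    move=> xA; split; first by have := xA ord0; rewrite mxE in_itv.
    by move=> i; have := xA (lift ord0 i); rewrite !mxE tnthS.
  move=> [x0 tA] i; rewrite mxE; case: (unliftP ord0 i) => [k ->|->].
    by have := tA k; rewrite !mxE tnthS.
  by move: x0; rewrite in_itv.
rewrite product_measure1E//; last exact: box_row_measurable.
have AE : leb `[A.1 0 ord0, A.2 0 ord0]%classic = (A.2 0 ord0 - A.1 0 ord0)%:E.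
  by rewrite lebesgue_measure_itv/= lte_fin pA.
rewrite [X in (X * _)%E]AE IH; last exact: omit_proper.
rewrite -EFinM; congr EFin; rewrite /volume big_ord_recl; congr (_ * _).
by apply: eq_bigr => i _; rewrite !mxE.
Qed.

End lebesgue_measure_rows.

(** * From slopes in coordinate directions to the total differential *)

Section rademacher.
Context {R : realType}.
Notation leb := (@lebesgue_measure R).
Implicit Types n : nat.

Lemma sup_holder_continuous n L (f : 'rV[R]_n -> R) : sup_holder 1 L f -> continuous f.
Proof.
move=> hf x P /nbhs_ballP[e /= e0 eP]; rewrite nbhs_simpl; apply/row_nbhsP.
have L0 := sup_holder_ge0 hf.
have L10 : 0 < L + 1 by rewrite ltr_wpDl.
exists (e / (L + 1)); first by rewrite divr_gt0.
move=> y xy; apply: eP; apply: le_lt_trans (hf _ _ (e / (L + 1)) _ _) _.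
- by rewrite divr_ge0 ?ltW.
- by move=> k; exact/ltW.
rewrite powRr1 ?divr_ge0 ?ltW// mulrCA gtr_pMr// ltr_pdivrMr// mul1r ltrDl.
exact: ltr01.
Qed.

Lemma closed_sublevel n L c (f : 'rV[R]_n -> R) :
  sup_holder 1 L f -> closed [set x | f x <= c].
Proof.
move=> /sup_holder_continuous cf.
by apply: (@preimage_closed _ _ f [set y | y <= c]); [move=> x _; exact: cf|exact: closed_le].
Qed.

Lemma sup_holder_norm n a L (f : 'rV[R]_n -> R) :
  sup_holder a L f -> sup_holder a L (fun x => `|f x|).
Proof.
by move=> hf x y r r0 xy; apply: le_trans (ler_dist_dist _ _) _; exact: hf.
Qed.

Definition shift_coord n (x : 'rV[R]_n) (i : 'I_n) (t : R) := set_coord x i (x 0 i + t).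

Lemma sup_holder_shift n a L (f : 'rV[R]_n -> R) i t :
  sup_holder a L f -> sup_holder a L (fun x => f (shift_coord x i t)).
Proof.
move=> hf x y r r0 xy; apply: hf => // k; rewrite !mxE; case: (k =P i) => [_|//].
by rewrite opprD addrACA subrr addr0.
Qed.

Lemma shift_coord_dist n a L (f : 'rV[R]_n -> R) x i t :
  sup_holder a L f -> `|f (shift_coord x i t) - f x| <= L * `|t| `^ a.
Proof.
move=> hf; apply: hf => // k; rewrite mxE; case: eqP => [->|_].
  by rewrite addrAC subrr add0r.
by rewrite subrr normr0.
Qed.

Lemma shift_set_coord n (x : 'rV[R]_n) i s t :
  shift_coord (set_coord x i s) i t = set_coord x i (s + t).
Proof. by apply/rowP => k; rewrite !mxE eqxx; case: eqP. Qed.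

Lemma set_coord_dist n L (f : 'rV[R]_n -> R) x i s t : sup_holder 1 L f ->
  `|f (set_coord x i s) - f (set_coord x i t)| <= L * `|s - t|.
Proof.
move=> hf; have := hf (set_coord x i s) (set_coord x i t) `|s - t| (normr_ge0 _).
rewrite powRr1//; apply => k; rewrite !mxE.
by case: eqP => // _; rewrite subrr normr0.
Qed.

(* [f] has slope [q], up to the error [1/(m+1)], in the coordinate direction [i]
   at all points of this closed set and at all scales below [1/(l+1)]. *)
Definition slope_set n (f : 'rV[R]_n -> R) (i : 'I_n) (m : nat) (q : R) (l : nat) :=
  [set x | forall t, `|t| <= l.+1%:R^-1 ->
     `|f (shift_coord x i t) - f x - t * q| <= `|t| / m.+1%:R].

Lemma slope_set_closed n f i m q l L :
  sup_holder 1 L f -> closed (@slope_set n f i m q l).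
Proof.
move=> hf.
rewrite (_ : slope_set _ _ _ _ _ = \bigcap_(t in [set t | `|t| <= l.+1%:R^-1])
   [set x | `|f (shift_coord x i t) - f x - t * q| <= `|t| / m.+1%:R]); last first.
  by apply/seteqP; split=> x.
apply: closed_bigI => t _.
apply: (@closed_sublevel _ (`|1| * L + (`|-1| * L + 0))).
apply: sup_holder_norm.
have := sup_holder_lin 1 (sup_holder_shift i t hf)
  (sup_holder_lin (-1) hf (sup_holder_cst 1 (- (t * q)))).
congr (sup_holder _ _ _); apply/funext => x; ring.
Qed.

Lemma derivable_slope (h : R -> R) s m : derivable h s 1 ->
  exists (q : rat) (l : nat), forall t, `|t| <= l.+1%:R^-1 ->
    `|h (s + t) - h s - t * ratr q| <= `|t| / m.+1%:R.
Proof.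
have aux (l p d : R) : l - d < p -> p < l + d -> - d <= l - p <= d.
  by move=> *; apply/andP; split; lra.
move=> /cvg_ex[l0 /cvgrPdist_le].
(* One half of the tolerance is for the difference quotient, the other for the rational
   approximation of the derivative. *)
have e0 : 0 < (m.+1%:R^-1 / 2 : R) by rewrite divr_gt0.
move=> /(_ _ e0) [d /= d0 dP].
have [q qP] := @rat_in_itvoo R (l0 - m.+1%:R^-1 / 2) (l0 + m.+1%:R^-1 / 2)
  ltac:(by rewrite ltrD2l gt0_cp).
exists q, (Num.bound d^-1) => t tl.
have [->|t0] := eqVneq t 0.
  by rewrite addr0 subrr mul0r subrr normr0 mul0r.
have td : ball_ Num.norm 0 d t.
  rewrite /ball_/= sub0r normrN; apply: le_lt_trans tl _.
  rewrite -[ltRHS]invrK ltf_pV2 ?posrE ?invr_gt0//.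
  by rewrite (lt_le_trans (archi_boundP _))// ?invr_ge0 ?(ltW d0)// ler_nat.
have := dP t td t0.
rewrite /shift/= [t *: 1]mulr1 (addrC t s) => dt.
have {}dt : `|t * l0 - (h (s + t) - h s)| <= `|t| * (m.+1%:R^-1 / 2).
  rewrite -[X in `|_ - X|](mulVKf t0) -mulrBr normrM ler_wpM2l//.
have qd : `|l0 - ratr q| <= m.+1%:R^-1 / 2.
  move: qP; rewrite in_itv/= => /andP[q1 q2]; rewrite ler_norml.
  exact: aux.
rewrite [X in `|X|](_ : _ = - (t * l0 - (h (s + t) - h s)) + t * (l0 - ratr q));
  last by ring.
apply: le_trans (ler_normD _ _) _; rewrite normrN normrM.
apply: (@le_trans _ _ (`|t| * (m.+1%:R^-1 / 2) + `|t| * (m.+1%:R^-1 / 2))).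
  by rewrite lerD// ler_wpM2l.
by rewrite -mulrDr -splitr.
Qed.

(** Rational slopes and discrete scales make the exceptional set a countable combination of closed
    sets, hence measurable; along each line it is null by the one-variable theorem. *)
Lemma slope_ae n (f : 'rV[R]_n -> R) L i : sup_holder 1 L f ->
  row_negligible [set x | ~ forall m, exists (q : rat) (l : nat),
    slope_set f i m (ratr q) l x].
Proof.
move=> hf.
pose N := \bigcup_m (~` \bigcup_(p : rat * nat) slope_set f i m (ratr p.1) p.2).
apply: (@row_negligibleS _ _ _ N).
  move=> x /= /existsNP[m mx]; exists m => //= -[[q l] _ qlx].
  by apply: mx; exists q, l.
apply: (row_negligible_lines (i := i)).
  apply: row_measurable_bigcup => m; apply: row_measurableC.
  apply: row_measurable_bigcup => p; apply: closed_row_measurable.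
  exact: slope_set_closed hf.
move=> x.
have := lipschitz_ae_derivable (fun s t => set_coord_dist x i s t hf).
apply: negligibleS => s /= -[m _ mx] dh; apply: mx.
have [q [l ql]] := derivable_slope m dh.
by exists (q, l) => // t tl; rewrite shift_set_coord; exact: ql.
Qed.

Section distance.
Variables (n : nat) (K : set 'rV[R]_n).
Hypothesis K0 : K !=set0.

(** Radii of the closed cubes around [x] that meet [K]. The condition [0 <= r] keeps the infimum
    meaningful in dimension 0. *)
Definition sup_distance_set (x : 'rV[R]_n) : set R :=
  [set r | 0 <= r /\ exists2 z, K z & forall i, `|z 0 i - x 0 i| <= r].

Definition sup_distance x := inf (sup_distance_set x).

Lemma sup_distance_lb x : has_lbound (sup_distance_set x).
Proof. by exists 0 => r []. Qed.

Lemma sup_distance_nonempty x : sup_distance_set x !=set0.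
Proof.
have [z Kz] := K0; exists (\sum_i `|z 0 i - x 0 i|); split; first exact: sumr_ge0.
by exists z => // i; rewrite (bigD1 i)//= lerDl sumr_ge0.
Qed.

Lemma sup_distance_ge0 x : 0 <= sup_distance x.
Proof. by apply: lb_le_inf; [exact: sup_distance_nonempty|move=> r []]. Qed.

Lemma sup_distance_in x : K x -> sup_distance x = 0.
Proof.
move=> Kx; apply/eqP; rewrite eq_le sup_distance_ge0 andbT.
apply: ge_inf; first exact: sup_distance_lb.
by split=> //; exists x => // i; rewrite subrr normr0.
Qed.

Lemma sup_distance_lt x r : sup_distance x < r ->
  exists2 z, K z & forall i, `|z 0 i - x 0 i| <= r.
Proof.
move=> /inf_lt[|s [_ [z Kz zx]] sr]; first exact: sup_distance_nonempty.
by exists z => // i; apply: le_trans (zx i) (ltW sr).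
Qed.

Lemma sup_distance_holder : sup_holder 1 1 sup_distance.
Proof.
have H (x y : 'rV[R]_n) (r : R) : 0 <= r -> (forall i, `|x 0 i - y 0 i| <= r) ->
    sup_distance x <= sup_distance y + r.
  move=> r0 xy; rewrite -lerBlDr; apply: lb_le_inf; first exact: sup_distance_nonempty.
  move=> s [s0 [z Kz zy]]; rewrite lerBlDr; apply: ge_inf; first exact: sup_distance_lb.
  split; first exact: addr_ge0.
  exists z => // i; rewrite (_ : _ - _ = (z 0 i - y 0 i) + (y 0 i - x 0 i)); last by ring.
  by apply: le_trans (ler_normD _ _) _; rewrite lerD// distrC.
move=> x y r r0 xy; rewrite mul1r powRr1// ler_norml.
have h1 := H x y r r0 xy.
have h2 : sup_distance y <= sup_distance x + r by apply: H => // i; rewrite distrC.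
by apply/andP; split; lra.
Qed.

End distance.

(* The distance to [K] is minimal on [K], so its partial derivatives vanish at
   almost every point of [K]: this replaces the Lebesgue density theorem. *)
Definition reachable_set n (K : set 'rV[R]_n) (i : 'I_n) (e : R) (l : nat) :=
  K `&` [set x | forall s, `|s| <= l.+1%:R^-1 ->
    sup_distance K (shift_coord x i s) <= e * `|s|].

Lemma reachable_set_closed n (K : set 'rV[R]_n) i e l :
  K !=set0 -> closed K -> closed (reachable_set K i e l).
Proof.
move=> K0 cK; apply: closedI => //.
rewrite (_ : [set _ | _] = \bigcap_(s in [set s | `|s| <= l.+1%:R^-1])
   [set x | sup_distance K (shift_coord x i s) <= e * `|s|]); last first.
  by apply/seteqP; split=> x.
apply: closed_bigI => s _; apply: (@closed_sublevel _ 1).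
exact/sup_holder_shift/sup_distance_holder.
Qed.

Lemma reachable_ae n (K : set 'rV[R]_n) i e : K !=set0 -> 0 < e ->
  row_negligible (K `\` \bigcup_l reachable_set K i e l).
Proof.
move=> K0 e0; apply: row_negligibleS (slope_ae i (sup_distance_holder K0)).
move=> x [Kx +] /= sx; apply.
have [q [l sl]] := sx (Num.bound (2 / e)).
exists l => //; split => // s ls.
set m := Num.bound _ in sl.
have m0 : 0 < (m.+1%:R^-1 : R) by rewrite invr_gt0.
have me : m.+1%:R^-1 <= e / 2.
  rewrite -[leRHS]invrK lef_pV2 ?posrE ?invr_gt0 ?divr_gt0// invf_div.
  by rewrite (le_trans (ltW (archi_boundP _)))// ?divr_ge0 ?(ltW e0)// ler_nat.
have h1 := sl s ls.
have h2 : `|sup_distance K (shift_coord x i (- s)) - sup_distance K x - - s * ratr q|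
   <= `|- s| / m.+1%:R by apply: sl; rewrite normrN.
(* Adding the estimates for [s] and [- s] cancels the slope; since both distances are nonnegative,
   each is at most [e] times the size of [s]. *)
move: h1 h2; rewrite normrN (sup_distance_in K0 Kx) !subr0 mulNr opprK.
have := sup_distance_ge0 K0 (shift_coord x i (- s)).
rewrite !ler_norml; move: (sup_distance K _) (sup_distance K _) => d1 d2.
move=> d10 /andP[_ u1] /andP[_ u2].
have : `|s| / m.+1%:R <= `|s| * (e / 2) by rewrite ler_wpM2l.
move: (`|s| / m.+1%:R) (s * ratr q) u1 u2 => E F; lra.
Qed.

(* [y] is reached from [x] by moving along the first [p] coordinates one after
   the other, passing close to points of [K], where [g] is almost constant in
   each coordinate direction. *)
Definition chain_at n (g : 'rV[R]_n -> R) (K : set 'rV[R]_n) (e L : R) (p : nat)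
    (x : 'rV[R]_n) :=
  exists2 d : R, 0 < d & forall (y : 'rV[R]_n) r, 0 <= r <= d ->
    (forall i, `|y 0 i - x 0 i| <= r) -> (forall i : 'I_n, (p <= i)%N -> y 0 i = x 0 i) ->
    exists2 z, K z & (forall i, `|z 0 i - y 0 i| <= p%:R * (2 * e) * r) /\
      `|g z - g x| <= p%:R * ((1 + 2 * L) * e) * r.

(** The point reached after [p] coordinates must itself allow a step in the next direction that ends
    near [K]. The induction on [p] is therefore over all closed [K] and is applied to the smaller
    sets [reachable_set K i e l], which exhaust [K] up to a null set. *)
Lemma chain_ae n (g : 'rV[R]_n -> R) L e d p (K : set 'rV[R]_n) :
  (p <= n)%N -> 0 < e -> 0 < d -> sup_holder 1 L g -> closed K ->
  (forall (x : 'rV[R]_n) i t, K x -> `|t| <= d -> `|g (shift_coord x i t) - g x| <= e * `|t|) ->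
  row_negligible (K `&` [set x | ~ chain_at g K e L p x]).
Proof.
move=> pn e0 d0 hg; elim: p pn K => [|p IH] pn K cK gK.
  apply: (@row_negligibleS _ _ _ set0); last first.
    by rewrite /row_negligible preimage_set0; exact: negligible_set0.
  move=> x [Kx]; apply; exists 1 => // y r _ _ yx.
  have -> : y = x by apply/rowP => i; exact: yx.
  by exists x => //; split=> [i|]; rewrite subrr normr0 !mul0r.
have [->|/set0P K0] := eqVneq K set0.
  by rewrite set0I /row_negligible preimage_set0; exact: negligible_set0.
pose i := Ordinal pn.
have L0 := sup_holder_ge0 hg.
have step l : row_negligible (reachable_set K i e l `&`
    [set x | ~ chain_at g (reachable_set K i e l) e L p x]).
  apply: IH; [exact: ltnW|exact: reachable_set_closed|].
  by move=> x k t [Kx _]; exact: gK.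
apply: (@row_negligibleS _ _ _ ((K `\` \bigcup_l reachable_set K i e l) `|`
   \bigcup_l (reachable_set K i e l `&`
    [set x | ~ chain_at g (reachable_set K i e l) e L p x]))); last first.
  apply: row_negligibleU; first exact: reachable_ae.
  exact: row_negligible_bigcup.
move=> x [Kx nCx].
have [[l _ xl]|nl] := pselect ((\bigcup_l reachable_set K i e l) x); last by left.
right; exists l => //; split => //= -[d' d'0 chain]; apply: nCx.
exists (Num.min d' (Num.min d l.+1%:R^-1)).
  by rewrite !lt_min d'0 d0 invr_gt0 ltr0n.
move=> y r /andP[r0]; rewrite !le_min => /and3P[rd' rd rl] xy yx.
(* [y'] postpones the move in direction [i]: it differs from [x] in the first [p] coordinates only,
   and the step [s] is made afterwards from the point [z'] near [y']. *)
pose y' := set_coord y i (x 0 i); pose s := y 0 i - x 0 i.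
have sr : `|s| <= r by exact: xy.
have [|||z' [Kz' z'l] [z'y' gz']] := chain y' r.
- by rewrite r0.
- by move=> k; rewrite mxE; case: eqP => [->|_]; rewrite ?subrr ?normr0.
- move=> k pk; rewrite mxE; case: eqP => [->//|/eqP ki].
  by apply: yx; rewrite ltn_neqAle pk andbT; apply: contra ki => /eqP pk'; apply/eqP/val_inj.
pose w := shift_coord z' i s.
have wy k : `|w 0 k - y 0 k| <= p%:R * (2 * e) * r.
  have := z'y' k; rewrite !mxE /s; case: eqP => [->|//].
  by rewrite (_ : z' 0 i + _ - _ = z' 0 i - x 0 i)//; ring.
have [z Kz zw] : exists2 z, K z & forall k, `|z 0 k - w 0 k| <= 2 * e * r.
  (* A point of [K] is found only at a radius strictly above the distance; this costs the factor 2
     and a separate treatment of [r = 0]. *)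
  have [r00|r00] := eqVneq r 0.
    exists z' => // k; rewrite r00 mulr0 /w /shift_coord.
    have -> : s = 0 by apply/eqP; rewrite -normr_le0 -r00.
    by rewrite mxE addr0; case: eqP => [->|_]; rewrite subrr normr0.
  apply: (sup_distance_lt K0); apply: le_lt_trans (z'l s (le_trans sr rl)) _.
  apply: (@le_lt_trans _ _ (e * r)); first by rewrite ler_wpM2l// ltW.
  have : 0 < e * r by rewrite mulr_gt0// lt_def r00.
  lra.
exists z => //; split=> [k|].
  rewrite (_ : z 0 k - y 0 k = (z 0 k - w 0 k) + (w 0 k - y 0 k)); last by ring.
  apply: le_trans (ler_normD _ _) _; apply: le_trans (lerD (zw k) (wy k)) _.
  by rewrite -natr1 le_eqVlt; apply/orP; left; apply/eqP; ring.
have h1 : `|g z - g w| <= L * (2 * e * r).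
  have er0 : 0 <= 2 * e * r by rewrite !mulr_ge0// ltW.
  by have := hg _ _ _ er0 zw; rewrite powRr1.
have h2 : `|g w - g z'| <= e * r.
  apply: le_trans (gK z' i s Kz' (le_trans sr rd)) _.
  by rewrite ler_wpM2l// ltW.
rewrite (_ : g z - g x = (g z - g w) + (g w - g z') + (g z' - g x)); last by ring.
apply: le_trans (ler_normD _ _) _.
apply: le_trans (lerD (le_trans (ler_normD _ _) (lerD h1 h2)) gz') _.
by rewrite -natr1 le_eqVlt; apply/orP; left; apply/eqP; ring.
Qed.

(** The full chain ends at [z] in [K] near [y]. It contributes [n * (1 + 2 * L)], and the Lipschitz
    bound between [z] and [y] another [n * 2 * L]. *)
Lemma almost_constant_ae n (g : 'rV[R]_n -> R) L e d (K : set 'rV[R]_n) :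
  0 < e -> 0 < d -> sup_holder 1 L g -> closed K ->
  (forall (x : 'rV[R]_n) i t, K x -> `|t| <= d -> `|g (shift_coord x i t) - g x| <= e * `|t|) ->
  row_negligible (K `&` [set x : 'rV[R]_n | ~ exists2 d' : R, 0 < d' &
    forall (y : 'rV[R]_n) r, 0 <= r <= d' -> (forall i, `|y 0 i - x 0 i| <= r) ->
    `|g y - g x| <= n%:R * (1 + 4 * L) * e * r]).
Proof.
move=> e0 d0 hg cK gK.
apply: row_negligibleS (chain_ae (leqnn n) e0 d0 hg cK gK).
move=> x [Kx nx]; split => //= -[d' d'0 chain]; apply: nx; exists d' => // y r rd' yx.
have [|z Kz [zy gz]] := chain y r rd' yx; first by move=> i; rewrite leqNgt ltn_ord.
have /andP[r0 _] := rd'.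
have er0 : 0 <= n%:R * (2 * e) * r by rewrite !mulr_ge0// ltW.
have := hg _ _ _ er0 zy; rewrite powRr1// distrC => gyz.
rewrite (_ : g y - g x = (g y - g z) + (g z - g x)); last by ring.
apply: le_trans (ler_normD _ _) _; apply: le_trans (lerD gyz gz) _.
by rewrite le_eqVlt; apply/orP; left; apply/eqP; ring.
Qed.

Lemma nested_intervals (u v : nat -> R) : (forall m k, u m <= v k) ->
  exists c, forall m, u m <= c <= v m.
Proof.
move=> uv; have u0 : range u !=set0 by exists (u 0%N), 0%N.
exists (sup (range u)) => m; apply/andP; split.
  by apply: ub_le_sup; [exists (v 0%N) => _ [k _ <-]|exists m].
by apply: ge_sup => // _ [k _ <-].
Qed.

Lemma slopes_ae n (f : 'rV[R]_n -> R) L : sup_holder 1 L f ->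
  row_negligible [set x | ~ forall m, exists q : {ffun 'I_n -> rat}, exists l,
    forall i, slope_set f i m (ratr (q i)) l x].
Proof.
move=> hf; have := row_negligible_bigcup (fun i => slope_ae i hf).
apply: row_negligibleS => x /= nx; apply: contrapT => H; apply: nx => m.
have Hi i : exists p : rat * nat, slope_set f i m (ratr p.1) p.2 x.
  apply: contrapT => Hi; apply: H; exists i => //= /(_ m)[q [l ql]].
  by apply: Hi; exists (q, l).
have [p pP] := choice Hi.
exists [ffun i => (p i).1], (\max_i (p i).2) => i t tl; rewrite ffunE.
apply: pP; apply: le_trans tl _.
by rewrite lef_pV2 ?posrE ?ltr0n// ler_nat ltnS leq_bigmax.
Qed.

(** Differentiability with a linear part that may still depend on the accuracy [m], as the slopes
    come from countably many rational candidates. *)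
Definition approx_differentiable n (f : 'rV[R]_n -> R) (c : R) (x : 'rV[R]_n) :=
  forall m : nat, exists q : 'I_n -> R, exists2 d : R, 0 < d &
    forall (y : 'rV[R]_n) r, 0 <= r <= d -> (forall i, `|y 0 i - x 0 i| <= r) ->
      `|f y - f x - \sum_i q i * (y 0 i - x 0 i)| <= c / m.+1%:R * r.

Lemma rademacher_approx n (f : 'rV[R]_n -> R) L : sup_holder 1 L f ->
  exists2 c, 0 <= c & row_negligible [set x | ~ approx_differentiable f c x].
Proof.
move=> hf; have L0 := sup_holder_ge0 hf.
(* A nonempty slope set forces its slopes to be at most [L + 1] in absolute value, so [L'] is a
   Lipschitz constant for [f] minus the linear part. It does not depend on the accuracy, whence a
   single constant [c]. *)
pose L' := L + n%:R * (L + 1).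
exists (n%:R * (1 + 4 * L')).
  by rewrite mulr_ge0// addr_ge0// mulr_ge0// addr_ge0// mulr_ge0// addr_ge0.
pose K m (q : {ffun 'I_n -> rat}) l := \bigcap_i slope_set f i m (ratr (q i)) l.
pose g (q : {ffun 'I_n -> rat}) (x : 'rV[R]_n) := f x - \sum_i ratr (q i) * x 0 i.
pose bad m q l := K m q l `&` [set x : 'rV[R]_n | ~ exists2 d' : R, 0 < d' &
    forall (y : 'rV[R]_n) r, 0 <= r <= d' -> (forall i, `|y 0 i - x 0 i| <= r) ->
    `|g q y - g q x| <= n%:R * (1 + 4 * L') * m.+1%:R^-1 * r].
have bad0 m q l : row_negligible (bad m q l).
  have [K0|/set0P [x0 Kx0]] := eqVneq (K m q l) set0.
    by rewrite /bad K0 set0I /row_negligible preimage_set0; exact: negligible_set0.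
  have q1 i : `|ratr (q i) : R| <= L + 1.
    have t0 : 0 < (l.+1%:R^-1 : R) by rewrite invr_gt0.
    have := Kx0 i I l.+1%:R^-1; rewrite gtr0_norm// lexx => /(_ isT) h1.
    have := shift_coord_dist x0 i l.+1%:R^-1 hf.
    rewrite powRr1// (gtr0_norm t0) => h2.
    rewrite -(ler_pM2l t0) -{1}(gtr0_norm t0) -normrM.
    rewrite -[X in `|X|](subKr (f (shift_coord x0 i l.+1%:R^-1) - f x0)).
    apply: le_trans (ler_normB _ _) _; apply: le_trans (lerD h2 h1) _.
    rewrite mulrDr mulr1 (mulrC L) lerD2l ler_pdivrMr ?ltr0n//.
    by rewrite ler_peMr ?(ltW t0)// ler1n.
  have hgq : sup_holder 1 L' (g q).
    move=> x y r r0 xy; rewrite /g powRr1//.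
    rewrite [X in `|X|](_ : _ = (f x - f y) - \sum_i ratr (q i) * (x 0 i - y 0 i)); last first.
      by under [in RHS]eq_bigr do rewrite mulrBr; rewrite sumrB; ring.
    apply: le_trans (ler_normB _ _) _; rewrite mulrDl lerD//.
      by have := hf _ _ _ r0 xy; rewrite powRr1.
    apply: le_trans (ler_norm_sum _ _ _) _.
    apply: le_trans (ler_sum (G := fun=> (L + 1) * r) _ _) _.
      by move=> i _; rewrite normrM ler_pM.
    by rewrite sumr_const card_ord -[leLHS]mulr_natl mulrA.
  apply: (almost_constant_ae (d := l.+1%:R^-1)) => //; rewrite ?invr_gt0 ?ltr0n//.
    by apply: closed_bigI => i _; exact: slope_set_closed hf.
  move=> x i t Kx tl; rewrite mulrC /g.
  have -> : \sum_j ratr (q j) * shift_coord x i t 0 j =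
      \sum_j ratr (q j) * x 0 j + t * ratr (q i) :> R.
    rewrite (bigD1 i)//= [in RHS](bigD1 i)//= !mxE eqxx.
    rewrite (eq_bigr (fun j => ratr (q j) * x 0 j)); first by ring.
    by move=> j /negbTE ji; rewrite mxE ji.
  rewrite [X in `|X|](_ : _ = f (shift_coord x i t) - f x - t * ratr (q i)); last by ring.
  exact: Kx i I t tl.
apply: (@row_negligibleS _ _ _ ([set x | ~ forall m, exists q : {ffun 'I_n -> rat},
    exists l, forall i, slope_set f i m (ratr (q i)) l x] `|`
    \bigcup_(p : nat * {ffun 'I_n -> rat} * nat) bad p.1.1 p.1.2 p.2)); last first.
  by apply: row_negligibleU; [exact: slopes_ae hf|exact: row_negligible_bigcup].
move=> x /= nx; apply: contrapT => /not_orP[/contrapT xs nb]; apply: nx => m.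
have [q [l qlx]] := xs m.
exists (fun i => ratr (q i)); apply: contrapT => H; apply: nb.
exists (m, q, l) => //; split => //= -[d d0 dP]; apply: H; exists d => // y r rd yx.
apply: le_trans (dP y r rd yx); rewrite le_eqVlt; apply/orP; left; apply/eqP.
congr `|_|; rewrite /g; under [in LHS]eq_bigr do rewrite mulrBr; rewrite sumrB; ring.
Qed.

(** Testing two accuracies on a common coordinate step shows that their slopes differ by at most the
    sum of the errors; the error intervals then have a common point, the true slope. *)
Lemma differentiable_from_approx n (f : 'rV[R]_n -> R) c x : 0 <= c ->
  approx_differentiable f c x ->
  exists q : 'I_n -> R, forall e : R, 0 < e -> exists2 d : R, 0 < d &
    forall (y : 'rV[R]_n) r, 0 <= r <= d -> (forall i, `|y 0 i - x 0 i| <= r) ->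
      `|f y - f x - \sum_i q i * (y 0 i - x 0 i)| <= e * r.
Proof.
move=> c0 /choice[q qP].
have close k m m' : q m k - c / m.+1%:R <= q m' k + c / m'.+1%:R.
  have [d d0 dP] := qP m; have [d' d'0 d'P] := qP m'.
  pose t := Num.min d d'; have t0 : 0 < t by rewrite lt_min d0.
  have yx j : `|shift_coord x k t 0 j - x 0 j| <= t.
    rewrite mxE; case: (j =P k) => [->|_]; last by rewrite subrr normr0 ltW.
    by rewrite addrAC subrr add0r gtr0_norm.
  have sumE (p : 'I_n -> R) : \sum_i p i * (shift_coord x k t 0 i - x 0 i) = p k * t.
    rewrite (bigD1 k)//= big1 ?addr0; first by rewrite mxE eqxx addrAC subrr add0r.
    by move=> j /negbTE jk; rewrite mxE jk subrr mulr0.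
  have := dP _ t _ yx; have := d'P _ t _ yx; rewrite !sumE ltW// !ge_min !lexx orbT.
  move=> /(_ isT) h' /(_ isT) h; rewrite -(ler_pM2r t0) mulrBl mulrDl.
  move: h h'; rewrite !ler_norml => /andP[h _] /andP[_ h'].
  move: h h'; set u := c / _ * t; set v := c / _ * t; lra.
have [G GP] := choice (fun k => nested_intervals (close k)).
exists G => e e0.
(* One error term comes from the approximation itself and [n] from replacing the slopes [q m] by
   [G]. *)
have n1 : 0 < n.+1%:R * (c + 1) by rewrite mulr_gt0 ?ltr0n// ltr_wpDl.
pose m := Num.bound (n.+1%:R * (c + 1) / e).
have me : n.+1%:R * (c / m.+1%:R) <= e.
  rewrite mulrA ler_pdivrMr ?ltr0n// -ler_pdivrMl//.
  apply: (@le_trans _ _ (n.+1%:R * (c + 1) / e)).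
    by rewrite mulrC ler_pM2r ?invr_gt0// ler_wpM2l// lerDl.
  apply: (le_trans (ltW (archi_boundP _))); first by rewrite divr_ge0 ?ltW.
  by rewrite ler_nat.
have [d d0 dP] := qP m; exists d => // y r rd yx; have /andP[r0 _] := rd.
rewrite [X in `|X|](_ : _ = (f y - f x - \sum_i q m i * (y 0 i - x 0 i)) +
    \sum_i (q m i - G i) * (y 0 i - x 0 i)); last first.
  by under [X in _ = _ + X]eq_bigr do rewrite mulrBl; rewrite sumrB; ring.
apply: le_trans (ler_normD _ _) _.
apply: (@le_trans _ _ (c / m.+1%:R * r + \sum_(i < n) c / m.+1%:R * r)).
  rewrite lerD ?dP//; apply: le_trans (ler_norm_sum _ _ _) _.
  apply: ler_sum => i _; rewrite normrM ler_pM// distrC ler_norml.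
  have /andP[? ?] := GP i m; apply/andP; split; first by rewrite lerBrDr addrC.
  by rewrite lerBlDr addrC.
rewrite sumr_const card_ord -mulrS -[leLHS]mulr_natl mulrA ler_wpM2r//.
Qed.

Theorem rademacher n m (g : 'I_m -> 'rV[R]_n -> R) L :
  (forall i, sup_holder 1 (L i) (g i)) ->
  row_negligible [set x | ~ exists G : 'M[R]_(m, n), differential_at g G x].
Proof.
move=> hg.
have /choice[c cP] : forall i, exists c, 0 <= c /\
    row_negligible [set x | ~ approx_differentiable (g i) c x].
  by move=> i; have [c] := rademacher_approx (hg i); exists c.
have c0 i : 0 <= c i by have [] := cP i.
have {}cP i : row_negligible [set x | ~ approx_differentiable (g i) (c i) x].
  by have [] := cP i.
apply: row_negligibleS (row_negligible_bigcup cP) => x /= nx.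
apply: contrapT => H; apply: nx.
have okx i := differentiable_from_approx (c0 i) (contrapT (fun Hi => H (ex_intro2 _ _ i I Hi))).
have [q qP] := choice okx; exists (\matrix_(i, k) q i k) => e e0.
have dP0 i : {d : R | 0 < d /\ forall (y : 'rV[R]_n) s, 0 <= s <= d ->
    (forall k, `|y 0 k - x 0 k| <= s) ->
    `|g i y - g i x - \sum_k q i k * (y 0 k - x 0 k)| <= e * s}.
  by apply: cid; have [d] := qP i e e0; exists d.
pose d i := sval (dP0 i).
have d0 i : 0 < d i by rewrite /d; case: (dP0 i) => ? [].
pose dl := (1 + \sum_i (d i)^-1)^-1.
have s0 : 0 < 1 + \sum_i (d i)^-1.
  by rewrite ltr_wpDr// sumr_ge0// => i _; rewrite invr_ge0 ltW.
exists dl; first by rewrite invr_gt0.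
move=> y s /andP[sge0 sd] yx i.
under eq_bigr do rewrite mxE.
have [_] := svalP (dP0 i); apply => //; rewrite sge0 (le_trans sd)//.
rewrite -[leRHS]invrK /dl lef_pV2 ?posrE ?invr_gt0 ?d0//.
rewrite (bigD1 i)//= addrCA lerDl addr_ge0// sumr_ge0// => j _.
by rewrite invr_ge0 ltW.
Qed.

End rademacher.

(** * The Lipschitz formula *)

Section jacobian_matrix.
Context {R : realType}.

Lemma row_norm_ge n (x : 'rV[R]_n) i : `|x 0 i| <= `|x|.
Proof.
rewrite [leRHS]/Num.norm/= mx_normrE.
exact: (le_bigmax _ (fun ij : 'I_1 * 'I_n => `|x ij.1 ij.2|) (0, i)).
Qed.

Lemma row_norm_le n (x : 'rV[R]_n) c : 0 <= c -> (forall i, `|x 0 i| <= c) -> `|x| <= c.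
Proof.
move=> c0 xc; rewrite [leLHS]/Num.norm/= mx_normrE; apply/bigmax_leP; split => // -[i j] _ /=.
by rewrite (ord1 i).
Qed.

Lemma mulmxr_continuous n m (M : 'M[R]_(n, m)) : continuous (mulmxr M : 'rV[R]_n -> 'rV[R]_m).
Proof.
move=> x P; rewrite nbhs_simpl => /row_nbhsP[e e0 eP]; apply/row_nbhsP.
pose L := \sum_i \sum_k `|M^T i k|.
have L0 : 0 <= L by rewrite sumr_ge0// => i _; rewrite sumr_ge0.
have L10 : 0 < L + 1 by rewrite ltr_wpDl.
exists (e / (L + 1)); first by rewrite divr_gt0.
move=> y xy; apply: eP => i.
have E (z : 'rV[R]_n) : (z *m M) 0 i = affine M^T (fun=> 0) i z.
  by rewrite mxE /affine addr0; apply: eq_bigr => k _; rewrite mxE mulrC.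
rewrite /= !E; apply: le_lt_trans (affine_holder _ _ _ (r := e / (L + 1)) _ _) _.
- by rewrite divr_ge0 ?ltW.
- by move=> k; exact/ltW.
rewrite powRr1 ?divr_ge0 ?ltW// mulrCA gtr_pMr// ltr_pdivrMr// mul1r.
apply: (@le_lt_trans _ _ L); last by rewrite ltrDl ltr01.
by rewrite /L [leRHS](bigD1 i)//= lerDl sumr_ge0// => j _; rewrite sumr_ge0.
Qed.

Lemma differential_at_jacobian n m (g : 'I_m -> 'rV[R]_n -> R) (G : 'M[R]_(m, n)) x :
  differential_at g G x -> ('J (fun y : 'rV[R]_n => \row_i g i y) x)^T = G.
Proof.
move=> dg; apply: (canLR (@trmxK _ _ _)).
have dE : 'd (fun y : 'rV[R]_n => \row_i g i y) x = mulmxr G^T :> (_ -> _).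
  apply: diff_unique; first exact: mulmxr_continuous.
  apply/eqaddoP => e e0; have [d d0 dP] := dg e e0.
  suff : nbhs (0 : 'rV[R]_n) [set h | `|(((fun y : 'rV[R]_n => \row_i g i y) \o shift x) -
     (cst (\row_i g i x) + (mulmxr G^T : 'rV[R]_n -> 'rV[R]_m))) h| <= e * `|h|] by [].
  apply/row_nbhsP; exists d => // h h0; rewrite /= !fctE /=.
  apply: row_norm_le; first by rewrite mulr_ge0 ?(ltW e0).
  move=> i; rewrite !mxE opprD addrA.
  rewrite (eq_bigr (fun k => G i k * ((h + x) 0 k - x 0 k))); last first.
    by move=> k _; rewrite !mxE addrK mulrC.
  apply: dP; last by move=> k; rewrite !mxE addrK; exact: row_norm_ge.
  rewrite normr_ge0/=; apply: row_norm_le; first exact: ltW.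
  by move=> k; have := h0 k; rewrite mxE sub0r normrN => /ltW.
apply/row_matrixP => i; rewrite !rowE /jacobian mul_rV_lin1 dE/=.
by [].
Qed.

Lemma differentiable_differential_at n m (g : 'I_m -> 'rV[R]_n -> R) x :
  (forall i, differentiable (g i) x) ->
  differential_at g (\matrix_(i, k) 'd (g i) x (delta_mx 0 k)) x.
Proof.
move=> dg e e0.
have H i : exists2 d : R, 0 < d & forall y : 'rV[R]_n, (forall k, `|x 0 k - y 0 k| < d) ->
    `|g i y - g i x - 'd (g i) x (y - x)| <= e * `|y - x|.
  have /diff_locallyP[_ /eqaddoP/(_ _ e0)] := dg i.
  move=> h; have /row_nbhsP[d d0 dP] : nbhs (0 : 'rV[R]_n)
    [set h | `|(g i \o shift x - (cst (g i x) + 'd (g i) x)) h| <= e * `|h|] by exact: h.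
  exists d => // y xy; have := dP (y - x); rewrite /= !fctE /= subrK opprD addrA.
  by apply => k; rewrite !mxE sub0r opprB; exact: xy.
have {}H i : {d : R | 0 < d /\ forall y : 'rV[R]_n, (forall k, `|x 0 k - y 0 k| < d) ->
    `|g i y - g i x - 'd (g i) x (y - x)| <= e * `|y - x|}.
  by apply: cid; have [d] := H i; exists d.
pose d i := sval (H i).
have d0 i : 0 < d i by rewrite /d; case: (H i) => ? [].
have s0 : 0 < 2 + \sum_i (d i)^-1.
  by rewrite ltr_wpDr// sumr_ge0// => i _; rewrite invr_ge0 ltW.
exists (2 + \sum_i (d i)^-1)^-1; first by rewrite invr_gt0.
move=> y s /andP[sge0 sd] yx i.
have -> : \sum_k (\matrix_(i, k) 'd (g i) x (delta_mx 0 k)) i k * (y 0 k - x 0 k) =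
    'd (g i) x (y - x).
  rewrite [in RHS](row_sum_delta (y - x)) linear_sum; apply: eq_bigr => k _.
  by rewrite linearZ !mxE mulrC.
have [_ dP] := svalP (H i).
apply: le_trans (dP y _) _ => [k|].
  rewrite distrC; apply: le_lt_trans (yx k) _; apply: le_lt_trans sd _.
  rewrite -[ltRHS]invrK ltf_pV2 ?posrE ?invr_gt0 ?d0// -/(d i).
  rewrite (bigD1 i)//= addrCA ltrDl ltr_pwDl// sumr_ge0// => j _.
  by rewrite invr_ge0 ltW.
rewrite ler_wpM2l ?(ltW e0)//; apply: row_norm_le => // k.
by rewrite !mxE; exact: yx.
Qed.

End jacobian_matrix.

Section almost_everywhere_equality.
Local Open Scope ereal_scope.
Import HBNNSimple.
Context d (T : measurableType d) (R : realType) (mu : {measure set T -> \bar R}).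

(** Works for arbitrary nonnegative functions: the integral is a supremum over simple functions
    below, and setting such a function to zero on [N] keeps its integral while placing it below
    [g]. *)
Lemma ge0_integral_le_off_null (N : set T) (f g : T -> \bar R) :
  measurable N -> mu N = 0 -> (forall x, 0 <= f x) -> (forall x, 0 <= g x) ->
  (forall x, ~ N x -> f x <= g x) -> \int[mu]_x f x <= \int[mu]_x g x.
Proof.
move=> mN N0 f0 g0 fg; rewrite !ge0_integralTE//.
apply: ge_ereal_sup => _ [h hf <-].
have mNC : measurable (~` N) by exact: measurableC.
have projE x : proj_nnsfun h mNC x = (h \_ (~` N)) x by rewrite (mrestrict h mNC).
apply: (@le_trans _ _ (sintegral mu (proj_nnsfun h mNC))); last first.
  apply: ereal_sup_ubound; exists (proj_nnsfun h mNC) => // x.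
  rewrite projE patchE; case: ifPn => [/set_mem Nx|_]; last exact: g0.
  exact: le_trans (hf x) (fg x Nx).
rewrite -!integralT_nnsfun le_eqVlt; apply/orP; left; apply/eqP.
apply: ae_eq_integral => //.
- exact/measurable_EFinP.
- exact/measurable_EFinP.
exists N; split => // x nP; apply: contrapT => Nx; apply: nP => _.
apply: (congr1 EFin); apply: esym; apply: etrans (projE x) _.
by rewrite patchE mem_set.
Qed.

Lemma integral_eq_off_null (D N : set T) (f g : T -> \bar R) :
  measurable N -> mu N = 0 -> (forall x, D x -> ~ N x -> f x = g x) ->
  \int[mu]_(x in D) f x = \int[mu]_(x in D) g x.
Proof.
move=> mN N0 fg; rewrite 2![LHS]integral_mkcond 2![RHS]integral_mkcond integralE [RHS]integralE.
have E x : ~ N x -> (f \_ D) x = (g \_ D) x.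
  by move=> Nx; rewrite !patchE; case: ifPn => // /set_mem Dx; exact: fg.
rewrite !patch_setT.
by congr (_ - _); apply/eqP; rewrite eq_le; apply/andP; split;
  apply: (ge0_integral_le_off_null mN N0) => // x Nx; rewrite ?funeposE ?funenegE E.
Qed.

End almost_everywhere_equality.

Section lipschitz_case.
Context {R : realType}.
Notation RT := (measurableTypeR R).
Notation lebn := (@lebesgue_measure_n R).
Implicit Types n : nat.

Lemma lipschitz_admissible n (a : R) : 0 < a <= 1 ->
  admissible_exponents a (fun _ : 'I_n => 1).
Proof.
move=> a01; split=> [//|_|]; first by rewrite ltr01 lexx.
by rewrite sumr_const card_ord ltrDr; case/andP: a01.
Qed.

(** Boundary integrals are rewritten as integrals of the constant 1, a form that makes sense in
    dimension 0 too and to which [integral_density] applies. *)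
Lemma dyadic_sum_cvg n a (b : 'I_n -> R) A f g Cf Cg :
  admissible_exponents a b -> proper_box A ->
  sup_holder a Cf f -> (forall i, sup_holder (b i) (Cg i) (g i)) ->
  \sum_(B <- dyadic k A) f B.1 * integral_fdg B (fun=> 1) g @[k --> \oo] -->
    integral_fdg A f g.
Proof.
case: n b A f g Cg => [|n] b A f g Cg ab pA hf hg.
  rewrite [X in X k @[k --> _]](_ : _ = fun=> f A.1).
    by rewrite integral_fdg0; exact: cvg_cst.
  apply/funext => k; rewrite (eq_bigr (fun=> f A.1)) => [|B _].
    by rewrite sum_dyadic_cst expr0 expr1n mul1r.
  by rewrite integral_fdg0 mulr1 (rowR0_eq B.1 A.1).
have := riemann_sum_cvg (@integral_existsP R n.+1) ab pA hf hg (corner_tagging pA).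
set S := (fun k => riemann_sum _ _ _ _ _) => Scvg.
suff -> : (fun k => \sum_(B <- dyadic k A) f B.1 * integral_fdg B (fun=> 1) g) = S by [].
apply/funext => k; apply: eq_big_seq => B BA.
congr (_ * _); rewrite (integral_fdg_cst 1 (@integral_existsP R n)
  (admissible_face_exponents ab) (dyadic_proper pA BA) hg).
by rewrite mul1r.
Qed.

Definition tuple_box n (A : @box R n) : set (n.-tuple RT) :=
  @row_of_tuple R n @^-1` box_set A.

Lemma measurable_tuple_box n (A : @box R n) : measurable (tuple_box A).
Proof. exact: box_row_measurable. Qed.

Lemma tuple_box_measure n (A : @box R n) : proper_box A ->
  lebn n (tuple_box A) = (volume A)%:E.
Proof. exact: lebesgue_measure_box. Qed.

Lemma integral_box_simple n (A : @box R n) (s : seq (box n)) (c : box n -> R) :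
  proper_box A ->
  (forall B, B \in s -> proper_box B /\ box_set B `<=` box_set A) ->
  let phi t := (\sum_(B <- s) c B * \1_(tuple_box B) t)%:E in
  (lebn n).-integrable (tuple_box A) phi /\
  (\int[lebn n]_(t in tuple_box A) phi t)%E = (\sum_(B <- s) c B * volume B)%:E.
Proof.
move=> pA; have mD := measurable_tuple_box A.
elim: s => [|B s IH] sA /=.
  rewrite (_ : (fun t => _) = cst 0%E); last by apply/funext => t; rewrite big_nil.
  by rewrite big_nil integral0; split => //; exact: integrable0.
have [pB BA] := sA B (mem_head _ _).
have [|int1 int2] := IH; first by move=> B' B's; apply: sA; rewrite inE B's orbT.
have mB := measurable_tuple_box B.
have iB : (lebn n).-integrable (tuple_box A) (fun t => (c B)%:E * (\1_(tuple_box B) t)%:E)%E.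
  apply: integrableZl => //; apply/integrableP; split.
    exact/measurable_EFinP/measurable_indic.
  under eq_integral do rewrite gee0_abs ?lee_fin//.
  rewrite integral_indic//= setIidl; last exact: preimage_subset.
  by rewrite lebesgue_measure_box// ltry.
rewrite (_ : (fun t => _) = (fun t => (c B)%:E * (\1_(tuple_box B) t)%:E +
    (\sum_(B' <- s) c B' * \1_(tuple_box B') t)%:E)%E); last first.
  by apply/funext => t; rewrite big_cons EFinD EFinM.
split; first exact: integrableD.
rewrite integralD// int2 integralZl//; last first.
  apply/integrableP; split; first exact/measurable_EFinP/measurable_indic.
  under eq_integral do rewrite gee0_abs ?lee_fin//.
  rewrite integral_indic//= setIidl; last exact: preimage_subset.
  by rewrite lebesgue_measure_box// ltry.
rewrite integral_indic// setIidl; last exact: preimage_subset.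
rewrite big_cons EFinD EFinM; congr (_ * _ + _)%E.
exact: lebesgue_measure_box.
Qed.

(** Such a point of [A] avoids every dividing hyperplane and therefore lies in exactly one dyadic
    box of each level. *)
Definition generic n (A : @box R n) (x : 'rV[R]_n) :=
  forall k B i, B \in dyadic k A -> x 0 i != midpoint B 0 i.

Lemma generic_ae n (A : @box R n) : row_negligible [set x | ~ generic A x].
Proof.
apply: (@row_negligibleS _ _ _ (\bigcup_(p : nat * nat * 'I_n)
  [set x : 'rV[R]_n | x 0 p.2 = midpoint (nth A (dyadic p.1.1 A) p.1.2) 0 p.2])).
  move=> x /= nx; apply: contrapT => H; apply: nx => k B i BA; apply/eqP => xi.
  by apply: H; exists (k, index B (dyadic k A), i) => //=; rewrite nth_index.
by apply: row_negligible_bigcup => p; exact: hyperplane_negligible.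
Qed.

Lemma dyadic_locate n (A : @box R n) x k : proper_box A -> box_set A x -> generic A x ->
  exists2 B, B \in dyadic k A & box_set B x /\
    forall F : box n -> R, \sum_(B' <- dyadic k A) F B' * \1_(box_set B') x = F B.
Proof.
move=> pA xA gx; elim: k => [|k [B BA [xB HB]]].
  exists A; first by rewrite inE.
  by split=> // F; rewrite /dyadic/= big_seq1 indicE mem_set// mulr1.
have pB := dyadic_proper pA BA.
pose s := [ffun i => midpoint B 0 i < x 0 i].
have xs : box_set (half_box B s) x.
  move=> i; rewrite half_box1 half_box2 ffunE; have /andP[? ?] := xB i.
  by case: ltP => [/ltW ->|->]; rewrite ?andbT.
exists (half_box B s).
  rewrite /dyadic iterS; apply/flatten_mapP; exists B => //.
  by apply/mapP; exists s => //; rewrite mem_enum.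
split => // F; rewrite big_dyadicS.
transitivity (\sum_(B' <- dyadic k A) (\sum_s' F (half_box B' s') *
    \1_(box_set (half_box B' s')) x) * \1_(box_set B') x).
  apply: eq_big_seq => B' B'A; rewrite mulr_suml; apply: eq_bigr => s' _.
  rewrite !indicE; have [/set_mem xs'|_] := boolP (x \in box_set (half_box B' s')).
    by rewrite mem_set ?mulr1//; exact: half_box_sub (dyadic_proper pA B'A) _ xs'.
  by rewrite mulr0 mul0r.
rewrite (HB (fun B' => \sum_s' F (half_box B' s') * \1_(box_set (half_box B' s')) x)).
rewrite (bigD1 s)//= indicE mem_set// mulr1 big1 ?addr0// => s' s's.
rewrite indicE memNset ?mulr0// => xs'; move/eqP: s's; apply.
apply/ffunP => i; rewrite ffunE; have := xs' i; rewrite half_box1 half_box2.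
have := gx k B i BA; case: (s' i) => xm /andP[h1 h2].
  by rewrite lt_neqAle eq_sym xm.
by apply/esym/negbTE; rewrite -leNgt.
Qed.

Lemma box_interior n (A : @box R n) (x : 'rV[R]_n) : (forall i, A.1 0 i < x 0 i < A.2 0 i) ->
  ((box_set A)° : set _) x.
Proof.
move=> xA; apply/row_nbhsP.
pose e i := Num.min (x 0 i - A.1 0 i) (A.2 0 i - x 0 i).
have e0 i : 0 < e i by have /andP[? ?] := xA i; rewrite lt_min !subr_gt0; apply/andP.
have s0 : 0 < 1 + \sum_i (e i)^-1.
  by rewrite ltr_wpDr// sumr_ge0// => i _; rewrite invr_ge0 ltW.
exists (1 + \sum_i (e i)^-1)^-1; first by rewrite invr_gt0.
move=> y xy i.
have : `|x 0 i - y 0 i| < e i.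
  apply: lt_le_trans (xy i) _; rewrite -[leRHS]invrK lef_pV2 ?posrE ?invr_gt0//.
  rewrite (bigD1 i)//= addrCA lerDl addr_ge0// sumr_ge0// => j _.
  by rewrite invr_ge0 ltW.
rewrite lt_min !ltr_norml => /andP[/andP[? ?] /andP[? ?]].
by apply/andP; split; lra.
Qed.

Lemma box_boundary_negligible n (A : @box R n) :
  row_negligible (box_set A `\` ((box_set A)° : set _)).
Proof.
apply: (@row_negligibleS _ _ _ (\bigcup_(p : 'I_n * bool)
  [set x : 'rV[R]_n | x 0 p.1 = side A p.2 0 p.1])).
  move=> x [xA nx]; apply: contrapT => H; apply: nx; apply: box_interior => i.
  have /andP[h1 h2] := xA i; rewrite !lt_neqAle h1 h2 !andbT; apply/andP; split.
    by apply/eqP => e; apply: H; exists (i, false).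
  by apply/eqP => e; apply: H; exists (i, true).
by apply: row_negligible_bigcup => p; exact: hyperplane_negligible.
Qed.

Lemma differential_at_interior n m (g g0 : 'I_m -> 'rV[R]_n -> R) (G : 'M[R]_(m, n))
    (X : set 'rV[R]_n) x :
  (X° : set _) x -> (forall i, {in X, g0 i =1 g i}) -> differential_at g G x ->
  differential_at g0 G x.
Proof.
move=> /row_nbhsP[e e0 eX] gg dg c c0; have [d d0 dP] := dg c c0.
exists (Num.min d (e / 2)); first by rewrite lt_min d0 divr_gt0.
move=> y s /andP[s0]; rewrite le_min => /andP[sd se] yx i.
have Xy : X y.
  apply: eX => k; rewrite distrC; apply: le_lt_trans (yx k) _; apply: le_lt_trans se _.
  by rewrite ltr_pdivrMr// ltr_pMr// ltr1n.
have Xx : X x by apply: eX => k; rewrite subrr normr0.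
by rewrite !gg ?mem_set//; apply: dP => //; rewrite s0.
Qed.

(** [f0] and [g0] are the given functions, [f] and [g] their extensions by clamping; almost every
    point is interior to the box, where the differentials agree. *)
Theorem lipschitz_integral n (A : @box R n) a f g f0 g0 Cf L : proper_box A ->
  0 < a <= 1 -> sup_holder a Cf f -> (forall i, sup_holder 1 (L i) (g i)) ->
  {in box_set A, f0 =1 f} -> (forall i, {in box_set A, g0 i =1 g i}) ->
  (integral_fdg A f0 g0)%:E = lebesgue_integral_on (box_set A)
    (fun x => f0 x * \det (deriv_on (box_set A) g0 x)).
Proof.
move=> pA a01 hf hL f0f g0g; rewrite (eq_integral_fdg pA f0f g0g); pose M := \sum_i L i.
have hg i : sup_holder 1 M (g i).
  apply: sup_holderW (hL i); rewrite /M (bigD1 i)//= lerDl sumr_ge0// => j _.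
  exact: sup_holder_ge0 (hL j).
have ab := lipschitz_admissible n a01.
have [r r0 sA] := proper_small_box pA; have vA0 := volume_gt0 pA.
have mD := measurable_tuple_box A.
(* The Riemann sum of level [k] becomes the integral of a function [phi k] that takes the value
   [q B] at almost all points of each dyadic box [B]. *)
pose q B := f B.1 * integral_fdg B (fun=> 1) g / volume B.
pose phi k t := (\sum_(B <- dyadic k A) q B * \1_(tuple_box B) t)%:E.
have simple k := @integral_box_simple n A (dyadic k A) q pA
  (fun B BA => conj (dyadic_proper pA BA) (dyadic_sub pA BA)).
have phiE k : (\int[lebn n]_(t in tuple_box A) phi k t)%E =
    (\sum_(B <- dyadic k A) f B.1 * integral_fdg B (fun=> 1) g)%:E.
  rewrite (simple k).2; congr EFin; apply: eq_big_seq => B BA.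
  by rewrite /q mulfVK//; exact/lt0r_neq0/volume_gt0/(dyadic_proper pA BA).
have [K K0 bK] := @integral_existsP R n _ _ (lipschitz_exponents n).
(* The bound for the integral over [B] and the volume of [B] scale alike, which yields a constant
   dominating all levels. *)
pose c0 := (`|f A.1| + Cf * r `^ a) * (K * (M * r) ^+ n / volume A).
have q_le k B : B \in dyadic k A -> `|q B| <= c0.
  move=> BA; have pB := dyadic_proper pA BA; have sB := dyadic_small sA BA.
  have rk0 : 0 <= r / 2 ^+ k by rewrite divr_ge0 ?(ltW r0)// exprn_ge0.
  rewrite /q -mulrA normrM ler_pM//.
    rewrite -[f B.1](subrK (f A.1)) addrC; apply: le_trans (ler_normD _ _) _.
    rewrite lerD2l; apply: sup_holder_box hf (ltW r0) sA _ (corner_in pA).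
    exact: dyadic_sub pA BA _ (corner_in pB).
  rewrite normrM normfV (gtr0_norm (volume_gt0 pB)) ler_pdivrMr ?volume_gt0//.
  have [_] := bK B _ (fun=> 1) g 0 (fun=> M) rk0 sB (sup_holder_cst 1 1) hg.
  move=> /(_ _ (corner_in pB))/le_trans; apply.
  rewrite normr1 mul0r addr0 mulr1 prodr_const card_ord powRr1//.
  rewrite (dyadic_volume BA) le_eqVlt; apply/orP; left; apply/eqP.
  rewrite -exprM mulnC exprM mulrA expr_div_n; field.
  by rewrite !expf_neq0// gt_eqF.
have bad0 : row_negligible ([set x | ~ generic A x] `|`
    [set x | ~ exists G : 'M[R]_n, differential_at g G x] `|`
    (box_set A `\` ((box_set A)° : set _))).
  apply: row_negligibleU; last exact: box_boundary_negligible.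
  by apply: row_negligibleU; [exact: generic_ae|exact: rademacher hg].
have [N [mN N0 badN]] := bad0.
have good t : tuple_box A t -> ~ N t -> [/\ generic A (row_of_tuple t),
    exists G : 'M[R]_n, differential_at g G (row_of_tuple t) &
    ((box_set A)° : set _) (row_of_tuple t)].
  move=> At Nt; have /not_orP[/not_orP[/contrapT g1 /contrapT g2] g3] :
    ~ ([set x | ~ generic A x] `|` [set x | ~ exists G : 'M[R]_n, differential_at g G x] `|`
    (box_set A `\` ((box_set A)° : set _))) (row_of_tuple t) by move=> /badN.
  by split => //; apply: contrapT => g4; apply: g3; split.
have phi_at k t : tuple_box A t -> ~ N t -> exists2 B, B \in dyadic k A &
    box_set B (row_of_tuple t) /\ phi k t = (q B)%:E.
  move=> At Nt; have [gt _ _] := good t At Nt.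
  have [B BA [tB HB]] := dyadic_locate k pA At gt.
  by exists B => //; split => //; rewrite /phi -HB.
pose F x := f0 x * \det (deriv_on (box_set A) g0 x).
have phi_cvg t : tuple_box A t -> ~ N t -> phi k t @[k --> \oo] --> (F (row_of_tuple t))%:E.
  move=> At Nt; have [gt [G dG] it] := good t At Nt; set x := row_of_tuple t in gt dG it *.
  have FE : F x = f x * \det G.
    rewrite /F /deriv_on mem_set// f0f ?mem_set//; congr (_ * \det _).
    exact/differential_at_jacobian/(differential_at_interior it g0g dG).
  suff H : fine (phi k t) @[k --> \oo] --> F x.
    by apply/fine_cvgP; split => //; exact: nearW.
  rewrite FE; apply/cvgrPdist_le => e e0.
  have f10 : 0 < `|\det G| + `|f x| + 2 by rewrite ltr_wpDl// addr_ge0.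
  (* Both the integrand and the density are approximated up to [e1]; [e1 <= 1] makes their quadratic
     error term linear. *)
  pose e1 := Num.min 1 (e / (`|\det G| + `|f x| + 2)).
  have e10 : 0 < e1 by rewrite lt_min ltr01 divr_gt0.
  have dens := integral_density pA hg dG e10.
  have fB : \forall k \near \oo, Cf * (r / 2 ^+ k) `^ a <= e1.
    have : Cf * r `^ a * (2^-1 `^ a) ^+ k @[k --> \oo] --> (0 : R).
      rewrite -[X in _ --> X](mulr0 (Cf * r `^ a)); apply: cvgM; first exact: cvg_cst.
      apply: cvg_expr; rewrite ger0_norm ?powR_ge0//.
      case/andP: a01 => a0 _; rewrite /powR invr_eq0 pnatr_eq0/= -[ltRHS]expR0 ltr_expR.
      by rewrite pmulr_rlt0// lnV ?posrE// oppr_lt0 ln_gt0// ltr1n.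
    move=> /cvgrPdist_le/(_ _ e10); apply: filterS => k.
    rewrite sub0r normrN => /(le_trans (ler_norm _)).
    by rewrite powR_dyadic ?(ltW r0)// mulrA.
  have [k0 _ H] := filterI dens fB; exists k0 => // k /H[densk fBk].
  have [B BA [xB ->]] := phi_at k t At Nt; rewrite /= /q.
  have pB := dyadic_proper pA BA; have vB0 := volume_gt0 pB.
  have h1 : `|integral_fdg B (fun=> 1) g - \det G * volume B| <= e1 * volume B.
    exact: densk.
  have h2 : `|f B.1 - f x| <= e1.
    apply: le_trans fBk.
    apply: sup_holder_box hf _ (dyadic_small sA BA) (corner_in pB) xB.
    by rewrite divr_ge0 ?(ltW r0)// exprn_ge0.
  have h3 : `|integral_fdg B (fun=> 1) g / volume B - \det G| <= e1.
    rewrite -(ler_pM2r vB0) -[X in _ * X <= _](gtr0_norm vB0) -normrM mulrBl mulfVK//.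
    by rewrite gt_eqF.
  rewrite -mulrA distrC; set D := _ / volume B in h3 *.
  rewrite [X in `|X|](_ : _ = (f B.1 - f x) * (D - \det G) + (f B.1 - f x) * \det G
     + f x * (D - \det G)); last by ring.
  apply: le_trans (ler_normD _ _) _; apply: le_trans (lerD (ler_normD _ _) (lexx _)) _.
  rewrite !normrM.
  apply: (@le_trans _ _ (e1 * 1 + e1 * `|\det G| + `|f x| * e1)).
    rewrite lerD ?ler_wpM2l// lerD ?ler_wpM2r// ler_pM//.
    by apply: le_trans h3 _; rewrite ge_min lexx.
  rewrite (mulrC `|f x|) -!mulrDr.
  apply: (@le_trans _ _ (e1 * (`|\det G| + `|f x| + 2))).
    by rewrite ler_wpM2l ?(ltW e10)//; lra.
  by rewrite -ler_pdivlMr// ge_min lexx orbT.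
(* A measurable representative of the limit for dominated convergence; it equals the Jacobian
   integrand off a null set. *)
pose h t := limn_esup (fun k => phi k t).
have mphi k : measurable_fun (tuple_box A) (phi k) := measurable_int _ (simple k).1.
have hE t : tuple_box A t -> ~ N t -> h t = (F (row_of_tuple t))%:E.
  by move=> At Nt; rewrite /h (cvg_limn_einf_sup (phi_cvg t At Nt)).2.
have aeN (P : n.-tuple RT -> Prop) : (forall t, ~ N t -> P t) -> {ae lebn n, forall t, P t}.
  move=> NP; exists N; split => // t /= nP; apply: contrapT => Nt; apply: nP; exact: NP.
have icst : (lebn n).-integrable (tuple_box A) (EFin \o cst c0).
  apply/integrableP; split; first exact/measurable_EFinP/measurable_cst.
  rewrite (eq_integral (cst `|c0|%:E))// integral_cst//.
  rewrite [X in (_ * X < _)%E](tuple_box_measure pA).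
  by rewrite -EFinM ltry.
have ae1 : {ae lebn n, forall t, tuple_box A t -> phi k t @[k --> \oo] --> h t}.
  by apply: aeN => t Nt At; rewrite hE//; exact: phi_cvg.
have ae2 : {ae lebn n, forall t k, tuple_box A t -> (`|phi k t| <= (EFin \o cst c0) t)%E}.
  apply: aeN => t Nt k At; have [B BA [_ ->]] := phi_at k t At Nt.
  by rewrite /= lee_fin; exact: q_le BA.
have [_ _ dom] := dominated_convergence mD mphi (measurable_fun_limn_esup mphi) ae1 icst ae2.
have sums := dyadic_sum_cvg ab pA hf hg.
have : (\int[lebn n]_(t in tuple_box A) phi k t)%E @[k --> \oo] --> (integral_fdg A f g)%:E.
  under eq_fun do rewrite phiE.
  by apply/fine_cvgP; split; [exact: nearW|exact: sums].
move=> /(cvg_unique _ dom); move=> /(_ (@ereal_hausdorff R)) <-.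
rewrite /lebesgue_integral_on.
exact: (integral_eq_off_null mN N0 hE).
Qed.

End lipschitz_case.

(** * Functions on the box *)

Section euclidean_holder.
Context {R : realType}.
Implicit Types n : nat.

Lemma euclidean_dist_le n (x y : 'rV[R]_n) (r : R) :
  0 <= r -> (forall i, `|x 0 i - y 0 i| <= r) -> euclidean_dist x y <= n.+1%:R * r.
Proof.
move=> r0 xy; have nr : 0 <= n.+1%:R * r by rewrite mulr_ge0.
rewrite -[leRHS]ger0_norm// -sqrtr_sqr ler_sqrt ?sqr_ge0//.
apply: (@le_trans _ _ (\sum_(i < n) r ^+ 2)).
  apply: ler_sum => i _; rewrite -real_normK ?num_real//.
  by rewrite lerXn2r ?nnegrE.
rewrite sumr_const card_ord -[_ *+ n]mulr_natl exprMn ler_wpM2r ?sqr_ge0// -natrX ler_nat.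
by rewrite (leq_trans (leqnSn n))// leq_pmulr.
Qed.

Lemma coord_le_euclidean_dist n (x y : 'rV[R]_n) i :
  `|x 0 i - y 0 i| <= euclidean_dist x y.
Proof.
rewrite -sqrtr_sqr ler_sqrt ?sumr_ge0// => [|j _]; last exact: sqr_ge0.
by rewrite (bigD1 i)//= lerDl sumr_ge0// => j _; rewrite sqr_ge0.
Qed.

Lemma holder_bounds_sup_holder n (A : @box R n) (a C : R) f :
  proper_box A -> 0 < a -> holder_bounds (box_set A) a f C ->
  sup_holder a (C * n.+1%:R `^ a) (f \o clamp A).
Proof.
move=> pA a0 [C0 hC] x y r r0 xy.
apply: le_trans (hC _ _ (clamp_in x pA) (clamp_in y pA)) _.
rewrite -mulrA ler_wpM2l// -powRM//; apply: ge0_ler_powR.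
- exact: ltW.
- by rewrite nnegrE sqrtr_ge0.
- by rewrite nnegrE mulr_ge0.
- by apply: euclidean_dist_le => // i; apply: le_trans (clamp_dist _ _ _ _) _.
Qed.

Lemma sup_holder_holder_bounds n (X : set 'rV[R]_n) (a C : R) f :
  sup_holder a C f -> holder_bounds X a f C.
Proof.
move=> hf; split; first exact: sup_holder_ge0 hf.
move=> x y _ _; apply: hf; first exact: sqrtr_ge0.
by move=> i; exact: coord_le_euclidean_dist.
Qed.

Lemma holder_clamp n (A : @box R n) (a : R) f :
  proper_box A -> 0 < a -> holder (box_set A) a f ->
  {C : R | sup_holder a C (f \o clamp A)}.
Proof.
move=> pA a0 hf; apply: cid; case: hf => C /(holder_bounds_sup_holder pA a0) hC.
by exists (C * n.+1%:R `^ a).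
Qed.

Lemma holder_const_le n (X : set 'rV[R]_n) (a C : R) f :
  sup_holder a C f -> holder_const X a f <= C.
Proof.
move=> hf; apply: ge_inf; last exact: sup_holder_holder_bounds.
by exists 0 => c [].
Qed.

Lemma holder_const_clamp n (A : @box R n) (a M : R) f :
  proper_box A -> 0 < a -> holder (box_set A) a f ->
  holder_const (box_set A) a f <= M ->
  sup_holder a ((M + 1) * n.+1%:R `^ a) (f \o clamp A).
Proof.
move=> pA a0 hf fM.
(* The Hoelder constant is an infimum, so an actual bound is taken strictly above it. *)
have [C Cf CM] : exists2 C, holder_bounds (box_set A) a f C & C < M + 1.
  by apply: inf_lt => //; apply: le_lt_trans fM _; rewrite ltrDl ltr01.
apply: sup_holderW (holder_bounds_sup_holder pA a0 Cf).
by rewrite ler_wpM2r ?powR_ge0// ltW.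
Qed.

Lemma clamp_eq n (A : @box R n) (f : 'rV[R]_n -> R) :
  {in box_set A, f =1 f \o clamp A}.
Proof. by move=> x /set_mem xA /=; rewrite clamp_id. Qed.

Lemma integral_clamp n (A : @box R n) f g : proper_box A ->
  integral_fdg A f g = integral_fdg A (f \o clamp A) (fun i => g i \o clamp A).
Proof. by move=> pA; apply: eq_integral_fdg => // *; exact: clamp_eq. Qed.

End euclidean_holder.

Section uniform_convergence.
Context {R : realType} {T : choiceType}.

Lemma uniform_cvg_at (X : set T) (f_ : nat -> T -> R) f x :
  {uniform X, f_ @ \oo --> f} -> X x -> f_ k x @[k --> \oo] --> f x.
Proof.
move=> fu Xx; suff : {uniform [set x], f_ @ \oo --> f} by rewrite uniform_set1.
by apply: uniform_subset_cvg fu => // _ ->.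
Qed.

Lemma cvg_uniform_dist (X : set T) (f_ : nat -> T -> R) f :
  (forall e : R, 0 < e -> \forall k \near \oo, forall x, X x -> `|f x - f_ k x| < e) ->
  {uniform X, f_ @ \oo --> f}.
Proof.
move=> fu P /uniform_nbhs[E [entE EP]].
move: entE; rewrite -entourage_ballE => -[e /= e0 eE].
have [k0 _ H] := fu e e0; exists k0 => // k /H kP; apply: EP => y Xy.
exact/eE/kP.
Qed.

End uniform_convergence.

Section properties_of_the_integral.
Context {R : realType}.
Variables (n : nat) (A : @box R n) (a : R) (b : 'I_n -> R).
Hypotheses (pA : proper_box A) (ab : admissible_exponents a b).

Let a0 : 0 < a. Proof. by case: ab => /andP[]. Qed.
Let b0 i : 0 < b i. Proof. by case: ab => _ /(_ i)/andP[]. Qed.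

Lemma admissible_is_integral f g : admissible A a b f g ->
  is_integral A f g (integral_fdg A f g).
Proof.
move=> [hf hg]; have [Cf hCf] := holder_clamp pA a0 hf.
have hCg i := svalP (holder_clamp pA (b0 i) (hg i)).
rewrite integral_clamp//.
rewrite (eq_is_integral pA (clamp_eq f) (fun i => clamp_eq (g i))).
exact: (exists_is_integral (@integral_existsP R n) ab pA hCf hCg).
Qed.

Lemma integral_multilinear : multilinear A a b (@integral_fdg R n A).
Proof.
split=> [c f f' g [hf hg] [hf' _]|i c h h' f g [hf hg] [_ hg']].
  rewrite integral_clamp// (integral_clamp f)// (integral_clamp f')//.
  have [Cf hCf] := holder_clamp pA a0 hf; have [Cf' hCf'] := holder_clamp pA a0 hf'.
  have hCg i := svalP (holder_clamp pA (b0 i) (hg i)).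
  exact: (integral_linear_integrand c (@integral_existsP R n) ab pA hCf hCf' hCg).
rewrite integral_clamp// (integral_clamp _ (update_at g i h))//.
rewrite (integral_clamp _ (update_at g i h'))//.
have [Cf hCf] := holder_clamp pA a0 hf.
have hCg j := svalP (holder_clamp pA (b0 j) (hg j)).
have hCg' j := svalP (holder_clamp pA (b0 j) (hg' j)).
apply: (integral_linear_differential (i := i) ab pA hCf hCg hCg') => [x|j x ji].
  by rewrite /update_at/= eqxx.
by rewrite /update_at/= (negbTE ji).
Qed.

Lemma integral_lipschitz_formula : lipschitz_formula A a (@integral_fdg R n A).
Proof.
move=> f g hf hg; have [Cf hCf] := holder_clamp pA a0 hf.
have hCg i := svalP (holder_clamp pA ltr01 (hg i)).
have a01 : 0 < a <= 1 by case: ab.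
exact: (lipschitz_integral pA a01 hCf hCg (clamp_eq f) (fun i => clamp_eq (g i))).
Qed.

Lemma integral_holder_continuous : holder_continuous A a b (@integral_fdg R n A).
Proof.
move=> f_ g_ f g fg_ fg ff gg [M fM] gM.
rewrite integral_clamp//; under eq_fun do rewrite integral_clamp//.
have {}gM i : {L : R | forall m, holder_const (box_set A) (b i) (g_ m i) <= L}.
  exact: cid (gM i).
apply: (@integral_continuous _ n a b A _ _ _ _ _ _ ab pA) => [m|m i|x|i x].
- exact: (holder_const_clamp pA a0 (fg_ m).1 (fM m)).
- exact: (holder_const_clamp pA (b0 i) ((fg_ m).2 i) (svalP (gM i) m)).
- by have := uniform_cvg_at ff (clamp_in x pA).
- by have := uniform_cvg_at (gg i) (clamp_in x pA).
Qed.

End properties_of_the_integral.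

(** * Approximation by inf-convolutions *)

Section lipschitz_approximation.
Context {R : realType}.
Variables (n : nat) (g : 'rV[R]_n -> R) (b C K : R).
Hypotheses (b0 : 0 < b) (hg : sup_holder b C g) (gK : forall x y, g x - g y <= K).

(** The radius [s] stands for the supremum distance of [x] and [y], which it may exceed without
    affecting the infimum. *)
Definition inf_conv_values (k : nat) (x : 'rV[R]_n) : set R :=
  [set v | exists (y : 'rV[R]_n) (s : R),
    [/\ 0 <= s, forall i, `|y 0 i - x 0 i| <= s & v = g y + k%:R * s]].

Definition inf_conv (k : nat) (x : 'rV[R]_n) : R := inf (inf_conv_values k x).

Lemma inf_conv_valuesT k x : inf_conv_values k x (g x).
Proof. by exists x, 0; split=> [//|i|]; rewrite ?subrr ?normr0// mulr0 addr0. Qed.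

Lemma inf_conv_values_lbound k x : has_lbound (inf_conv_values k x).
Proof.
exists (g x - K) => _ [y [s [s0 _ ->]]]; have := gK x y.
have : 0 <= k%:R * s by rewrite mulr_ge0.
lra.
Qed.

Lemma inf_conv_le k x : inf_conv k x <= g x.
Proof. exact/ge_inf/inf_conv_valuesT/inf_conv_values_lbound. Qed.

(** Competitors within [d] are controlled by Hoelder continuity; beyond [d] the penalty exceeds the
    total oscillation [K] of [g]. *)
Lemma inf_conv_close k x d : 0 <= d -> K <= k%:R * d -> g x - C * d `^ b <= inf_conv k x.
Proof.
move=> d0 Kd; apply: lb_le_inf; first by exists (g x); exact: inf_conv_valuesT.
move=> _ [y [s [s0 yx ->]]]; have C0 := sup_holder_ge0 hg.
have Cd : 0 <= C * d `^ b by rewrite mulr_ge0 ?powR_ge0.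
have ks : 0 <= k%:R * s by rewrite mulr_ge0.
have [sd|ds] := leP s d.
  have : g x - g y <= C * d `^ b.
    apply: le_trans (ler_norm _) _; rewrite distrC; apply: hg => // i.
    exact: le_trans (yx i) sd.
  lra.
have : k%:R * d <= k%:R * s by rewrite ler_wpM2l// ltW.
have := gK x y; lra.
Qed.

Lemma inf_conv_lipschitz k : sup_holder 1 k%:R (inf_conv k).
Proof.
have one (x x' : 'rV[R]_n) (r : R) : 0 <= r -> (forall i, `|x 0 i - x' 0 i| <= r) ->
    inf_conv k x - k%:R * r <= inf_conv k x'.
  move=> r0 xx'; apply: lb_le_inf; first by exists (g x'); exact: inf_conv_valuesT.
  move=> _ [y [s [s0 yx ->]]]; rewrite lerBlDr -addrA -mulrDr.
  apply: ge_inf; first exact: inf_conv_values_lbound.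
  exists y, (s + r); split=> // [|i]; first exact: addr_ge0.
  apply: le_trans (ler_distD (x' 0 i) _ _) _.
  by rewrite lerD// distrC.
move=> x y r r0 xy; rewrite powRr1// ler_norml.
have := one x y r r0 xy; have := one y x r r0.
have yx i : `|y 0 i - x 0 i| <= r by rewrite distrC.
move=> /(_ yx).
by move=> h1 h2; apply/andP; split; lra.
Qed.

(** Translating a competitor by [x - x'] keeps its penalty and changes the value of [g] by at most
    its Hoelder bound; this uses that [g] lives on the whole space. *)
Lemma inf_conv_holder k : sup_holder b C (inf_conv k).
Proof.
have one (x x' : 'rV[R]_n) (r : R) : 0 <= r -> (forall i, `|x 0 i - x' 0 i| <= r) ->
    inf_conv k x - C * r `^ b <= inf_conv k x'.
  move=> r0 xx'; apply: lb_le_inf; first by exists (g x'); exact: inf_conv_valuesT.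
  move=> _ [y [s [s0 yx ->]]].
  have : inf_conv k x <= g (y + (x - x')) + k%:R * s.
    apply: ge_inf; first exact: inf_conv_values_lbound.
    exists (y + (x - x')), s; split=> // i; rewrite !mxE.
    by rewrite (_ : _ - _ = y 0 i - x' 0 i) //; ring.
  have : g (y + (x - x')) - g y <= C * r `^ b.
    apply: le_trans (ler_norm _) _; apply: hg => // i.
    by rewrite !mxE addrAC subrr add0r.
  lra.
move=> x y r r0 xy; rewrite ler_norml.
have := one x y r r0 xy; have := one y x r r0.
have yx i : `|y 0 i - x 0 i| <= r by rewrite distrC.
move=> /(_ yx).
by move=> h1 h2; apply/andP; split; lra.
Qed.

Lemma inf_conv_cvg (X : set 'rV[R]_n) (f : 'rV[R]_n -> R) :
  {in X, f =1 g} -> {uniform X, inf_conv @ \oo --> f}.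
Proof.
move=> fg; apply: cvg_uniform_dist => e e0.
have C0 := sup_holder_ge0 hg; have C1 : 0 < C + 1 by rewrite ltr_wpDl.
(* Solves [d^b = e / (C + 1)], so that the Hoelder error in [inf_conv_close] stays below [e]. *)
pose d := (e / (C + 1)) `^ b^-1.
have q0 : 0 < e / (C + 1) by rewrite divr_gt0.
have d0 : 0 < d by rewrite powR_gt0.
have Cd : C * d `^ b < e.
  rewrite -powRrM mulVf ?gt_eqF// powRr1 ?ltW// mulrCA gtr_pMr// ltr_pdivrMr//.
  by rewrite mul1r ltrDl ltr01.
have [k0 _ H] := nbhs_infty_ger (K / d); exists k0 => // k /H Kk x Xx.
rewrite fg ?inE// ger0_norm ?subr_ge0 ?inf_conv_le//.
have Kd : K <= k%:R * d by rewrite -ler_pdivrMr.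
have := inf_conv_close x (ltW d0) Kd; lra.
Qed.

End lipschitz_approximation.

(** * Smooth functions *)

Section smooth_case.
Context {R : realType}.
Implicit Types n : nat.

Lemma box_compact n (A : @box R n) : compact (box_set A).
Proof.
have := @rV_compact R n (fun i => `[A.1 0 i, A.2 0 i]%classic)
  (fun i => @segment_compact R _ _).
congr compact; apply/seteqP; split=> x xA i; have := xA i; by rewrite /= in_itv.
Qed.

Lemma continuous_bounded_box n (A : @box R n) (f : 'rV[R]_n -> R) :
  continuous f -> exists M, forall x, box_set A x -> `|f x| <= M.
Proof.
move=> cf; have := continuous_compact (continuous_subspaceT cf) (box_compact (A := A)).
move=> /compact_bounded[M [_ /(_ (M + 1))]]; rewrite ltrDl ltr01 => /(_ isT) H.
by exists (M + 1) => x xA; apply: H; exists x.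
Qed.

Lemma is_derive_line n (f : 'rV[R]_n -> R) (x v : 'rV[R]_n) (t : R) :
  derivable f (x + t *: v) v ->
  is_derive t 1 (fun t => f (x + t *: v)) ('D_v f (x + t *: v)).
Proof.
move=> df.
have E : (fun h : R => h^-1 *: (((fun t => f (x + t *: v)) \o shift t) (h *: 1) -
    f (x + t *: v))) =
    (fun h : R => h^-1 *: ((f \o shift (x + t *: v)) (h *: v) - f (x + t *: v))).
  apply/funext => h /=; do 3 congr (_ _); rewrite [h *: 1]mulr1 scalerDl.
  by rewrite addrCA.
by apply: DeriveDef; rewrite /derivable /derive E.
Qed.

(** The mean value theorem on the segment between the clamped points, which stays in the convex box
    where the partial derivatives are bounded. *)
Lemma differential_bound_holder n (A : @box R n) (f : 'rV[R]_n -> R) (M : 'I_n -> R) :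
  proper_box A -> (forall x, differentiable f x) ->
  (forall k x, box_set A x -> `|'D_(delta_mx 0 k) f x| <= M k) ->
  sup_holder 1 (\sum_k M k) (f \o clamp A).
Proof.
move=> pA df fM x y r r0 xy; rewrite powRr1//= distrC.
set p := clamp A x; set q := clamp A y; set v := q - p.
pose phi (t : R) := f (p + t *: v).
have dphi (t : R) : is_derive t 1 phi ('D_v f (p + t *: v)).
  exact/is_derive_line/diff_derivable.
have cphi : continuous phi.
  move=> t; apply: differentiable_continuous; apply/derivable1_diffP.
  by have [] := dphi t.
have [c c01] := MVT_segment ler01 (fun t _ => dphi t) (continuous_subspaceT cphi).
rewrite /phi scale1r scale0r addr0 subr0 mulr1 [p + v]addrC subrK => ->.
rewrite deriveE// [X in 'd f _ X](row_sum_delta v) linear_sum mulr_suml.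
apply: le_trans (ler_norm_sum _ _ _) _; apply: ler_sum => k _.
rewrite linearZ/= -deriveE// normrM mulrC ler_pM//.
  apply: fM => i; have pi := clamp_in x pA i; have qi := clamp_in y pA i.
  move: c01 pi qi; rewrite in_itv/= -/p -/q !mxE.
  set u := p 0 i; set w := q 0 i => /andP[c0 c1] /andP[u1 u2] /andP[w1 w2].
  by apply/andP; split; nra.
have -> : v 0 k = q 0 k - p 0 k by rewrite !mxE.
rewrite distrC; exact: le_trans (clamp_dist _ _ _ _) (xy k).
Qed.

Lemma smooth_clamp_holder n (A : @box R n) (f : 'rV[R]_n -> R) :
  proper_box A -> smooth_fun f -> {M : R | sup_holder 1 M (f \o clamp A)}.
Proof.
move=> pA sf; have [df Df] := sf 2%N.
have dk k : {M : R | forall x, box_set A x -> `|'D_(delta_mx 0 k) f x| <= M}.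
  apply: cid; apply: continuous_bounded_box => x.
  exact/differentiable_continuous/(Df _).1.
exists (\sum_k sval (dk k)); apply: differential_bound_holder => // k.
exact: svalP (dk k).
Qed.

(** [wedge_std] is the Leibniz expansion of the Jacobian determinant; the two integrands agree off
    the null boundary, where [deriv_on] is set to zero. *)
Lemma integral_smooth_formula n (A : @box R n) :
  proper_box A -> smooth_formula A (@integral_fdg R n A).
Proof.
move=> pA f g sf sg.
have [M hf] := smooth_clamp_holder pA sf.
have hg i := svalP (smooth_clamp_holder pA (sg i)).
have a01 : 0 < (1 : R) <= 1 by rewrite ltr01 lexx.
rewrite (lipschitz_integral pA a01 hf hg (clamp_eq f) (fun i => clamp_eq (g i))).
have [N [mN N0 NA]] := box_boundary_negligible A.
apply: (integral_eq_off_null mN N0) => t At Nt; congr (_ * _)%:E.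
have it : (box_set A)° (row_of_tuple t : 'rV[R]_n).
  by apply: contrapT => nt; apply: Nt; apply: NA; split.
rewrite /deriv_on mem_set//.
have dg i : differentiable (g i) (row_of_tuple t) by have [] := sg i 1%N.
rewrite (differential_at_jacobian (differentiable_differential_at dg)).
apply: eq_bigr => s _; congr (_ * _); apply: eq_bigr => i _.
by rewrite mxE.
Qed.

End smooth_case.

(** Only the differentials are approximated: the Lipschitz formula already admits integrands of
    exponent [a], so [f] is kept as a constant sequence. *)
Lemma integral_unique (R : realType) n (A : @box R n) (a : R) (b : 'I_n -> R)
    (J : ('rV[R]_n -> R) -> ('I_n -> 'rV[R]_n -> R) -> R) :
  proper_box A -> admissible_exponents a b ->
  lipschitz_formula A a J -> holder_continuous A a b J ->
  forall f g, admissible A a b f g -> J f g = integral_fdg A f g.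
Proof.
move=> pA ab Jlip Jcont f g fg; have [_ b01 _] := ab.
have b0 i : 0 < b i by case/andP: (b01 i).
have [r r0 sA] := proper_small_box pA.
have C i := holder_clamp pA (b0 i) (fg.2 i).
have hC i := svalP (C i).
pose K i := sval (C i) * r `^ b i.
have gK i x y : (g i \o clamp A) x - (g i \o clamp A) y <= K i.
  apply: le_trans (ler_norm _) _ => /=.
  have := sup_holder_box (hC i) (ltW r0) sA (clamp_in x pA) (clamp_in y pA).
  by rewrite /= !(clamp_id (clamp_in _ pA)).
pose G k i := inf_conv (g i \o clamp A) k.
have GE k : J f (G k) = integral_fdg A f (G k).
  have hG i : holder (box_set A) 1 (G k i).
    by exists k%:R; apply/sup_holder_holder_bounds/inf_conv_lipschitz/gK.
  by apply: EFin_inj; rewrite Jlip ?(integral_lipschitz_formula pA ab)//; case: fg.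
have cvgG I : holder_continuous A a b I -> I f (G m) @[m --> \oo] --> I f g.
  move=> Icont; apply: (Icont (fun=> f)) => // [m||i||i].
  - split=> [|i]; first by case: fg.
    exists (sval (C i)); apply/sup_holder_holder_bounds/inf_conv_holder/gK.
    exact: hC.
  - by apply: cvg_uniform_dist => e e0; apply: nearW => m x _; rewrite subrr normr0.
  - by apply: inf_conv_cvg (b0 i) (hC i) (gK i) _ _ _; exact: clamp_eq.
  - by exists (holder_const (box_set A) a f).
  - exists (sval (C i)) => m; apply/holder_const_le/inf_conv_holder/gK.
    exact: hC.
apply: (cvg_unique _ (cvgG _ Jcont)) => //.
rewrite /= (funext GE : (fun m => J f (G m)) = _).
exact/cvgG/integral_holder_continuous.
Qed.

Theorem theorem3p2 (R : realType) (n : nat) (A : @box R n)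
    (a : R) (b : 'I_n -> R)
    (hA : proper_box A)
    (ha : 0 < a <= 1) (hb : forall i, 0 < b i <= 1)
    (hab : n%:R < a + \sum_i b i) :
  (forall f g, admissible A a b f g ->
     is_integral A f g (integral_fdg A f g) /\
     forall v, is_integral A f g v -> v = integral_fdg A f g) /\
  multilinear A a b (integral_fdg A) /\
  lipschitz_formula A a (integral_fdg A) /\
  smooth_formula A (integral_fdg A) /\
  holder_continuous A a b (integral_fdg A) /\
  (forall J : ('rV[R]_n -> R) -> ('I_n -> 'rV[R]_n -> R) -> R,
     lipschitz_formula A a J -> holder_continuous A a b J ->
     forall f g, admissible A a b f g -> J f g = integral_fdg A f g).
Proof.
have ab : admissible_exponents a b by [].
split=> [f g fg|]; first split.
- exact: admissible_is_integral fg.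
- by move=> v /(integral_fdg_eq hA).
split; first exact: integral_multilinear.
split; first exact: integral_lipschitz_formula.
split; first exact: integral_smooth_formula.
split; first exact: integral_holder_continuous.
by move=> J Jlip Jcont f g; exact: integral_unique ab Jlip Jcont f g.
Qed.
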